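(* There exists an algorithm that, given a graph $G=(V,E)$ whose edges are coloured black or white, outputs every maximal \textsc{bc}-clique of $G$ exactly once, with delay $O(q^5|V|^2)$ and using $O(q)$ additional space, where $q$ is the maximum size of a \textsc{bc}-clique of $G$.
   Context: Let $G_B$ be the spanning subgraph of $G$ containing only the black edges. A \textsc{bc}-clique is a vertex set $C\subseteq V$ that is a clique in $G$ and induces a connected subgraph of $G_B$; it is maximal if not strictly contained in another \textsc{bc}-clique. The delay of an enumeration algorithm is the maximum time elapsed between the start and the first output, between two consecutive outputs, and between the last output and termination. Additional space is the working memory used beyond the read-only input. *)

(* Defs.v *)
From mathcomp Require Import all_boot.
Set Implicit Arguments. Unset Strict Implicit. Unset Printing Implicit Defensive.

(* A graph on vertex set 'I_n is a symmetric irreflexive relation e;   *)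
(* the colouring is a symmetric relation b: an edge {x,y} of G is      *)
(* black iff b x y, white otherwise.                                   *)

Definition black_edge (n : nat) (e b : rel 'I_n) : rel 'I_n :=
  fun x y => e x y && b x y.

Definition is_clique (n : nat) (e : rel 'I_n) (C : {set 'I_n}) : bool :=
  [forall x in C, forall y in C, (x != y) ==> e x y].

Definition black_connected (n : nat) (e b : rel 'I_n) (C : {set 'I_n}) : bool :=
  (C != set0) &&
  [forall x in C, forall y in C,
    connect [rel u v | [&& u \in C, v \in C & black_edge e b u v]] x y].

Definition bc_clique (n : nat) (e b : rel 'I_n) (C : {set 'I_n}) : bool :=
  is_clique e C && black_connected e b C.

Definition maximal_bc_clique (n : nat) (e b : rel 'I_n) (C : {set 'I_n}) : Prop :=
  bc_clique e b C /\
  forall D : {set 'I_n}, bc_clique e b D -> C \subset D -> D = C.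

Definition max_bc_size (n : nat) (e b : rel 'I_n) : nat :=
  \max_(C : {set 'I_n} | bc_clique e b C) #|C|.

(* Machine model: a word-RAM with read-only oracle access to the input *)
(* Registers r[0], r[1], ... hold natural numbers (words), all         *)
(* initially 0.  The input graph is read-only and accessed through the *)
(* adjacency (matrix) queries IAdj / IBlack, each in unit time.        *)
(* Every instruction costs one time unit.  IOut i emits the vertex     *)
(* r[i]; ISep ends the current output set (one solution).              *)

Inductive instr : Type :=
| IConst of nat & nat
| IN of nat
| IAdd of nat & nat & nat
| ISub of nat & nat & nat      (* r[i] := r[j] - r[k] (truncated) *)
| ILoad of nat & nat
| IStore of nat & nat
| IAdj of nat & nat & nat
| IBlack of nat & nat & nat
| IJz of nat & nat
| IJmp of nat
| IOut of nat
| ISep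
| IHalt.

Definition program := seq instr.

Inductive event : Type := ENone | EOut of nat | ESep.

Record config := Cfg { pc : nat; mem : nat -> nat }.

Definition upd (m : nat -> nat) (a v : nat) : nat -> nat :=
  fun x => if x == a then v else m x.

Record input := Input { in_n : nat; in_e : nat -> nat -> bool; in_b : nat -> nat -> bool }.

Definition lift_rel (n : nat) (r : rel 'I_n) : nat -> nat -> bool :=
  fun x y => match @insub nat (fun k => k < n) 'I_n x,
                   @insub nat (fun k => k < n) 'I_n y with
             | Some x', Some y' => r x' y'
             | _, _ => false
             end.

Definition graph_input (n : nat) (e b : rel 'I_n) : input :=
  Input n (lift_rel e) (lift_rel (black_edge e b)).

Definition halted (P : program) (c : config) : bool :=
  if nth IHalt P (pc c) is IHalt then true else false.

Definition step (P : program) (I : input) (c : config) : config * event :=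
  let m := mem c in
  let nx := (pc c).+1 in
  match nth IHalt P (pc c) with
  | IConst i k => (Cfg nx (upd m i k), ENone)
  | IN i => (Cfg nx (upd m i (in_n I)), ENone)
  | IAdd i j k => (Cfg nx (upd m i (m j + m k)), ENone)
  | ISub i j k => (Cfg nx (upd m i (m j - m k)), ENone)
  | ILoad i j => (Cfg nx (upd m i (m (m j))), ENone)
  | IStore i j => (Cfg nx (upd m (m i) (m j)), ENone)
  | IAdj i j k => (Cfg nx (upd m i (nat_of_bool (in_e I (m j) (m k)))), ENone)
  | IBlack i j k => (Cfg nx (upd m i (nat_of_bool (in_b I (m j) (m k)))), ENone)
  | IJz i l => (Cfg (if m i == 0 then l else nx) m, ENone)
  | IJmp l => (Cfg l m, ENone)
  | IOut i => (Cfg nx m, EOut (m i))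
  | ISep => (Cfg nx m, ESep)
  | IHalt => (c, ENone)
  end.

Definition init_config : config := Cfg 0 (fun _ => 0).

Fixpoint conf (P : program) (I : input) (t : nat) : config :=
  if t is t'.+1 then (step P I (conf P I t')).1 else init_config.

Definition event_at (P : program) (I : input) (t : nat) : event :=
  (step P I (conf P I t)).2.

Definition halts_at (P : program) (I : input) (T : nat) : Prop :=
  halted P (conf P I T) /\ forall t, t < T -> ~~ halted P (conf P I t).

Fixpoint blocks (cur : seq nat) (evs : seq event) : seq (seq nat) :=
  match evs with
  | [::] => [::]
  | EOut v :: es => blocks (rcons cur v) es
  | ESep :: es => cur :: blocks [::] es
  | ENone :: es => blocks cur es
  end.

Definition outputs (P : program) (I : input) (T : nat) : seq (seq nat) :=
  blocks [::] [seq event_at P I t | t <- iota 0 T].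

(* delay at most D: every window of D consecutive steps before       *)
(* termination completes an output (covers start->first output,      *)
(* between consecutive outputs, last output->termination)            *)
Definition delay_le (P : program) (I : input) (T D : nat) : Prop :=
  forall t, t + D <= T -> exists2 s, t <= s < t + D & event_at P I s = ESep.

(* additional space at most S words, each word of O(log n) bits:     *)
(* only registers 0..S-1 are ever nonzero, and every register value  *)
(* stays below (n+2)^k                                               *)
Definition space_le (P : program) (I : input) (T S k : nat) : Prop :=
  forall t, t <= T ->
    (forall a, S <= a -> mem (conf P I t) a = 0) /\
    (forall a, mem (conf P I t) a < (in_n I).+2 ^ k).

Definition as_vset (n : nat) (s : seq nat) : {set 'I_n} :=
  [set v : 'I_n | val v \in s].

Definition enumerates_maximal_bc_cliques (n : nat) (e b : rel 'I_n)
    (outs : seq (seq nat)) : Prop :=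
  all (fun s => all (fun v => v < n) s) outs /\
  uniq [seq as_vset n s | s <- outs] /\
  forall C : {set 'I_n},
    C \in [seq as_vset n s | s <- outs] <-> maximal_bc_clique e b C.

(* Main.v *)
Require Import Defs.
From mathcomp Require Import all_boot.
From mathcomp Require Import zify.
Set Implicit Arguments. Unset Strict Implicit. Unset Printing Implicit Defensive.

(** Reverse search.  A solution is written as the sequence obtained from its least vertex by
    repeatedly adding, among its vertices that see the current sequence through a black edge, the
    one of least key (position of its first black neighbour, vertex).  A key never changes once it
    exists, so the greedy completion of a prefix is found in one sweep over all keys.  The parent
    of S is the completion of its longest prefix that does not complete to S; the vertex v that
    follows this prefix and the first vertex s of S recover S from its parent P, because the same
    greedy rule, restricted to v and its neighbours in P and started at s, replays the prefix.  The
    empty sequence is the parent of the solutions that have no other parent.  The sequences of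
    keys decrease lexicographically towards the parent, so this is a tree, with at most n (q + 1)
    candidate pairs (v, s) below each node.  The tree is traversed without a stack, since parent, v
    and s can be recomputed; entering solutions of even depth and leaving those of odd depth
    produces the output, which keeps the number of candidates tested between two outputs in
    O(q n), each test costing O(q^3 n). *)

(** The neighbours of v in P may fall into several black-connected pieces, so v alone does not
    determine the lost prefix: s selects the piece in which the replay starts, and reaching v ends
    it. Most pairs (v, s) do not come from a child. Each pair is therefore checked by recomputing
    the parent of the solution it produces, and this check replaces any record of visited solutions.
    The program is never told q. This number enters only the analysis, through the fact that every
    valid sequence has at most q vertices, so no memory region can be reserved in advance by its
    size and no loop can be bounded by q. Delay and space constrain every single machine step, not
    only the final result. For this reason the program is written in a small structured language
    whose semantics records one event per machine instruction. Time bounds are lengths of traces,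
    proved in a program logic, and the compiler preserves the trace literally. *)

Record black_white (n : nat) (E K : rel nat) : Prop := BlackWhite {
  bw_sym : symmetric E;
  bw_irr : irreflexive E;
  bw_lt : forall x y, E x y -> x < n;
  bw_black_sym : symmetric K;
  bw_black_edge : forall x y, K x y -> E x y }.

(** * Candidates for extending a sequence, and their keys *)

Section Graph.
Variables (n : nat) (E K : rel nat).
Hypothesis G : black_white n E K.
Local Notation Esym := (bw_sym G).
Local Notation Eirr := (bw_irr G).
Local Notation Elt := (bw_lt G).
Local Notation Ksym := (bw_black_sym G).
Local Notation KE := (bw_black_edge G).

Implicit Types (F : pred nat) (X Y S T P : seq nat).

(** For vertices below [n] this packs the pair (position, vertex) into one number: comparison is
    lexicographic, and a double loop over positions and vertices meets keys in increasing order.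
    Without a black neighbour in [X], [find] returns [size X], so such a vertex ranks after all
    attached ones. *)
Definition key X u := find (K u) X * n + u.
Definition cand F X u := [&& F u, all (E u) X & has (K u) X].

Lemma cand_lt F X u : cand F X u -> u < n.
Proof. by case/and3P=> _ _ /hasP[x _ /KE/Elt]. Qed.

Lemma cand_notin F X u : cand F X u -> u \notin X.
Proof.
by case/and3P=> _ /allP a _; apply/negP => /a /=; rewrite Eirr.
Qed.

Lemma candT F X u : cand F X u -> cand predT X u.
Proof. by case/and3P=> _ a b; apply/and3P. Qed.

Lemma eq_cand F F' X u : F =1 F' -> cand F X u = cand F' X u.
Proof. by rewrite /cand => ->. Qed.

Lemma cand_eq_mem F X Y u : X =i Y -> cand F X u = cand F Y u.
Proof. by move=> e; rewrite /cand (eq_all_r e) (eq_has_r e). Qed.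

Lemma key_inj X u w : u < n -> w < n -> key X u = key X w -> u = w.
Proof.
move=> hu hw /(congr1 (modn^~ n)).
by rewrite /key !modnMDl !modn_small.
Qed.

(** * Valid sequences *)

Definition valid X :=
  (forall x, x \in X -> x < n) /\
  (forall l, 0 < l < size X -> cand predT (take l X) (nth 0 X l)).

Lemma valid_nil : valid [::].
Proof. by split=> // l; rewrite andbC. Qed.

Lemma valid1 s : s < n -> valid [:: s].
Proof. by move=> h; split=> [x|[|l]] //; rewrite inE => /eqP->. Qed.

Lemma take_nth_lt X Y l i : i < l -> take l X = take l Y -> nth 0 X i = nth 0 Y i.
Proof. by move=> h e; rewrite -(nth_take 0 h) e nth_take. Qed.

Lemma mem_take_nth X i l : i < l -> i < size X -> nth 0 X i \in take l X.
Proof. by move=> il iX; rewrite -(nth_take 0 il) mem_nth // size_take_min leq_min il. Qed.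

Lemma valid_take l X : valid X -> valid (take l X).
Proof.
case=> a b; split=> [x /mem_take/a //|k].
rewrite size_take_min leq_min => /and3P[h1 h2 h3].
by rewrite (take_takel _ (ltnW h2)) nth_take //; apply: b; rewrite h1.
Qed.

Lemma valid_rcons X u : valid X -> cand predT X u -> valid (rcons X u).
Proof.
case=> a b c; split=> [x|l].
  by rewrite mem_rcons inE => /orP[/eqP->|/a //]; apply: cand_lt c.
rewrite size_rcons ltnS => /andP[l0]; rewrite leq_eqVlt => /orP[/eqP->|h].
  by rewrite -cats1 take_size_cat // nth_cat ltnn subnn.
by rewrite -cats1 takel_cat 1?ltnW // nth_cat h; apply: b; rewrite l0.
Qed.

Lemma valid_clique X x y : valid X -> x \in X -> y \in X -> x != y -> E x y.
Proof.
case=> _ v.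
have aux i j : i < j -> j < size X -> E (nth 0 X j) (nth 0 X i).
  move=> ij jX; have /v/and3P[_ /allP a _] : 0 < j < size X by lia.
  by apply: a; apply: mem_take_nth => //; apply: ltn_trans jX.
move=> /(nthP 0)[i iX <-] /(nthP 0)[j jX <-] ne.
case: (ltngtP i j) => [h|h|h]; last by rewrite h eqxx in ne.
  by rewrite Esym aux.
exact: aux.
Qed.

Lemma valid_uniq X : valid X -> uniq X.
Proof.
case=> a b; apply/(uniqP 0) => i j.
wlog ij : i j / i < j.
  move=> H iX jX e; case: (ltngtP i j) => // h; first exact: (H i j).
  by apply/esym/(H j i).
rewrite !inE => iX jX e; exfalso.
have /b/cand_notin : 0 < j < size X by rewrite (leq_ltn_trans _ ij).
by rewrite -e mem_take_nth // (ltn_trans ij).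
Qed.

Lemma valid_size X : valid X -> size X <= n.
Proof.
move=> v; rewrite -[n in _ <= n](size_iota 0); apply: uniq_leq_size.
  exact: valid_uniq.
by move=> x /(proj1 v); rewrite mem_iota add0n.
Qed.

(** Black connectivity in terms of cuts: any property that separates two vertices of [X] is crossed
    by a black edge inside [X]. *)
Lemma valid_exit X (Y : pred nat) y z : valid X -> y \in X -> Y y -> z \in X -> ~~ Y z ->
  exists x w, [/\ x \in X, w \in X, Y x, ~~ Y w & K w x].
Proof.
case=> _ v yX Yy zX Yz.
have X0 : 0 < size X by case: (X) yX.
(* When [Q] holds at the first vertex, the first later vertex violating [Q] has its black neighbour
   among earlier ones, which satisfy [Q]. Otherwise the same argument is applied to the complement
   and the edge is reversed. *)
have step (Q : pred nat) : Q (nth 0 X 0) -> (exists2 w, w \in X & ~~ Q w) ->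
    exists x w, [/\ x \in X, w \in X, Q x, ~~ Q w & K w x].
  move=> q0 [w wX qw].
  have hX : has (predC Q) X by apply/hasP; exists w.
  have qn := nth_find 0 hX; move: hX; rewrite has_find => hX.
  set j := find _ _ in qn hX.
  have j0 : 0 < j by rewrite lt0n; apply/eqP=> e; rewrite e /= q0 in qn.
  have /v/and3P[_ _ /hasP[x xj kx]] : 0 < j < size X by lia.
  exists x, (nth 0 X j); split=> //; first exact: mem_take xj.
    exact: mem_nth.
  have /(nthP 0)[i iX <-] := xj; move: iX; rewrite size_take hX => iX.
  by rewrite nth_take //; have := before_find 0 iX; rewrite /= => /negbFE.
case: (boolP (Y (nth 0 X 0))) => [h|h].
  by apply: step => //; exists z.
have [|x [w [? ? h1 h2 k]]] := step (predC Y) h; first by exists y; rewrite //= negbK.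
by exists w, x; split=> //; [rewrite -[Y w]negbK | rewrite Ksym].
Qed.

(** * Greedy completions *)

Definition argmin_key F X u :=
  cand F X u /\ forall w, cand F X w -> key X u <= key X w.

(** A relation rather than a function: the fuelled recursion, the sweep of the program and the tails
    of solutions are all shown to satisfy it, and [greedy_inj] then identifies their results. *)
Definition greedy F X Y :=
  [/\ take (size X) Y = X,
      forall l, size X <= l < size Y -> argmin_key F (take l Y) (nth 0 Y l)
    & forall u, ~~ cand F Y u].

Lemma argmin_key_inj F X u w : argmin_key F X u -> argmin_key F X w -> u = w.
Proof.
move=> [cu hu] [cw hw]; apply: (@key_inj X); [exact: cand_lt cu|exact: cand_lt cw|].
by apply/eqP; rewrite eqn_leq hu // hw.
Qed.

Lemma take_S_nth X l : l < size X -> take l.+1 X = rcons (take l X) (nth 0 X l).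
Proof. by move=> h; rewrite (take_nth 0). Qed.

Lemma greedy_inj F X Y Z : greedy F X Y -> greedy F X Z -> Y = Z.
Proof.
move=> [y1 y2 y3] [z1 z2 z3].
have H l : take l Y = take l Z.
  elim: l => [|l IH]; first by rewrite !take0.
  case: (leqP (size X) l) => lX; last first.
    have t (Z' : seq nat) : take l.+1 Z' = take l.+1 (take (size X) Z') by rewrite take_takel.
    by rewrite t y1 (t Z) z1.
  case: (ltnP l (size Y)) => lY; case: (ltnP l (size Z)) => lZ.
  - rewrite !take_S_nth // -IH; congr rcons; apply: (@argmin_key_inj F (take l Y)).
      by apply: y2; rewrite lX.
    by rewrite IH; apply: z2; rewrite lX.
  - have /y2[+ _] : size X <= l < size Y by rewrite lX.
    by rewrite IH take_oversize // => c; move: (z3 (nth 0 Y l)); rewrite c.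
  - have /z2[+ _] : size X <= l < size Z by rewrite lX.
    by rewrite -IH take_oversize // => c; move: (y3 (nth 0 Z l)); rewrite c.
  by move: IH; rewrite !take_oversize // ltnW // ltnS.
have := H (maxn (size Y) (size Z)).
by rewrite !take_oversize // ?leq_maxl ?leq_maxr.
Qed.

Lemma greedy_ext F F' X Y : F =1 F' -> greedy F X Y -> greedy F' X Y.
Proof.
move=> e [a b c]; split=> // [l /b[h1 h2]|u]; last by rewrite -(eq_cand _ _ e).
by split=> [|w]; rewrite -(eq_cand _ _ e) //; apply: h2.
Qed.

Lemma greedy_stop F X : (forall u, ~~ cand F X u) -> greedy F X X.
Proof. by move=> h; split=> // [|l]; rewrite ?take_size //; case: ltngtP. Qed.

Lemma greedy_valid F X Y : valid X -> greedy F X Y -> valid Y.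
Proof.
move=> vX [a b c].
have sXY : size X <= size Y by rewrite -{1}a size_take_min; lia.
have H l : size X <= l <= size Y -> valid (take l Y).
  elim: l => [|l IH] h; first by rewrite take0; apply: valid_nil.
  case: (ltngtP (size X) l.+1) (h) => [h1 _|h1|<- _]; [|lia|by rewrite a].
  have hl : l < size Y by lia.
  rewrite take_S_nth //; apply: valid_rcons; first by apply: IH; lia.
  by apply: (@candT F); case: (b l); first lia.
by rewrite -(take_size Y); apply: H; rewrite leqnn andbT.
Qed.

Lemma greedy_mem F X Y y : greedy F X Y -> y \in Y -> y \in X \/ F y.
Proof.
move=> [a b c] /(nthP 0)[i iY <-]; case: (ltnP i (size X)) => h.
  by left; rewrite -a mem_take_nth // (leq_trans h) // -a size_take_min geq_minr.
by right; case: (b i) => [|/and3P[]]; first by rewrite h.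
Qed.

Lemma greedy_sub F X Y x : greedy F X Y -> x \in X -> x \in Y.
Proof. by case=> a _ _; rewrite -{1}a => /mem_take. Qed.

Lemma greedy_take F X Y l : greedy F X Y -> size X <= l -> greedy F (take l Y) Y.
Proof.
move=> [a b c] h; case: (leqP (size Y) l) => hl.
  by rewrite take_oversize //; apply: greedy_stop.
split=> // [|k]; rewrite size_take hl // => hk; apply: b; lia.
Qed.

Lemma exists_argmin F X u : cand F X u -> exists w, argmin_key F X w.
Proof.
move=> cu.
pose Q k := has (fun w => cand F X w && (key X w == k)) (iota 0 n).
have exQ : exists k, Q k.
  exists (key X u); apply/hasP; exists u; rewrite ?mem_iota ?(cand_lt cu) //=.
  by rewrite cu eqxx.
case: (ex_minnP exQ) => k /hasP[w _ /andP[cw /eqP<-]] H.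
exists w; split=> // x cx; apply: H; apply/hasP; exists x.
  by rewrite mem_iota (cand_lt cx).
by rewrite cx eqxx.
Qed.

Definition next F X : option nat :=
  ohead [seq u <- iota 0 n |
    cand F X u && all (fun w => cand F X w ==> (key X u <= key X w)) (iota 0 n)].

Lemma nextP F X :
  if next F X is Some u then argmin_key F X u else forall u, ~~ cand F X u.
Proof.
rewrite /next; case E1: [seq _ <- _ | _] => [|u s] /=.
  move=> u; apply/negP => /exists_argmin[w [cw hw]].
  suff: w \in [::] by [].
  rewrite -E1 mem_filter mem_iota (cand_lt cw) cw /= andbT.
  by apply/allP=> x _; apply/implyP/hw.
have : u \in u :: s by rewrite inE eqxx.
rewrite -E1 mem_filter => /andP[/andP[cu /allP h] _]; split=> // w cw.
by have := h w; rewrite mem_iota (cand_lt cw) cw; apply.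
Qed.

Fixpoint complete_rec k F X :=
  if k is k'.+1 then
    if next F X is Some u then complete_rec k' F (rcons X u) else X
  else X.

Definition complete F X := complete_rec n F X.

Lemma greedy_cons F X Y u : argmin_key F X u -> greedy F (rcons X u) Y -> greedy F X Y.
Proof.
move=> m [a b c]; rewrite size_rcons in a b.
have sY : size X < size Y.
  by have := congr1 size a; rewrite size_take size_rcons; case: ltngtP; lia.
have tX : take (size X) Y = X.
  by rewrite -(@take_takel _ _ (size X).+1) // a -cats1 take_size_cat.
split=> // l; case: (ltngtP (size X) l) => // [h|<-] hl; first by apply: b; lia.
move: a; rewrite take_S_nth // tX => /rcons_inj[->]; exact: m.
Qed.

Lemma complete_greedy F X : valid X -> greedy F X (complete F X).
Proof.
(* Generalised for the induction: fuel plus current length is at least [n]. A valid sequence has at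
   most [n] vertices, so the fuel cannot run out while a candidate remains. *)
rewrite /complete => vX; have : n <= n + size X by rewrite leq_addr.
elim: {2 3}n X vX => [|k IH] X vX h /=.
  apply: greedy_stop => u; apply/negP => c.
  have /valid_size := valid_rcons vX (candT c); rewrite size_rcons; lia.
have := nextP F X; case: next => [u|] m; last exact: greedy_stop.
apply: (greedy_cons m); apply: IH; last by rewrite size_rcons; lia.
by apply: valid_rcons => //; apply: candT m.1.
Qed.

Lemma completeE F X Y : valid X -> greedy F X Y -> complete F X = Y.
Proof. by move=> v g; apply: greedy_inj g; apply: complete_greedy. Qed.

Lemma complete_valid F X : valid X -> valid (complete F X).
Proof. by move=> v; apply: greedy_valid (complete_greedy F v). Qed.

Lemma complete_ext F F' X : valid X -> F =1 F' -> complete F X = complete F' X.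
Proof.
by move=> v e; apply: completeE => //; apply/(greedy_ext (fsym e))/complete_greedy.
Qed.

Lemma complete_max F X u : valid X -> ~~ cand F (complete F X) u.
Proof. by case/(complete_greedy F). Qed.

(** Nothing is attached to the empty sequence. Hence the prefix of length 0 never completes to a
    solution, and the downward search for the parent position always succeeds. *)
Lemma complete_nil F : complete F [::] = [::].
Proof. by apply: completeE valid_nil _; apply: greedy_stop => u; rewrite /cand andbF. Qed.

Lemma sub_complete F X x : valid X -> x \in X -> x \in complete F X.
Proof. by move=> v; apply/greedy_sub/complete_greedy. Qed.

Notation completeT := (complete predT).

(* The black neighbour through which u is first attached does not change when X grows. *)
Lemma key_cat X Y u : has (K u) X -> key (X ++ Y) u = key X u.
Proof. by move=> h; rewrite /key find_cat h. Qed.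

(** A vertex attached only by later entries ranks after everything attached before, so growth never
    creates a candidate behind the sweep. *)
Lemma key_cat_ge X Y u : ~~ has (K u) X -> size X * n <= key (X ++ Y) u.
Proof. by move=> h; rewrite /key find_cat (negPf h); nia. Qed.

Lemma key_lt X u : u < n -> has (K u) X -> key X u < size X * n.
Proof. by rewrite /key has_find => h1 h2; nia. Qed.

(* The state of a sweep over all pairs (position a, vertex u) in increasing order of a n + u:
   candidates of smaller key have been dealt with. *)
Definition partial_greedy F X0 X p :=
  [/\ valid X, take (size X0) X = X0,
      forall l, size X0 <= l < size X -> argmin_key F (take l X) (nth 0 X l)
    & forall w, cand F X w -> p <= key X w].

Lemma partial_greedy0 F X : valid X -> partial_greedy F X X 0.
Proof. by move=> v; split=> // [|l]; rewrite ?take_size //; case: ltngtP. Qed.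

Lemma key_le X a u : a < size X -> K (nth 0 X a) u -> u < n -> key X u <= a * n + u.
Proof.
move=> aX k un; rewrite /key leq_add2r leq_mul2r; apply/orP; right.
by rewrite leqNgt; apply/negP => /(before_find 0); rewrite Ksym k.
Qed.

Lemma key_eq X a u w : u < n -> w < n -> key X w = a * n + u -> w = u /\ find (K w) X = a.
Proof.
move=> un wn e; have wu : w = u.
  by move/(congr1 (modn^~ n)): e; rewrite /key !modnMDl !modn_small.
by split=> //; move: e; rewrite wu /key; nia.
Qed.

(** The sweep need not restart after a push. A candidate attached earlier keeps its key, which
    differs from that of [u]; one first attached through [u] has key at least [size X * n], beyond
    the current row. *)
Lemma partial_greedy_push F X0 X a u : partial_greedy F X0 X (a * n + u) ->
  a < size X -> u < n -> F u -> K (nth 0 X a) u -> all (E u) X ->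
  partial_greedy F X0 (rcons X u) (a * n + u.+1).
Proof.
move=> [v t gr mn] aX un fu ku au.
have cu : cand F X u.
  apply/and3P; split=> //; apply/hasP; exists (nth 0 X a); rewrite ?mem_nth //.
  by rewrite Ksym.
have eu : key X u = a * n + u by apply/eqP; rewrite eqn_leq key_le ?mn.
have sX : size X0 <= size X by rewrite -{1}t size_take_min geq_minr.
split.
- by apply: valid_rcons => //; apply: candT cu.
- by rewrite -cats1 takel_cat.
- move=> l; rewrite size_rcons ltnS [l <= _]leq_eqVlt => /andP[h1 /orP[/eqP->|h2]].
    rewrite -cats1 take_size_cat // nth_cat ltnn subnn /=; split=> // w /mn.
    by rewrite eu.
  by rewrite -cats1 takel_cat 1?ltnW // nth_cat h2; apply: gr; rewrite h1.
move=> w cw; have wn := cand_lt cw; have := cand_notin cw; rewrite mem_rcons inE negb_or => /andP[wu _].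
case: (boolP (has (K w) X)) => hw; last first.
  have h1 : a.+1 * n <= size X * n by rewrite leq_mul2r aX orbT.
  by have := key_cat_ge [:: u] hw; rewrite -cats1; lia.
rewrite -cats1 key_cat // addnS ltn_neqAle; apply/andP; split.
  by apply: contra wu => /eqP/esym/(key_eq un wn)[->].
apply: mn; case/and3P: cw => f; rewrite all_rcons => /andP[_ aw] _.
by apply/and3P.
Qed.

Lemma partial_greedy_skip F X0 X a u : partial_greedy F X0 X (a * n + u) ->
  a < size X -> u < n -> ~~ [&& F u, K (nth 0 X a) u & all (E u) X] ->
  partial_greedy F X0 X (a * n + u.+1).
Proof.
move=> [v t gr mn] aX un nc; split=> // w cw; rewrite addnS ltn_neqAle mn // andbT.
apply: contra nc => /eqP/esym/(key_eq un (cand_lt cw))[wu fa]; subst w.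
case/and3P: cw => -> -> hw; rewrite andbT /= Ksym -fa.
exact: nth_find.
Qed.

Lemma partial_greedy_stop F X0 X : partial_greedy F X0 X (size X * n) -> greedy F X0 X.
Proof.
move=> [v t gr mn]; split=> // u; apply/negP => c; have /and3P[_ _ hu] := c.
by have := mn u c; rewrite leqNgt key_lt // (cand_lt c).
Qed.

(** * Canonical orders *)

Definition least X := foldr minn n X.

Lemma least_le X x : x \in X -> least X <= x.
Proof.
elim: X => //= y X IH; rewrite inE geq_min => /orP[/eqP->|/IH->]; last exact: orbT.
by rewrite leqnn.
Qed.

Lemma least_mem X : X != [::] -> (forall x, x \in X -> x < n) -> least X \in X.
Proof.
elim: X => //= y X IH _ h; case: (altP (X =P [::])) => [->|X0] /=.
  by rewrite (minn_idPl _) ?mem_head // ltnW // h // mem_head.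
have IX : least X \in X by apply: IH => // x xX; apply: h; rewrite inE xX orbT.
by rewrite inE /minn; case: ifP; rewrite ?eqxx ?IX ?orbT.
Qed.

Lemma least_eq_mem X Y : X =i Y -> (forall x, x \in X -> x < n) -> least X = least Y.
Proof.
move=> e h.
have h' x : x \in Y -> x < n by rewrite -e; apply: h.
case: (altP (X =P [::])) => [X0|X0].
  by case: Y e {h'} => [|y Y] e; rewrite X0 //; have := e y; rewrite X0 mem_head.
have Y0 : Y != [::].
  by apply: contra_neq X0 => Y0; case: X e {h} => // x X /(_ x); rewrite Y0 mem_head.
apply/eqP; rewrite eqn_leq least_le ?e ?least_mem //.
by rewrite least_le // -e least_mem.
Qed.

(** The empty sequence is treated apart because its [least] is [n], which is not a vertex. *)
Definition canon X := if X is [::] then [::] else complete (mem X) [:: least X].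

Lemma canonE X : X != [::] -> canon X = complete (mem X) [:: least X].
Proof. by case: X. Qed.

Lemma least_valid X : X != [::] -> valid X -> valid [:: least X].
Proof. by move=> X0 v; apply/valid1/(proj1 v)/least_mem => //; case: v. Qed.

(** If the restricted greedy rule stopped early, [valid_exit] would give a black edge leaving the
    part reached, and its outer end would still be a candidate because [X] is a clique. *)
Lemma mem_canon X : valid X -> canon X =i X.
Proof.
move=> v; case: (altP (X =P [::])) => [->|X0] // x; rewrite canonE //.
have v1 := least_valid X0 v; have mX := least_mem X0 (proj1 v).
have g := complete_greedy (mem X) v1.
set Y := complete _ _ in g *.
have YX z : z \in Y -> z \in X by case/(greedy_mem g) => //; rewrite inE => /eqP->.
have mY : least X \in Y by apply: greedy_sub g _; rewrite mem_head.
apply/idP/idP => [/YX //|xX]; apply/negPn/negP => xY.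
have [y [w [yX wX yY wY k]]] := valid_exit (Y := mem Y) v mX mY xX xY.
case: g => _ _ /(_ w)/negP[]; apply/and3P; split=> //.
  apply/allP => z zY; apply: (valid_clique v) => //; first exact: YX.
  by apply: contraNneq wY => ->.
by apply/hasP; exists y.
Qed.

Lemma canon_eq_mem X Y : valid X -> X =i Y -> canon X = canon Y.
Proof.
move=> v e; case: (altP (X =P [::])) => [X0|X0].
  by case: Y e => [|y Y] e; rewrite X0 //; have := e y; rewrite X0 mem_head.
have Y0 : Y != [::].
  by apply: contra_neq X0 => Y0; case: X e {v} => // x X /(_ x); rewrite Y0 mem_head.
rewrite !canonE // -(least_eq_mem e (proj1 v)); apply: complete_ext => //.
exact: least_valid.
Qed.

Lemma canon_valid X : valid X -> valid (canon X).
Proof.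
move=> v; case: (altP (X =P [::])) => [->|X0]; first exact: valid_nil.
by rewrite canonE //; apply/complete_valid/least_valid.
Qed.

(** Fixing the canonical order leaves one sequence per maximal vertex set, so solutions can be
    compared as sequences. *)
Definition sol X :=
  [/\ X != [::], valid X, canon X = X & forall u, ~~ cand predT X u].

Lemma eq_mem_neq0 X Y : X =i Y -> X != [::] -> Y != [::].
Proof. by move=> e; apply: contra_neq => Y0; case: X e => // x X /(_ x); rewrite Y0 mem_head. Qed.

Lemma sol_canon X : X != [::] -> valid X -> (forall u, ~~ cand predT X u) -> sol (canon X).
Proof.
move=> X0 v m; have e := mem_canon v; split.
- by apply: eq_mem_neq0 X0 => x; rewrite e.
- exact: canon_valid.
- by apply: canon_eq_mem => //; apply: canon_valid.
by move=> u; rewrite (cand_eq_mem _ _ e).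
Qed.

Lemma complete_neq0 F X : X != [::] -> valid X -> complete F X != [::].
Proof.
case: X => // x X _ v; apply/eqP => e.
by have := sub_complete F v (mem_head x X); rewrite e in_nil.
Qed.

Lemma sol_complete X : X != [::] -> valid X -> sol (canon (completeT X)).
Proof.
move=> X0 v; apply: sol_canon; first exact: complete_neq0.
  exact: complete_valid.
by move=> u; apply: complete_max.
Qed.

Lemma sol_greedy S : sol S -> greedy (mem S) [:: least S] S.
Proof. by case=> S0 v c _; rewrite -{3}c canonE //; apply/complete_greedy/least_valid. Qed.

Lemma sol_head S : sol S -> nth 0 S 0 = least S.
Proof. by move=> /sol_greedy[e _ _]; rewrite -(@nth_take 1) // e. Qed.

(** * Parents *)

(** Searching downwards finds the longest prefix with another completion, and lets the program
    follow with a decreasing counter. *)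
Fixpoint parent_pos_rec k S :=
  if k is i.+1 then if completeT (take i S) == S then parent_pos_rec i S else i else 0.
Definition parent_pos S := parent_pos_rec (size S) S.

Definition parent_info S : seq nat * nat * nat :=
  (canon (completeT (take (parent_pos S) S)), nth 0 S (parent_pos S), nth 0 S 0).

Lemma parent_pos_recP k S : 0 < k -> S != [::] ->
  [/\ parent_pos_rec k S < k, completeT (take (parent_pos_rec k S) S) != S &
      forall i, parent_pos_rec k S < i < k -> completeT (take i S) = S].
Proof.
move=> k0 S0; elim: k k0 => // k IH _ /=; case: eqP => [e|/eqP e]; last by split=> //; lia.
have k1 : 0 < k by case: k e {IH} => //; rewrite take0 complete_nil => e; rewrite -e in S0.
have [h1 h2 h3] := IH k1; split=> //; first exact: ltnW.
move=> i; case: (ltngtP i k) => // [h|h|-> //] h'; [apply: h3|]; lia.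
Qed.

(** The whole of [S] completes to itself because a solution has no candidate; the empty prefix does
    not. The search therefore stops at a proper prefix. Lengths beyond [size S] only repeat the
    whole sequence. *)
Lemma parent_posP S : sol S ->
  [/\ parent_pos S < size S, completeT (take (parent_pos S) S) != S &
      forall i, parent_pos S < i -> completeT (take i S) = S].
Proof.
case=> S0 v c m; have [|h1 h2 h3] := @parent_pos_recP (size S) S _ S0; first by case: (S) S0.
split=> // i hi; case: (ltnP i (size S)) => h; first by apply: h3; rewrite hi.
by rewrite take_oversize //; apply: completeE => //; apply: greedy_stop.
Qed.

Definition parent S := (parent_info S).1.1.

Lemma parentE S : parent S = (parent_info S).1.1. Proof. by []. Qed.

Lemma parent_sol S : sol S -> parent S = [::] \/ sol (parent S).
Proof.
move=> sS; have [h _ _] := parent_posP sS; case: sS => S0 v _ _.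
rewrite /parent /=; case: (posnP (parent_pos S)) => [->|p0].
  by left; rewrite take0 complete_nil.
right; apply: sol_complete; last exact: valid_take.
by rewrite -size_eq0 size_take h -lt0n.
Qed.

Definition nbr_filter v P := v :: [seq u <- P | E v u].
Lemma mem_nbr_filter v P u : (u \in nbr_filter v P) = (u == v) || E v u && (u \in P).
Proof. by rewrite inE mem_filter. Qed.

(** If the replay never meets [v], then [index] is [size W] and the cut keeps everything. Every
    vertex [s] thus yields some solution; comparing its [parent_info] with the pair decides whether
    it is a genuine child. *)
Definition child P v s :=
  let W := complete (mem (nbr_filter v P)) [:: s] in
  canon (completeT (take (index v W).+1 W)).

Lemma sol_child P v s : s < n -> sol (child P v s).
Proof.
move=> h; apply: sol_complete; last by apply/valid_take/complete_valid/valid1.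
have := @complete_neq0 (mem (nbr_filter v P)) [:: s] isT (valid1 h).
by case: complete.
Qed.

(* If the restricted search from the root left S before reaching v, it would do so to some c
   outside S adjacent to all of S up to v; the first later s_m not adjacent to c then has a key
   below that of c, hence below that of s_l, against the canonical order of S. *)
Lemma child_prefix S i l F : sol S ->
  (forall i', i < i' -> completeT (take i' S) = S) ->
  (forall c, F c -> c \notin S -> all (E c) (take i.+1 S)) ->
  (forall k, k <= i -> k < size S -> F (nth 0 S k)) ->
  0 < l <= i -> i < size S -> argmin_key F (take l S) (nth 0 S l).
Proof.
move=> sS hi hF hS hl iS.
have [S0 v _ mx] := sS.
have [_ gr _] := sol_greedy sS.
have grl : argmin_key (mem S) (take l S) (nth 0 S l) by apply: gr => /=; lia.
have cl : cand F (take l S) (nth 0 S l).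
  have := grl.1; rewrite /cand => /and3P[_ -> ->]; rewrite hS //; lia.
split=> // c cc.
case: (boolP (c \in S)) => cS.
  by apply: grl.2; case/and3P: cc => _ a b; apply/and3P.
rewrite leqNgt; apply/negP => klt.
have adj := hF c (proj1 (andP cc)) cS.
have hatt : has (K c) (take l S) by case/and3P: cc.
have hattS k : l <= k -> has (K c) (take k S).
  move=> lk; apply/hasP; case/hasP: hatt => x xl kx; exists x => //.
  by move: xl; rewrite -(take_takel S lk) => /mem_take.
have nadj : has (predC (E c)) S.
  have /negP := mx c; rewrite /cand /= => nc.
  rewrite has_predC; apply/negP => al; apply: nc; rewrite al /=.
  by have := hattS (size S); rewrite take_size; apply; lia.
have [m em] : exists m, m = find (predC (E c)) S by eexists.
have := nadj; rewrite has_find -em => mS.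
have nm : ~~ E c (nth 0 S m) by rewrite em; have := nth_find 0 nadj.
have im : i < m.
  rewrite ltnNge; apply/negP => mi; move/negP: nm; apply; apply: (allP adj).
  exact: mem_take_nth.
(* Since [m] exceeds [i], this prefix completes to [S] without any restriction. So the vertex at
   position [m] has least key even among candidates outside [S], and [c] is one of them. *)
have [_ grm _] : greedy predT (take m S) S.
  by rewrite -{2}(hi m im); apply/complete_greedy/valid_take.
have lS : l <= size S by case/andP: hl => _ li; apply: leq_trans li (ltnW iS).
have lm : l <= m by case/andP: hl => _ li; apply: leq_trans li (ltnW im).
have smS : size (take m S) = m by rewrite size_take mS.
have [cm km] : argmin_key predT (take m S) (nth 0 S m).
  by have := grm m; rewrite smS; apply; rewrite leqnn.
have cmc : cand predT (take m S) c.
  rewrite /cand /= hattS // andbT.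
  apply/allP => x /(nthP 0)[k]; rewrite smS => km' <-; rewrite nth_take //.
  by rewrite em in km'; have := before_find 0 km'; rewrite /= => /negbFE.
have tm : take m S = take l S ++ drop l (take m S).
  by rewrite -(take_takel S lm) cat_take_drop.
have kcm : key (take m S) c = key (take l S) c by rewrite tm key_cat.
have := km c cmc; rewrite kcm => kmc.
have slS : size (take l S) = l by rewrite size_takel.
case: (boolP (has (K (nth 0 S m)) (take l S))) => h.
  have : key (take l S) (nth 0 S l) <= key (take l S) (nth 0 S m).
    apply: grl.2; apply/and3P; split=> //; first exact: mem_nth.
    case/and3P: cm => _ /allP a _; apply/allP => x xl; apply: a.
    by rewrite tm mem_cat xl.
  by move=> le; move: kmc; rewrite tm key_cat // leqNgt (leq_trans klt le).
have := key_cat_ge (drop l (take m S)) h; rewrite -tm slS => ge.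
have lt := key_lt (cand_lt cc) hatt; rewrite slS in lt.
by have := leq_trans lt (leq_trans ge kmc); rewrite ltnn.
Qed.

Lemma greedy_prefix F X S i :
  greedy F (take 1 S) X -> i < size S ->
  (forall l, 0 < l <= i -> argmin_key F (take l S) (nth 0 S l)) ->
  take i.+1 X = take i.+1 S.
Proof.
move=> [a b c] iS h.
have s1 : size (take 1 S) = 1 by rewrite size_take_min; lia.
rewrite s1 in a b.
have H l : l <= i -> take l.+1 X = take l.+1 S.
  elim: l => [|l IH] li; first by rewrite a.
  have {}IH := IH (ltnW li).
  have ag : argmin_key F (take l.+1 S) (nth 0 S l.+1) by apply: h; lia.
  have lX : l.+1 < size X.
    rewrite ltnNge; apply/negP => hX; have /negP[] := c (nth 0 S l.+1).
    by rewrite -(take_oversize hX) IH; apply: ag.1.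
  rewrite take_S_nth // [RHS]take_S_nth; last lia.
  rewrite IH; congr rcons; apply: argmin_key_inj ag.
  by rewrite -IH; apply: b; lia.
exact: H.
Qed.

Lemma parent_nth S (i := parent_pos S) : sol S -> 0 < i -> nth 0 S 0 \in parent S.
Proof.
move=> sS i0; have [iS _ _] := parent_posP sS; have [S0 v _ _] := sS.
have vt := valid_take i v.
rewrite /parent /= mem_canon; last exact: complete_valid.
by apply: sub_complete => //; rewrite mem_take_nth // (ltn_trans i0).
Qed.

(** The prefix before [v] lies in [P], which has the vertices of its completion, and is adjacent to
    [v]; so the filter contains it. A filter vertex outside [S] is adjacent to [v] and, by the
    clique [P], to the prefix, as [child_prefix] requires. The second conclusion allows the
    traversal to store a position in [P] instead of [s]. *)
Lemma child_parent S P v s : sol S -> parent_info S = (P, v, s) ->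
  child P v s = S /\ nth v P (index s P) = s.
Proof.
move=> sS [eP ev es]; have [iS ne hi] := parent_posP sS; have [S0 vS cS mS] := sS.
set i := parent_pos S in iS ne hi eP ev.
have sn : s < n by rewrite -es; apply: (proj1 vS); apply: mem_nth; apply: leq_ltn_trans iS.
have s1 : take 1 S = [:: s] by case: (S) S0 es => //= x S' _ ->; rewrite take0.
have eW : take i.+1 (complete (mem (nbr_filter v P)) [:: s]) = take i.+1 S.
  have gW := complete_greedy (mem (nbr_filter v P)) (valid1 sn).
  rewrite -s1 in gW *.
  apply: (greedy_prefix gW iS) => l hl.
  have Pi k : k < i -> nth 0 S k \in P.
    move=> ki; rewrite -eP mem_canon; last by apply/complete_valid/valid_take.
    apply: sub_complete; first exact: valid_take.
    by rewrite mem_take_nth // (ltn_trans ki).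
  have uS := valid_uniq vS.
  apply: (child_prefix sS hi) => //.
    move=> c cF; have {cF} : c \in nbr_filter v P by [].
    rewrite mem_nbr_filter => /orP[/eqP->|].
      by rewrite -ev mem_nth.
    case/andP=> Evc cP ncS.
    have vP : valid P by rewrite -eP; apply/canon_valid/complete_valid/valid_take.
    rewrite take_S_nth // all_rcons ev Esym Evc /=; apply/allP => x.
    move=> /(nthP 0)[k]; rewrite size_take iS => ki <-; rewrite nth_take //.
    apply: (valid_clique vP) => //; first exact: Pi.
    by apply: contraNneq ncS => ->; rewrite mem_nth // (ltn_trans ki).
  move=> k ki kS; suff: nth 0 S k \in nbr_filter v P by [].
  rewrite mem_nbr_filter -ev.
  case: (ltngtP k i) ki => // [h _|-> _]; last by rewrite eqxx.
  rewrite Pi // andbT; apply/orP; right.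
  by apply: (valid_clique vS); rewrite ?mem_nth // nth_uniq // gtn_eqF.
set W := complete _ _ in eW.
have vi : index v W = i.
  have iW : i < size W.
    by have := congr1 size eW; rewrite !size_take_min; lia.
  rewrite -ev (take_nth_lt (ltnSn i) (esym eW)) index_uniq //.
  by apply: valid_uniq; apply/complete_valid/valid1.
split; first by rewrite /child -/W vi eW hi.
(* At position 0 the parent is empty, and [s] and [v] are the same entry of [S]: the default of
   [nth] is then the right value. *)
case: (posnP i) => [i0|i0]; last by apply: nth_index; rewrite -es -eP parent_nth.
by rewrite -eP i0 take0 complete_nil /= -ev i0.
Qed.

(** * A potential that decreases towards the parent *)

(** The successor makes every entry positive, so a missing entry, read as 0, ranks below any present
    one and the empty sequence comes first. *)
Definition keys S := [seq (key (take l S) (nth 0 S l)).+1 | l <- iota 0 (size S)].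

(** The number with digits [s] in base [M], most significant first, padded or cut to [k] digits. For
    digits below [M] it turns lexicographic comparison into comparison of numbers, available for
    plain induction. *)
Fixpoint lexval M k (s : seq nat) :=
  if k is k'.+1 then if s is x :: s' then x * M ^ k' + lexval M k' s' else 0 else 0.

Lemma lexval_lt M k s : 0 < M -> (forall x, x \in s -> x < M) -> lexval M k s < M ^ k.
Proof.
move=> M0; elim: k s => [|k IH] [|x s] //= h; first by rewrite expn_gt0 M0.
have := IH s _; rewrite expnS => /(_ (fun y h' => h y (mem_behead (s := x :: s) h'))).
have := h x (mem_head x s); nia.
Qed.

Lemma lexval_cmp M k s t i : 0 < M -> (forall x, x \in s -> x < M) ->
  i < k -> i < size t -> take i s = take i t -> nth 0 s i < nth 0 t i ->
  lexval M k s < lexval M k t.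
Proof.
move=> M0; elim: k s t i => // k IH s [|y t] i //= hs; case: i => [|i] ik it.
  move=> _ /= h; case: s hs h => [|x s] hs /= h; first by have: 0 < M ^ k; [rewrite expn_gt0 M0|nia].
  have := @lexval_lt M k s M0 (fun y h' => hs y (mem_behead (s := x :: s) h')); nia.
case: s hs => [|x s] hs //= [<- e] h; rewrite ltn_add2l; apply: IH h => //.
by move=> z zs; apply: hs; rewrite inE zs orbT.
Qed.

Definition base := (n.+1 * n.+1).+2.
Definition pot S := lexval base n.+1 (keys S).

Lemma keys_lt S x : valid S -> x \in keys S -> x < base.
Proof.
move=> v /mapP[l]; rewrite mem_iota /= add0n => lS ->.
have uS : nth 0 S l < n by apply: (proj1 v); apply: mem_nth.
have fl : find (K (nth 0 S l)) (take l S) <= l.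
  by apply: leq_trans (find_size _ _) _; rewrite size_take_min geq_minl.
by have := valid_size v; rewrite /key /base; nia.
Qed.

Lemma pot_lt S : valid S -> pot S < base ^ n.+1.
Proof. by move=> v; apply: lexval_lt => // x; apply: keys_lt. Qed.

Lemma size_keys S : size (keys S) = size S.
Proof. by rewrite size_map size_iota. Qed.

Lemma nth_keys S l : l < size S -> nth 0 (keys S) l = (key (take l S) (nth 0 S l)).+1.
Proof. by move=> h; rewrite (nth_map 0) ?size_iota // nth_iota. Qed.

Lemma keys_take S T l : take l S = take l T -> take l (keys S) = take l (keys T).
Proof.
move=> e; have es : minn l (size S) = minn l (size T) by rewrite -!size_take_min e.
apply: (@eq_from_nth _ 0) => [|k]; first by rewrite !size_take_min !size_keys.
rewrite size_take_min size_keys leq_min => /andP[kl kS].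
have kT : k < size T by lia.
rewrite !nth_take // !nth_keys //.
by rewrite -(@take_takel _ k l S) 1?ltnW // e take_takel 1?ltnW // (take_nth_lt kl e).
Qed.

Lemma pot_cmp S T i : valid S -> valid T -> i < size S -> i < size T -> take i S = take i T ->
  key (take i S) (nth 0 S i) < key (take i T) (nth 0 T i) -> pot S < pot T.
Proof.
move=> vS vT iS iT e h.
rewrite /pot; apply: (@lexval_cmp _ _ _ _ i) => //; rewrite ?size_keys ?nth_keys //.
- by move=> x; apply: keys_lt.
- by have := valid_size vT; lia.
exact: keys_take.
Qed.

(** The completion [T] of the cut prefix agrees with [S] before [i] and has a smaller key at [i].
    Passing to the canonical order [P] keeps the decrease: where [P] first leaves [S] before [i],
    the vertex of [S] was available in [P], so the one chosen has smaller key; if they agree up to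
    [i], the key of [P] there is at most that of [T]. *)
Lemma pot_parent S : sol S -> pot (parent S) < pot S.
Proof.
move=> sS; have [iS ne hi] := parent_posP sS; have [S0 vS cS mS] := sS.
have := parent_sol sS; have := parent_nth sS.
set i := parent_pos S in iS ne hi *.
set P := parent S => hs.
case=> [->|sP].
  rewrite /pot; apply: (@lexval_cmp _ _ _ _ 0) => //; rewrite ?size_keys.
  - by case: (S) S0.
  by case: (S) S0.
  by case: (S) S0.
have {hs} i0 : 0 < i.
  rewrite lt0n; apply/eqP => i0; have [+ _ _ _] := sP.
  by rewrite /P /parent /= -/i i0 take0 complete_nil.
have [P0 vP cP mP] := sP.
have vt := valid_take i vS.
set T := completeT (take i S) in ne.
have gT : greedy predT (take i S) T by apply: complete_greedy.
have vT : valid T := greedy_valid vt gT.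
have TP : P =i T by move=> x; rewrite /P /parent /= -/i mem_canon.
have st : size (take i S) = i by rewrite size_take iS.
have [gT1 gT2 gT3] := gT; rewrite st in gT1 gT2.
have [_ gS _] := sol_greedy sS.
have [_ gP _] := sol_greedy sP.
have Si k : k < i -> nth 0 S k \in P.
  move=> ki; rewrite TP; apply: (greedy_sub gT).
  by rewrite mem_take_nth // (ltn_trans ki).
have SiC : cand predT (take i S) (nth 0 S i) by apply: (proj2 vS); rewrite i0.
have iT : i < size T.
  rewrite ltnNge; apply/negP => h; have /negP[] := gT3 (nth 0 S i).
  by rewrite -(take_oversize h) gT1.
have [cTi kTi] := gT2 i (introT andP (conj (leqnn i) iT)).
rewrite gT1 in cTi kTi.
(* If the two vertices agreed, the prefix of length [i.+1] would complete to [T], whereas it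
   completes to [S]. *)
have Tne : nth 0 T i != nth 0 S i.
  apply: contraNneq ne => e; rewrite -(hi i.+1) //; apply/eqP/esym/completeE.
    exact: valid_take.
  by rewrite take_S_nth // -e -gT1 -take_S_nth //; apply: (greedy_take gT); rewrite st.
have kTS : key (take i S) (nth 0 T i) < key (take i S) (nth 0 S i).
  rewrite ltn_neqAle kTi // andbT; apply: contra_neq Tne; apply: key_inj.
    exact: cand_lt cTi.
  exact: cand_lt SiC.
suff H l : l <= i -> take l P = take l S \/ pot P < pot S.
  case: (H i (leqnn i)) => // e.
  have ciP : cand (mem P) (take i P) (nth 0 T i).
    rewrite e; case/and3P: cTi => _ a b; apply/and3P; split=> //.
    suff: nth 0 T i \in P by [].
    by rewrite TP mem_nth.
  have iP : i < size P.
    rewrite ltnNge; apply/negP => h; move: (cand_notin ciP); rewrite take_oversize //.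
    by rewrite TP mem_nth.
  apply: (@pot_cmp _ _ i) => //; have [//|_ ] := gP i; first by rewrite i0.
  by move=> /(_ _ ciP); rewrite e; lia.
elim: l => [|l IH] li; first by left; rewrite !take0.
have [e|] := IH (ltnW li); last by right.
have lS : l < size S by lia.
have Sl := Si l li.
have lP : l < size P.
  rewrite ltnNge; apply/negP => h; move: Sl; rewrite -[P](take_oversize h) e.
  rewrite -(nth_take 0 (ltnSn l)) -index_mem.
  case: (posnP l) => [->|l0]; first by rewrite take0.
  have /cand_notin : cand predT (take l S) (nth 0 S l) by apply: (proj2 vS); rewrite l0.
  by rewrite nth_take // index_mem => /negP.
rewrite !take_S_nth // e.
case: (altP (nth 0 P l =P nth 0 S l)) => [->|nPS]; [by left|right].
have cS' : 0 < l -> cand (mem P) (take l P) (nth 0 S l).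
  move=> l0; have : cand predT (take l S) (nth 0 S l) by apply: (proj2 vS); rewrite l0.
  by rewrite e => /and3P[_ a b]; apply/and3P.
apply: (@pot_cmp _ _ l) => //; rewrite e.
(* Over the empty sequence the key is the vertex itself, and a canonical sequence starts with its
   least vertex. *)
case: (posnP l) => [l0|l0].
  rewrite l0 take0 /key /= in nPS Sl *; rewrite ltn_neqAle nPS /=.
  by rewrite sol_head // least_le.
have [cP' kP'] : argmin_key (mem P) (take l P) (nth 0 P l) by apply: gP; rewrite l0.
have := kP' _ (cS' l0); rewrite e leq_eqVlt => /orP[/eqP k|//].
case/eqP: nPS; apply: key_inj k; first exact: cand_lt cP'.
exact: cand_lt (cS' l0).
Qed.

End Graph.

(** * A structured language with four arrays *)

Inductive atom : Type :=
| AConst of nat & nat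
| AN of nat
| AMov of nat & nat
| AInc of nat
| ADec of nat
| ASub of nat & nat & nat
| ANeq of nat & nat & nat
| AAdj of nat & nat & nat
| ABlack of nat & nat & nat
| AGet of nat & nat & nat
| APush of nat & nat
| ALen of nat & nat
| ACut of nat & nat
| AOut of nat
| ASep.

Inductive cmd : Type :=
| Block of seq atom
| Seq of cmd & cmd
| If of nat & cmd & cmd
| While of nat & cmd.

Record state := State { rg : nat -> nat; ar : nat -> seq nat; tr : seq event }.

(* Cells 0..15 hold the scalars, 16..18 are scratch, cell 20 + x holds the length of array x,
   and entry i of array x sits in cell 24 + 4 i + x. *)
Definition addr_code x i : seq instr :=
  [:: IAdd 16 i i; IAdd 16 16 16; IConst 17 (24 + x); IAdd 16 16 17].

(** The machine has neither move nor equality test. A move adds a scratch cell holding 0; inequality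
    is the sum of the two truncated differences, at most one of which is positive. *)
Definition acode (a : atom) : seq instr :=
  match a with
  | AConst r k => [:: IConst r k]
  | AN r => [:: IN r]
  | AMov r s => [:: IConst 16 0; IAdd r s 16]
  | AInc r => [:: IConst 16 1; IAdd r r 16]
  | ADec r => [:: IConst 16 1; ISub r r 16]
  | ASub r i j => [:: ISub r i j]
  | ANeq r i j => [:: ISub 16 i j; ISub 17 j i; IAdd r 16 17]
  | AAdj r i j => [:: IAdj r i j]
  | ABlack r i j => [:: IBlack r i j]
  | AGet r x i => addr_code x i ++ [:: ILoad r 16]
  | APush x r => addr_code x (20 + x) ++ [:: IStore 16 r; IConst 17 1; IAdd (20 + x) (20 + x) 17]
  | ALen r x => [:: IConst 16 0; IAdd r (20 + x) 16]
  | ACut x r => [:: IConst 16 0; IAdd (20 + x) r 16]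
  | AOut r => [:: IOut r]
  | ASep => [:: ISep]
  end.

Definition atom_ok (a : atom) : bool :=
  match a with
  | AConst r k => (r < 16) && (k <= 2)
  | AN r | AInc r | ADec r | AOut r => r < 16
  | AMov r s => (r < 16) && (s < 16)
  | ASub r i j | ANeq r i j | AAdj r i j | ABlack r i j => [&& r < 16, i < 16 & j < 16]
  | AGet r x i => [&& r < 16, x < 4 & i < 16]
  | APush x r | ALen r x | ACut x r => (x < 4) && (r < 16)
  | ASep => true
  end.

Fixpoint cmd_ok (c : cmd) : bool :=
  match c with
  | Block l => all atom_ok l
  | Seq c1 c2 => cmd_ok c1 && cmd_ok c2
  | If r c1 c2 => [&& r < 16, cmd_ok c1 & cmd_ok c2]
  | While r c1 => (r < 16) && cmd_ok c1
  end.

Fixpoint csize (c : cmd) : nat :=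
  match c with
  | Block l => size (flatten (map acode l))
  | Seq c1 c2 => csize c1 + csize c2
  | If _ c1 c2 => (csize c1 + csize c2).+2
  | While _ c1 => (csize c1).+2
  end.

Fixpoint compile (off : nat) (c : cmd) : seq instr :=
  match c with
  | Block l => flatten (map acode l)
  | Seq c1 c2 => compile off c1 ++ compile (off + csize c1) c2
  | If r c1 c2 =>
      IJz r (off + (csize c1).+2) :: compile off.+1 c1 ++
      IJmp (off + (csize c1 + csize c2).+2) :: compile (off + (csize c1).+2) c2
  | While r c1 => IJz r (off + (csize c1).+2) :: compile off.+1 c1 ++ [:: IJmp off]
  end.

Lemma size_compile off c : size (compile off c) = csize c.
Proof.
elim: c off => //= [c1 h1 c2 h2|r c1 h1 c2 h2|r c1 h1] off.
- by rewrite size_cat h1 h2.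
- by rewrite size_cat /= h1 h2 addnS.
by rewrite size_cat /= h1 addn1.
Qed.

Section Semantics.
Variables (n q : nat) (E K : nat -> nat -> bool).

Definition tick s := State (rg s) (ar s) (rcons (tr s) ENone).

Definition set_rg s r v := State (upd (rg s) r v) (ar s) (tr s).
Definition set_ar s x v := State (rg s) (fun y => if y == x then v else ar s y) (tr s).

Definition adata (a : atom) (s : state) : state :=
  match a with
  | AConst r k => set_rg s r k
  | AN r => set_rg s r n
  | AMov r i => set_rg s r (rg s i)
  | AInc r => set_rg s r (rg s r).+1
  | ADec r => set_rg s r (rg s r).-1
  | ASub r i j => set_rg s r (rg s i - rg s j)
  | ANeq r i j => set_rg s r ((rg s i - rg s j) + (rg s j - rg s i))
  | AAdj r i j => set_rg s r (E (rg s i) (rg s j))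
  | ABlack r i j => set_rg s r (K (rg s i) (rg s j))
  | AGet r x i => set_rg s r (nth 0 (ar s x) (rg s i))
  | APush x r => set_ar s x (rcons (ar s x) (rg s r))
  | ALen r x => set_rg s r (size (ar s x))
  | ACut x r => set_ar s x (take (rg s r) (ar s x))
  | AOut _ | ASep => s
  end.

Definition aevents (a : atom) (s : state) : seq event :=
  match a with
  | AOut r => [:: EOut (rg s r)]
  | ASep => [:: ESep]
  | _ => nseq (size (acode a)) ENone
  end.

Definition asem a s := State (rg (adata a s)) (ar (adata a s)) (tr s ++ aevents a s).

(** The conditions that syntax cannot guarantee: they keep scalars at most [n.+2], arrays at most
    [q.+2] long, and reads and cuts within the arrays. *)
Definition apre (a : atom) (s : state) : Prop :=
  match a with
  | AInc r => rg s r <= n.+1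
  | AGet r x i => rg s i < size (ar s x)
  | APush x r => size (ar s x) < q.+2
  | ACut x r => rg s r <= size (ar s x)
  | _ => True
  end.

Fixpoint block_pre l s : Prop :=
  if l is a :: l' then apre a s /\ block_pre l' (asem a s) else True.

Definition block_sem l s := foldl (fun s a => asem a s) s l.

(** The trace grows by one event per machine instruction, jumps included, so its length is the
    running time. A true conditional pays the test and the jump over the other branch, a false one
    only the test. *)
Inductive exec : cmd -> state -> state -> Prop :=
| XBlock l s : block_pre l s -> exec (Block l) s (block_sem l s)
| XSeq c1 c2 s s1 s2 : exec c1 s s1 -> exec c2 s1 s2 -> exec (Seq c1 c2) s s2
| XIfT r c1 c2 s s1 : rg s r != 0 -> exec c1 (tick s) s1 -> exec (If r c1 c2) s (tick s1)
| XIfF r c1 c2 s s1 : rg s r = 0 -> exec c2 (tick s) s1 -> exec (If r c1 c2) s s1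
| XWhileF r c s : rg s r = 0 -> exec (While r c) s (tick s)
| XWhileT r c s s1 s2 : rg s r != 0 -> exec c (tick s) s1 ->
    exec (While r c) (tick s1) s2 -> exec (While r c) s s2.

(** * Correctness of the compiler *)

Variable P : program.
Let I := Input n E K.
(** The four arrays are interleaved so that all can grow without a known maximal length. The bound
    [q.+2] rather than [q] leaves room for the filter, which holds [v] besides neighbours from a
    full node. *)
Definition mem_size := 24 + 4 * q.+2.
Definition word_bound := n.+2 ^ 6.

Definition good (m : nat -> nat) :=
  (forall a, mem_size <= a -> m a = 0) /\ (forall a, m a < word_bound).

(** Being unhalted and within the space bound is recorded at every intermediate step, since the
    final statement asks for both at all times. *)
Inductive segment : config -> seq event -> config -> Prop :=
| Segment0 c : segment c [::] c
| SegmentS c evs c' : ~~ halted P c -> good (Defs.mem c) ->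
    segment (step P I c).1 evs c' -> segment c ((step P I c).2 :: evs) c'.

Lemma segment_cat c evs c' evs' c'' :
  segment c evs c' -> segment c' evs' c'' -> segment c (evs ++ evs') c''.
Proof. by elim=> //= {}c e {}c' h g s IH s'; apply: SegmentS => //; apply: IH. Qed.

Lemma segment_conf c evs c' t : segment c evs c' -> c = conf P I t ->
  [/\ c' = conf P I (t + size evs),
      forall i, i < size evs ->
        ~~ halted P (conf P I (t + i)) /\ good (Defs.mem (conf P I (t + i)))
    & forall i, i < size evs -> nth ENone evs i = event_at P I (t + i)].
Proof.
move=> s; elim: s t => {c evs c'} [c|c evs c' h g s IH] t e.
  by split=> //; rewrite addn0.
have [|h1 h2 h3] := IH t.+1; first by rewrite e.
split=> [|[|i] hi|[|i] hi] /=; rewrite ?addn0 ?addnS -?addSn //.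
- by rewrite -e.
- exact: h2.
- by rewrite e.
exact: h3.
Qed.

Definition code_at off (code : seq instr) :=
  forall i, i < size code -> nth IHalt P (off + i) = nth IHalt code i.

Lemma code_at_cat off l1 l2 :
  code_at off (l1 ++ l2) -> code_at off l1 /\ code_at (off + size l1) l2.
Proof.
move=> h; split=> i hi.
  by rewrite h ?size_cat ?nth_cat ?hi //; lia.
by rewrite -addnA h ?size_cat ?ltn_add2l // nth_cat ltnNge leq_addr /= addKn.
Qed.

Lemma code_at_cons off x l :
  code_at off (x :: l) -> nth IHalt P off = x /\ code_at off.+1 l.
Proof.
move=> h; split; first by have := h 0; rewrite addn0; apply.
by move=> i hi; have := h i.+1; rewrite addnS -addSn; apply.
Qed.

Definition simple (i : instr) :=
  match i with IJz _ _ | IJmp _ | IHalt => false | _ => true end.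

Definition mstep (i : instr) (m : nat -> nat) : nat -> nat :=
  match i with
  | IConst i k => upd m i k
  | IN i => upd m i n
  | IAdd i j k => upd m i (m j + m k)
  | ISub i j k => upd m i (m j - m k)
  | ILoad i j => upd m i (m (m j))
  | IStore i j => upd m (m i) (m j)
  | IAdj i j k => upd m i (E (m j) (m k))
  | IBlack i j k => upd m i (K (m j) (m k))
  | _ => m
  end.

Definition mevent (i : instr) (m : nat -> nat) : event :=
  match i with IOut r => EOut (m r) | ISep => ESep | _ => ENone end.

Fixpoint mgood l m : Prop := if l is i :: l' then good m /\ mgood l' (mstep i m) else True.
Fixpoint mevents l m : seq event :=
  if l is i :: l' then mevent i m :: mevents l' (mstep i m) else [::].
Definition mrun l m := foldl (fun m i => mstep i m) m l.

Lemma segment_simple l off m : code_at off l -> all simple l -> mgood l m ->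
  segment (Cfg off m) (mevents l m) (Cfg (off + size l) (mrun l m)).
Proof.
elim: l off m => [|i l IH] off m /=; first by rewrite addn0; constructor.
case/code_at_cons=> hi hl /andP[si sl] [g gl].
have e : step P I (Cfg off m) = (Cfg off.+1 (mstep i m), mevent i m).
  by rewrite /step /= hi; case: (i) si.
have <- : (step P I (Cfg off m)).2 = mevent i m by rewrite e.
apply: SegmentS => //; first by rewrite /halted /= hi; case: (i) si.
by rewrite e addnS -addSn; apply: IH.
Qed.

Definition state_ok s :=
  [/\ forall r, rg s r <= n.+2, forall x, size (ar s x) <= q.+2 &
      forall x i, nth 0 (ar s x) i <= n.+2].

(** Scratch cells and entries beyond the length of an array are free apart from the bounds in
    [good]. This is why truncating an array is a single write to its length cell. *)
Definition represents s m :=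
  [/\ forall r, r < 16 -> m r = rg s r,
      forall x, x < 4 -> m (20 + x) = size (ar s x),
      forall x i, x < 4 -> i < size (ar s x) -> m (24 + 4 * i + x) = nth 0 (ar s x) i,
      good m & state_ok s].

Hypothesis qn : q <= n.

Lemma good_upd m a v : good m -> a < mem_size -> v <= 4 * n + 40 -> good (upd m a v).
Proof.
case=> g1 g2 ha hv; split=> b; rewrite /upd; case: eqP => [e|_]; [lia|exact: g1| |exact: g2].
(* Origin of the exponent 6: [n.+2 ^ 6] is at least 32 times [n.+2], which exceeds [4 * n + 40] even
   for [n = 0]. *)
have : 32 <= n.+2 ^ 5 by apply: (@leq_exp2r 2 n.+2 5).
by rewrite /word_bound expnS; nia.
Qed.

Lemma state_ok_rg s r v : state_ok s -> v <= n.+2 -> state_ok (set_rg s r v).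
Proof. by case=> a b c h; split=> //= x; rewrite /upd; case: eqP. Qed.

Lemma repr_tr s m t : represents s m -> represents (State (rg s) (ar s) t) m.
Proof. by case=> a b c d e; split. Qed.

Lemma repr_scratch s m a v : represents s m -> 16 <= a < 20 -> v <= 4 * n + 40 -> represents s (upd m a v).
Proof.
case=> h1 h2 h3 h4 h5 ha hv; split=> //.
- by move=> r hr; rewrite /upd; case: eqP => [|_]; [lia|exact: h1].
- by move=> x hx; rewrite /upd; case: eqP => [|_]; [lia|exact: h2].
- by move=> x i hx hi; rewrite /upd; case: eqP => [|_]; [lia|exact: h3].
by apply: good_upd => //; rewrite /mem_size; lia.
Qed.

Lemma repr_rg s m r v : represents s m -> r < 16 -> v <= n.+2 -> represents (set_rg s r v) (upd m r v).
Proof.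
case=> h1 h2 h3 h4 h5 hr hv; split=> //=.
- by move=> i hi; rewrite /upd; case: eqP => [//|_]; exact: h1.
- by move=> x hx; rewrite /upd; case: eqP => [|_]; [lia|exact: h2].
- by move=> x i hx hi; rewrite /upd; case: eqP => [|_]; [lia|exact: h3].
- by apply: good_upd => //; rewrite /mem_size; lia.
exact: state_ok_rg.
Qed.

Lemma upd_eq m a v : upd m a v a = v. Proof. by rewrite /upd eqxx. Qed.
Lemma upd_ne m a v b : b != a -> upd m a v b = m b. Proof. by rewrite /upd => /negPf->. Qed.

Lemma addr_run s m x i v : represents s m -> x < 4 -> i != 16 -> i != 17 -> m i = v -> v <= n.+2 ->
  let m' := mrun (addr_code x i) m in
  [/\ mgood (addr_code x i) m, represents s m' & m' 16 = 24 + 4 * v + x].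
Proof.
move=> h hx i16 i17 mi hv /=.
have g m1 : represents s m1 -> good m1 by case.
set m1 := upd m 16 _.
have r1 : represents s m1 by apply: repr_scratch => //; lia.
have e1 : m1 16 = v + v by rewrite /m1 upd_eq mi.
set m2 := upd m1 16 _.
have r2 : represents s m2 by apply: repr_scratch => //; lia.
have e2 : m2 16 = 4 * v by rewrite /m2 upd_eq e1; lia.
set m3 := upd m2 17 _.
have r3 : represents s m3 by apply: repr_scratch => //; lia.
have e3 : m3 16 = 4 * v by rewrite /m3 upd_ne.
have e3' : m3 17 = 24 + x by rewrite /m3 upd_eq.
split; first by do 4!(split; first by apply: g).
  by apply: repr_scratch => //; lia.
by rewrite upd_eq e3 e3'; lia.
Qed.

Lemma mgood_cat l1 l2 m : mgood l1 m -> mgood l2 (mrun l1 m) -> mgood (l1 ++ l2) m.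
Proof. by elim: l1 m => //= i l IH m [g h] h2; split=> //; apply: IH. Qed.

Lemma mrun_cat l1 l2 m : mrun (l1 ++ l2) m = mrun l2 (mrun l1 m).
Proof. exact: foldl_cat. Qed.

Lemma repr_push s m x v : represents s m -> x < 4 -> size (ar s x) < q.+2 -> v <= n.+2 ->
  represents (set_ar s x (rcons (ar s x) v))
    (upd (upd (upd m (24 + 4 * size (ar s x) + x) v) 17 1) (20 + x) (size (ar s x)).+1).
Proof.
case=> h1 h2 h3 h4 [o1 o2 o3] hx hs hv; split=> /=.
- move=> i hi; rewrite /upd; do 3!(case: eqP => [|_]; first lia); exact: h1.
- move=> y hy; rewrite /upd; case: (altP (y =P x)) => [->|/eqP yx].
    by rewrite eqxx size_rcons.
  do 3!(case: eqP => [|_]; first lia); exact: h2.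
- move=> y i hy; rewrite /upd; case: (altP (y =P x)) => [->|/eqP yx].
    rewrite size_rcons nth_rcons ltnS leq_eqVlt => hi.
    do 2!(case: eqP => [|_]; first lia).
    case: eqP => [e|e].
      suff -> : i = size (ar s x) by rewrite ltnn eqxx.
      by move: e; clear; lia.
    case/orP: hi => [/eqP ei|hi]; first by case: e; rewrite ei.
    by rewrite hi h3.
  move=> hi; do 3!(case: eqP => [|_]; first lia); exact: h3.
- do 3!(apply: good_upd; rewrite /mem_size; try lia); exact: h4.
split=> //= [y|y i]; case: eqP => [_|_] //; first by rewrite size_rcons.
by rewrite nth_rcons; case: ifP => // _; case: ifP.
Qed.

Lemma repr_cut s m x k : represents s m -> x < 4 -> k <= size (ar s x) ->
  represents (set_ar s x (take k (ar s x))) (upd m (20 + x) k).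
Proof.
case=> h1 h2 h3 h4 [o1 o2 o3] hx hs; have sx := o2 x; split=> /=.
- by move=> i hi; rewrite /upd; case: eqP => [|_]; [lia|exact: h1].
- move=> y hy; rewrite /upd; case: (altP (y =P x)) => [->|/eqP yx].
    by rewrite eqxx size_takel.
  by case: eqP => [|_]; [lia|exact: h2].
- move=> y i hy; rewrite /upd; case: (altP (y =P x)) => [->|_] hi; (case: eqP => [|_]; first lia); last exact: h3.
  by move: hi; rewrite size_takel // => hi; rewrite nth_take // h3 //; apply: leq_trans hi hs.
- by apply: good_upd => //; rewrite /mem_size; lia.
split=> //= [y|y i]; case: eqP => [_|_] //; first by rewrite size_takel // (leq_trans hs).
case: (ltnP i k) => h; first by rewrite nth_take.
by rewrite nth_default // size_takel.
Qed.

Lemma get_repr s m r x i (a := AGet r x i) : represents s m -> r < 16 -> x < 4 -> i < 16 ->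
  rg s i < size (ar s x) -> mgood (acode a) m /\ represents (asem a s) (mrun (acode a) m).
Proof.
move=> h hr hx hi pre; have [h1 h2 h3 h4 [o1 o2 o3]] := h.
have [||ga ra ea] := addr_run h hx _ _ (h1 _ hi) (o1 i); [lia|lia|].
have -> : acode a = addr_code x i ++ [:: ILoad r 16] by [].
rewrite mrun_cat.
have [k1 k2 k3 k4 k5] := ra; split; first by apply: mgood_cat ga _.
set m' := mrun (addr_code x i) m in ra ea k1 k2 k3 k4 *.
rewrite [mrun [:: _] _]/= ea k3 //.
by apply/(@repr_tr (set_rg s r _))/repr_rg.
Qed.

Lemma push_repr s m x r (a := APush x r) : represents s m -> r < 16 -> x < 4 ->
  size (ar s x) < q.+2 -> mgood (acode a) m /\ represents (asem a s) (mrun (acode a) m).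
Proof.
move=> h hr hx pre; have [h1 h2 h3 h4 [o1 o2 o3]] := h.
have sx : size (ar s x) <= n.+2 by apply: leq_trans (o2 x) _; lia.
have [||ga ra ea] := addr_run h hx _ _ (h2 _ hx) sx; [lia|lia|].
set l := [:: IStore 16 r; IConst 17 1; IAdd (20 + x) (20 + x) 17].
have -> : acode a = addr_code x (20 + x) ++ l by [].
rewrite mrun_cat.
have [k1 k2 k3 k4 k5] := ra.
set m' := mrun _ m in ra ea k1 k2 k3 k4 *.
have g1 : good (upd m' (m' 16) (m' r)).
  by apply: good_upd; rewrite // ?ea ?k1 ?/mem_size //; [lia|have := o1 r; lia].
have g2 : good (upd (upd m' (m' 16) (m' r)) 17 1) by apply: good_upd; rewrite // /mem_size; lia.
split; first by apply: mgood_cat ga _.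
rewrite [mrun l _]/= upd_eq ea k1 // (upd_ne _ _ (_ : 20 + x != 17)); last by lia.
rewrite (upd_ne _ _ (_ : 20 + x != 24 + 4 * size (ar s x) + x)); last by lia.
rewrite k2 // addn1.
by apply/(@repr_tr (set_ar s x _))/repr_push.
Qed.

Lemma atom_repr a s m : atom_ok a -> apre a s -> represents s m ->
  [/\ all simple (acode a), mgood (acode a) m, represents (asem a s) (mrun (acode a) m) &
      mevents (acode a) m = aevents a s].
Proof.
move=> ok pre h; have [h1 h2 h3 h4 h5] := h; have [o1 o2 o3] := h5.
have sc a' v : 16 <= a' < 20 -> v <= 4 * n + 40 -> represents s (upd m a' v) by apply: repr_scratch.
have g m1 : represents s m1 -> good m1 by case.
have o1' r : rg s r <= 4 * n + 40 by have := o1 r; lia.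
case: a ok pre => [r k|r|r i|r|r|r i j|r i j|r i j|r i j|r x i|x r|r x|x r|r|] /=.
- move=> /andP[hr hk] _; split=> //; apply/(@repr_tr (set_rg s r k))/repr_rg => //; lia.
- by move=> hr _; split=> //; apply/(@repr_tr (set_rg s r n))/repr_rg => //; lia.
- move=> /andP[hr hi] _; split=> //.
    by split=> //; split=> //; apply/g/sc.
  apply/(@repr_tr (set_rg s r (rg s i))).
  rewrite upd_eq addn0 upd_ne ?h1 //; last by lia.
  by apply: repr_rg => //; apply: sc.
- move=> hr pre; split=> //.
    by split=> //; split=> //; apply/g/sc => //; lia.
  apply/(@repr_tr (set_rg s r (rg s r).+1)).
  rewrite upd_eq addn1 upd_ne ?h1 //; last by lia.
  by apply: repr_rg => //; apply: sc => //; lia.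
- move=> hr pre; split=> //.
    by split=> //; split=> //; apply/g/sc => //; lia.
  apply/(@repr_tr (set_rg s r (rg s r).-1)).
  rewrite upd_eq subn1 upd_ne ?h1 //; last by lia.
  by apply: repr_rg => //; [apply: sc => //; lia|have := o1 r; lia].
- move=> /and3P[hr hi hj] _; split=> //; rewrite !h1 //.
  by apply/(@repr_tr (set_rg s r _))/repr_rg => //; have := o1 i; lia.
- move=> /and3P[hr hi hj] _; rewrite !h1 //.
  have ij v k : k < 16 -> upd m 16 v k = rg s k by move=> hk; rewrite upd_ne ?h1 //; lia.
  rewrite !ij //.
  have r1 : represents s (upd m 16 (rg s i - rg s j)) by apply: sc => //; have := o1' i; lia.
  have r2 : represents s (upd (upd m 16 (rg s i - rg s j)) 17 (rg s j - rg s i)).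
    by apply: repr_scratch => //; have := o1' j; lia.
  split=> //; first by split=> //; split; [apply: g|split; first apply: g].
  rewrite upd_ne // !upd_eq.
  by apply/(@repr_tr (set_rg s r _))/repr_rg => //; have := o1 i; have := o1 j; lia.
- move=> /and3P[hr hi hj] _; split=> //; rewrite !h1 //.
  by apply/(@repr_tr (set_rg s r _))/repr_rg => //; case: (E _ _).
- move=> /and3P[hr hi hj] _; split=> //; rewrite !h1 //.
  by apply/(@repr_tr (set_rg s r _))/repr_rg => //; case: (K _ _).
- by move=> /and3P[hr hx hi] pre; have [ga ra] := get_repr h hr hx hi pre; split.
- by move=> /andP[hx hr] pre; have [ga ra] := push_repr h hr hx pre; split.
- move=> /andP[hx hr] _; split=> //.
    by split=> //; split=> //; apply/g/sc.
  apply/(@repr_tr (set_rg s r (size (ar s x)))).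
  rewrite upd_eq addn0 upd_ne ?h2 //.
  by apply: repr_rg => //; [apply: sc|have := o2 x; lia].
- move=> /andP[hx hr] pre; split=> //.
    by split=> //; split=> //; apply/g/sc.
  apply/(@repr_tr (set_ar s x (take (rg s r) (ar s x)))).
  rewrite upd_eq addn0 upd_ne ?h1 //; last by lia.
  by apply: repr_cut => //; apply: sc.
- by move=> hr _; split=> //; rewrite ?h1 //; apply: repr_tr.
by move=> _ _; split=> //; apply: repr_tr.
Qed.

Lemma block_repr l s m : all atom_ok l -> block_pre l s -> represents s m ->
  let code := flatten (map acode l) in
  [/\ all simple code, mgood code m, represents (block_sem l s) (mrun code m) &
      tr (block_sem l s) = tr s ++ mevents code m].
Proof.
elim: l s m => /= [|a l IH] s m; first by rewrite cats0.
move=> /andP[oa ol] [pa pl] h; have [h1 h2 h3 h4] := atom_repr oa pa h.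
have [k1 k2 k3 k4] := IH _ _ ol pl h3; split.
- by rewrite all_cat h1.
- exact: mgood_cat.
- by rewrite mrun_cat.
have mc l1 l2 m0 : mevents (l1 ++ l2) m0 = mevents l1 m0 ++ mevents l2 (mrun l1 m0).
  by elim: l1 m0 => //= i l1 IH1 m0; rewrite IH1.
by rewrite mc h4 k4 /= catA.
Qed.

Lemma repr_good s m : represents s m -> good m. Proof. by case. Qed.

Lemma segment_jump off m i l : nth IHalt P off = i -> good m ->
  (i = IJmp l \/ exists r, i = IJz r l /\ m r = 0) -> segment (Cfg off m) [:: ENone] (Cfg l m).
Proof.
move=> e g h.
have e' : step P I (Cfg off m) = (Cfg l m, ENone).
  by rewrite /step /= e; case: h => [->//|[r [-> ->]]].
have -> : [:: ENone] = [:: (step P I (Cfg off m)).2] by rewrite e'.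
apply: SegmentS => //; last by rewrite e'; constructor.
by rewrite /halted /= e; case: h => [->//|[r [-> _]]].
Qed.

Lemma segment_nojump off m r l : nth IHalt P off = IJz r l -> good m -> m r != 0 ->
  segment (Cfg off m) [:: ENone] (Cfg off.+1 m).
Proof.
move=> e g h.
have e' : step P I (Cfg off m) = (Cfg off.+1 m, ENone) by rewrite /step /= e (negPf h).
have -> : [:: ENone] = [:: (step P I (Cfg off m)).2] by rewrite e'.
apply: SegmentS => //; last by rewrite e'; constructor.
by rewrite /halted /= e.
Qed.

(** The induction is on the execution, not on the command: after one round a loop runs again from
    the same offset, and that run is a smaller derivation. *)
Lemma compile_correct c s s' off m : exec c s s' -> cmd_ok c -> code_at off (compile off c) ->
  represents s m -> exists evs m', [/\ tr s' = tr s ++ evs,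
    segment (Cfg off m) evs (Cfg (off + csize c) m') & represents s' m'].
Proof.
move=> x; elim: x off m => {c s s'}.
- move=> l s pre off m /= ok ca h; have [h1 h2 h3 h4] := block_repr ok pre h.
  by exists (mevents (flatten (map acode l)) m), (mrun (flatten (map acode l)) m); split=> //; apply: segment_simple.
- move=> c1 c2 s s1 s2 _ IH1 _ IH2 off m /= /andP[ok1 ok2] /code_at_cat[].
  rewrite size_compile => ca1 ca2 h.
  have [e1 [m1 [t1 g1 h1]]] := IH1 _ _ ok1 ca1 h.
  have [e2 [m2 [t2 g2 h2]]] := IH2 _ _ ok2 ca2 h1.
  exists (e1 ++ e2), m2; split=> //; first by rewrite t2 t1 catA.
  by rewrite addnA; apply: segment_cat g2.
- move=> r c1 c2 s s1 rs _ IH off m /= /and3P[hr ok1 ok2] /code_at_cons[cj] /code_at_cat[].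
  rewrite size_compile => ca1 /code_at_cons[cj2 ca2] h.
  have [e1 [m1 [t1 g1 h1]]] := IH _ _ ok1 ca1 (repr_tr _ h).
  have mr : m r != 0 by case: h => ->.
  have s1' := segment_nojump cj (repr_good h) mr.
  have s3 := segment_jump cj2 (repr_good h1) (or_introl erefl).
  exists (ENone :: e1 ++ [:: ENone]), m1; split.
  + by rewrite /= t1 cat_rcons rcons_cat /= cats1.
  + apply: (segment_cat s1'); apply: (segment_cat g1).
    exact: s3.
  exact: repr_tr.
- move=> r c1 c2 s s1 rs _ IH off m /= /and3P[hr ok1 ok2] /code_at_cons[cj] /code_at_cat[].
  rewrite size_compile => ca1 /code_at_cons[cj2 ca2] h.
  have eo : (off.+1 + csize c1).+1 = off + (csize c1).+2 by lia.
  rewrite eo in ca2.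
  have [e1 [m1 [t1 g1 h1]]] := IH _ _ ok2 ca2 (repr_tr _ h).
  have mr : m r = 0 by case: h => ->.
  have s1' := segment_jump cj (repr_good h) (or_intror (ex_intro _ r (conj erefl mr))).
  exists (ENone :: e1), m1; split=> //; first by rewrite t1 cat_rcons.
  apply: (segment_cat s1').
  by have <- : off + (csize c1).+2 + csize c2 = off + (csize c1 + csize c2).+2 by lia.
- move=> r c s rs off m /= /andP[hr ok1] /code_at_cons[cj _] h.
  have mr : m r = 0 by case: h => ->.
  have s1' := segment_jump cj (repr_good h) (or_intror (ex_intro _ r (conj erefl mr))).
  by exists [:: ENone], m; split; rewrite ?cats1 //; apply: repr_tr.
move=> r c s s1 s2 rs _ IH1 _ IH2 off m ok ca h; have := ok; have := ca.
move=> /= /code_at_cons[cj] /code_at_cat[]; rewrite size_compile.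
move=> ca1 /code_at_cons[cj2 _] /andP[hr ok1].
have [e1 [m1 [t1 g1 h1]]] := IH1 _ _ ok1 ca1 (repr_tr _ h).
have mr : m r != 0 by case: h => ->.
have s1' := segment_nojump cj (repr_good h) mr.
have s3 := segment_jump cj2 (repr_good h1) (or_introl erefl).
have [e2 [m2 [t2 g2 h2]]] := IH2 _ _ ok ca (repr_tr _ h1).
exists (ENone :: e1 ++ ENone :: e2), m2; split=> //.
  by rewrite t2 /= t1 !cat_rcons -catA.
by apply: (segment_cat s1'); apply: (segment_cat g1); apply: (segment_cat s3).
Qed.

End Semantics.

Section Hoare.
Variables (n q : nat) (E K : rel nat).
Notation exec := (exec n q E K).
Notation block_sem := (block_sem n E K).
Notation block_pre := (block_pre n q E K).
Notation regs := (nat -> nat).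
Notation arrays := (nat -> seq nat).
Implicit Types (g : regs) (a : arrays) (rs xs : seq nat) (t : seq event).

(** * A program logic with time, output and frame *)

(** Quantifying over the continuation also forces the piece to end with no unfinished block, which
    is what makes outputs of consecutive pieces concatenate. *)
Definition emits (lab : seq (seq nat)) (evs : seq event) :=
  forall es, blocks [::] (evs ++ es) = lab ++ blocks [::] es.

Lemma emits_silent k : emits [::] (nseq k ENone).
Proof. by move=> es; elim: k. Qed.

Lemma emits_cat l1 e1 l2 e2 : emits l1 e1 -> emits l2 e2 -> emits (l1 ++ l2) (e1 ++ e2).
Proof. by move=> h1 h2 es; rewrite -!catA h1 h2. Qed.

Lemma emits_cons l e : emits l e -> emits l (ENone :: e).
Proof. by move=> h es; apply: h. Qed.

Lemma emits_rcons l e : emits l e -> emits l (rcons e ENone).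
Proof. by move=> h es; rewrite cat_rcons h. Qed.

Definition frame rs xs g a g' a' :=
  (forall r, r \notin rs -> g' r = g r) /\ (forall x, x \notin xs -> a' x = a x).

Lemma frame_refl rs xs g a : frame rs xs g a g a.
Proof. by []. Qed.

Lemma frame_trans rs xs g a g1 a1 g2 a2 :
  frame rs xs g a g1 a1 -> frame rs xs g1 a1 g2 a2 -> frame rs xs g a g2 a2.
Proof. by move=> [h1 h2] [k1 k2]; split=> r hr; rewrite ?k1 ?h1 ?k2 ?h2. Qed.

Lemma frame_sub rs xs rs' xs' g a g' a' : all (mem rs') rs -> all (mem xs') xs ->
  frame rs xs g a g' a' -> frame rs' xs' g a g' a'.
Proof.
move=> /allP h1 /allP h2 [k1 k2]; split=> r hr.
  by apply/k1/(contra _ hr)/h1.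
by apply/k2/(contra _ hr)/h2.
Qed.

(** Total correctness with a time bound [D] and a frame. The events [evs] are chosen before the
    earlier trace [t], so cost and output do not depend on history. *)
Definition ok lab D rs xs c g a (Q : regs -> arrays -> Prop) :=
  exists g' a' evs,
    [/\ forall t, exec c (State g a t) (State g' a' (t ++ evs)),
        emits lab evs, size evs <= D, frame rs xs g a g' a' & Q g' a'].

Lemma ok_conseq lab D rs xs D' rs' xs' c g a (Q Q' : regs -> arrays -> Prop) :
  ok lab D rs xs c g a Q -> D <= D' -> all (mem rs') rs -> all (mem xs') xs ->
  (forall g' a', frame rs xs g a g' a' -> Q g' a' -> Q' g' a') ->
  ok lab D' rs' xs' c g a Q'.
Proof.
move=> [g' [a' [evs [h1 h2 h3 h4 h5]]]] hD hr hx hQ.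
exists g', a', evs; split=> //; [exact: leq_trans hD|exact: frame_sub h4|exact: hQ].
Qed.

Lemma all_mem_refl (rs : seq nat) : all (mem rs) rs.
Proof. exact/allP. Qed.

Lemma ok_seq lab1 D1 rs1 xs1 lab2 D2 rs xs c1 c2 g a (Q1 Q : regs -> arrays -> Prop) :
  ok lab1 D1 rs1 xs1 c1 g a Q1 -> all (mem rs) rs1 -> all (mem xs) xs1 ->
  (forall g1 a1, frame rs1 xs1 g a g1 a1 -> Q1 g1 a1 -> ok lab2 D2 rs xs c2 g1 a1 Q) ->
  ok (lab1 ++ lab2) (D1 + D2) rs xs (Seq c1 c2) g a Q.
Proof.
move=> [g1 [a1 [e1 [h1 h2 h3 h4 h5]]]] hr hx H.
have [g2 [a2 [e2 [k1 k2 k3 k4 k5]]]] := H _ _ h4 h5.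
exists g2, a2, (e1 ++ e2); split=> //.
- by move=> t; apply: XSeq (h1 t) _; rewrite catA.
- exact: emits_cat.
- by rewrite size_cat leq_add.
by apply: frame_trans k4; apply: frame_sub h4.
Qed.

Lemma ok_if lab D rs xs r c1 c2 g a Q :
  (g r != 0 -> ok lab D rs xs c1 g a Q) -> (g r = 0 -> ok lab D rs xs c2 g a Q) ->
  ok lab D.+2 rs xs (If r c1 c2) g a Q.
Proof.
move=> h1 h2; case: (altP (g r =P 0)) => hr.
  have [g' [a' [evs [k1 k2 k3 k4 k5]]]] := h2 hr.
  exists g', a', (ENone :: evs); split=> //=; last by lia.
  by move=> t; apply: XIfF => //; rewrite -cat_rcons; apply: k1.
have [g' [a' [evs [k1 k2 k3 k4 k5]]]] := h1 hr.
exists g', a', (ENone :: rcons evs ENone); split=> //=.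
- move=> t; have := XIfT c2 (s := State g a t) hr (k1 (rcons t ENone)).
  by rewrite /tick /= cat_rcons rcons_cat.
- exact/emits_cons/emits_rcons.
by rewrite size_rcons; lia.
Qed.

(** Each round costs the body plus two jumps and lowers [mu]; the extra unit is the last test. Only
    silent loops are covered. *)
Lemma ok_while D rs xs r c g a (Iv : regs -> arrays -> Prop) (mu : regs -> arrays -> nat) :
  Iv g a ->
  (forall g1 a1, frame rs xs g a g1 a1 -> Iv g1 a1 -> g1 r != 0 ->
     ok [::] D rs xs c g1 a1 (fun g2 a2 => Iv g2 a2 /\ mu g2 a2 < mu g1 a1)) ->
  ok [::] (mu g a * D.+2).+1 rs xs (While r c) g a (fun g' a' => Iv g' a' /\ g' r = 0).
Proof.
move=> hI H.
have [m hm] := ubnP (mu g a); elim: m g a hm hI H => // m IH g a hm hI H.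
case: (altP (g r =P 0)) => hr.
  exists g, a, [:: ENone]; split=> //.
  by move=> t; rewrite cats1; apply: XWhileF.
have [g1 [a1 [e1 [h1 h2 h3 h4 [h5 h6]]]]] := H _ _ (frame_refl _ _ _ _) hI hr.
have [||g2 [a2 [e2 [k1 k2 k3 k4 [k5 k6]]]]] := IH g1 a1 _ h5; first lia.
  by move=> g2 a2 hf; apply: H; apply: frame_trans hf.
exists g2, a2, (ENone :: e1 ++ ENone :: e2); split=> //.
- move=> t; apply: (XWhileT (s := State g a t) hr (h1 (rcons t ENone))).
  by have := k1 (rcons (rcons t ENone ++ e1) ENone); rewrite !cat_rcons -catA.
- by apply: emits_cons; apply: (emits_cat h2); apply: emits_cons.
- rewrite /= size_cat /=; nia.
exact: frame_trans k4.
Qed.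

Definition silent_atom (b : atom) := match b with AOut _ | ASep => false | _ => true end.
Definition atom_writes rs xs (b : atom) :=
  match b with
  | AConst r _ | AN r | AMov r _ | AInc r | ADec r | ASub r _ _ | ANeq r _ _ | AAdj r _ _
  | ABlack r _ _ | AGet r _ _ | ALen r _ => r \in rs
  | APush x _ | ACut x _ => x \in xs
  | AOut _ | ASep => true
  end.

Lemma frame_atom rs xs b s s' : atom_writes rs xs b -> s' = asem n E K b s ->
  frame rs xs (rg s) (ar s) (rg s') (ar s').
Proof.
move=> h ->; split=> z hz; case: b h => //= *; rewrite /upd; case: eqP => // e; by rewrite e in hz; case/negP: hz.
Qed.

Lemma block_sem_data l s s' : rg s = rg s' -> ar s = ar s' ->
  [/\ rg (block_sem l s) = rg (block_sem l s'), ar (block_sem l s) = ar (block_sem l s') &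
      block_pre l s -> block_pre l s'].
Proof.
elim: l s s' => //= b l IH s s' er ea.
have [||h1 h2 h3] := IH (asem n E K b s) (asem n E K b s').
- by case: b => //= *; rewrite er ?ea.
- by case: b => //= *; rewrite ea ?er.
split=> // -[p1 p2]; split; last exact: h3.
by case: b p1 {p2 h1 h2 h3} => //= *; rewrite -?er -?ea.
Qed.

Lemma block_sem_tr l s : all silent_atom l ->
  tr (block_sem l s) = tr s ++ nseq (size (flatten (map acode l))) ENone.
Proof.
elim: l s => /= [|b l IH] s; first by rewrite cats0.
move=> /andP[sb sl]; rewrite IH // size_cat nseqD catA; congr (_ ++ _).
by case: b sb.
Qed.

Lemma ok_block D rs xs l g a (s := block_sem l (State g a [::])) (Q : regs -> arrays -> Prop) :
  block_pre l (State g a [::]) -> all silent_atom l -> all (atom_writes rs xs) l ->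
  size (flatten (map acode l)) <= D -> Q (rg s) (ar s) -> ok [::] D rs xs (Block l) g a Q.
Proof.
move=> p sl wl hD hQ.
exists (rg s), (ar s), (nseq (size (flatten (map acode l))) ENone); split=> //.
- move=> t; have [h1 h2 h3] := @block_sem_data l (State g a [::]) (State g a t) erefl erefl.
  have := XBlock (h3 p); move: (block_sem_tr (State g a t) sl); rewrite /s h1 h2.
  by case: (block_sem l (State g a t)) => g2 a2 t2 /= ->.
- exact: emits_silent.
- by rewrite size_nseq.
have H s0 : frame rs xs (rg s0) (ar s0) (rg (block_sem l s0)) (ar (block_sem l s0)).
  elim: (l) wl s0 => //= b l' IH /andP[wb wl] s0.
  by apply: frame_trans (IH wl _); apply: frame_atom wb _.
exact: H.
Qed.

(** * Loops over an array, from its last entry down *)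

Definition down x body :=
  Seq (Block [:: ALen 5 x]) (While 5 (Seq (Block [:: ADec 5; AGet 6 x 5]) body)).

(** [J i] describes the state once the entries from [i] on have been treated. Counting down makes
    the counter itself the loop condition, as the language only tests against zero. *)
Lemma ok_down D rs xs x body g a (J : nat -> regs -> arrays -> Prop) :
  5 \in rs -> 6 \in rs -> x \notin xs ->
  J (size (a x)) (upd g 5 (size (a x))) a ->
  (forall i g1 a1, frame rs xs g a g1 a1 -> i < size (a x) -> J i.+1 g1 a1 ->
     ok [::] D rs xs body (upd (upd g1 5 i) 6 (nth 0 (a x) i)) a1
       (fun g2 a2 => g2 5 = i /\ J i g2 a2)) ->
  ok [::] (size (a x) * (D + 9) + 3) rs xs (down x body) g a (J 0).
Proof.
move=> r5 r6 nx j0 H.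
have h1 : ok [::] 2 rs xs (Block [:: ALen 5 x]) g a (fun g1 a1 => a1 = a /\ g1 = upd g 5 (size (a x))).
  by apply: ok_block; rewrite //= r5.
have H2 : ok [::] (2 + (size (a x) * (7 + D).+2).+1) rs xs (down x body) g a
   (fun g' a' => (g' 5 <= size (a x) /\ J (g' 5) g' a') /\ g' 5 = 0).
  apply: (ok_seq h1); rewrite ?all_mem_refl //.
  move=> g1 a1 f1 [ea eg]; subst a1 g1.
  pose mu (g2 : regs) (a2 : arrays) := g2 5.
  have <- : mu (upd g 5 (size (a x))) a = size (a x) by rewrite /mu upd_eq.
  apply: (ok_while (Iv := fun g2 a2 => g2 5 <= size (a x) /\ J (g2 5) g2 a2)).
    by rewrite upd_eq.
  move=> g2 a2 f2 [l2 j2] n2.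
  have f3 := frame_trans f1 f2.
  have ex : a2 x = a x by apply: (proj2 f3).
  have e2 : g2 5 = (g2 5).-1.+1 by rewrite prednK // lt0n.
  have hb : ok [::] 7 rs xs (Block [:: ADec 5; AGet 6 x 5]) g2 a2
     (fun g3 a3 => a3 = a2 /\ g3 = upd (upd g2 5 (g2 5).-1) 6 (nth 0 (a x) (g2 5).-1)).
    apply: ok_block; rewrite //= ?r5 ?r6 //.
      by split=> //; split=> //; rewrite upd_eq ex -e2.
    by rewrite upd_eq ex.
  apply: (ok_seq hb); rewrite ?all_mem_refl //.
  move=> g3 a3 _ [-> ->].
  have hi : (g2 5).-1 < size (a x) by rewrite -e2.
  rewrite e2 in j2.
  apply: (ok_conseq (H _ _ _ f3 hi j2)); rewrite ?all_mem_refl //.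
  by move=> g4 a4 _ [e j]; rewrite /mu e; split; [split=> //; lia|lia].
apply: (ok_conseq H2); rewrite ?all_mem_refl //; first lia.
by move=> g' a' _ [[_ j] e]; rewrite e in j.
Qed.

End Hoare.

(** * Elementary routines on a single array *)

Section HoareMore.
Variables (n q : nat) (E K : rel nat).
Notation ok := (ok n q E K).
Notation block_sem := (block_sem n E K).
Notation block_pre := (block_pre n q E K).

Lemma ok_le lab D D' rs xs c g a Q :
  ok lab D rs xs c g a Q -> D <= D' -> ok lab D' rs xs c g a Q.
Proof. by move=> h hD; apply: (ok_conseq h); rewrite ?all_mem_refl. Qed.

Lemma ok_post lab D rs xs c g a (Q Q' : (nat -> nat) -> (nat -> seq nat) -> Prop) :
  ok lab D rs xs c g a Q -> (forall g' a', frame rs xs g a g' a' -> Q g' a' -> Q' g' a') ->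
  ok lab D rs xs c g a Q'.
Proof. by move=> h hQ; apply: (ok_conseq h); rewrite ?all_mem_refl. Qed.

Lemma ok_bseq lab D rs xs l c g a (s := block_sem l (State g a [::])) Q :
  block_pre l (State g a [::]) -> all silent_atom l -> all (atom_writes rs xs) l ->
  ok lab D rs xs c (rg s) (ar s) Q ->
  ok lab (size (flatten (map acode l)) + D) rs xs (Seq (Block l) c) g a Q.
Proof.
move=> p sl wl h; rewrite -[lab]cat0s.
have hb : ok [::] (size (flatten (map acode l))) rs xs (Block l) g a
    (fun g1 a1 => g1 = rg s /\ a1 = ar s) by apply: ok_block.
by apply: (ok_seq hb); rewrite ?all_mem_refl // => g1 a1 _ [-> ->].
Qed.

Lemma ok_call D1 rs1 xs1 (Q1 : (nat -> nat) -> (nat -> seq nat) -> Prop) lab D2 rs xs c1 c2 g a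
    (Q : (nat -> nat) -> (nat -> seq nat) -> Prop) :
  ok [::] D1 rs1 xs1 c1 g a Q1 -> all (mem rs) rs1 -> all (mem xs) xs1 ->
  (forall g1 a1, frame rs1 xs1 g a g1 a1 -> Q1 g1 a1 -> ok lab D2 rs xs c2 g1 a1 Q) ->
  ok lab (D1 + D2) rs xs (Seq c1 c2) g a Q.
Proof. exact: ok_seq. Qed.

Lemma neqE x y : (x - y + (y - x) == 0) = (x == y).
Proof. lia. Qed.

Definition nop := Block [::].

Lemma ok_nop D rs xs g a (Q : _ -> _ -> Prop) : Q g a -> ok [::] D rs xs nop g a Q.
Proof. by move=> h; apply: ok_block. Qed.

Lemma ok_down' D rs xs x body g a (J : nat -> (nat -> nat) -> (nat -> seq nat) -> Prop)
    (Q : (nat -> nat) -> (nat -> seq nat) -> Prop) D' :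
  5 \in rs -> 6 \in rs -> x \notin xs -> size (a x) <= q.+2 ->
  J (size (a x)) (upd g 5 (size (a x))) a ->
  (forall i g1 a1, frame rs xs g a g1 a1 -> i < size (a x) -> J i.+1 g1 a1 ->
     ok [::] D rs xs body (upd (upd g1 5 i) 6 (nth 0 (a x) i)) a1
       (fun g2 a2 => g2 5 = i /\ J i g2 a2)) ->
  (forall g1 a1, frame rs xs g a g1 a1 -> J 0 g1 a1 -> Q g1 a1) ->
  q.+2 * (D + 9) + 3 <= D' ->
  ok [::] D' rs xs (down x body) g a Q.
Proof.
move=> r5 r6 nx hs j0 H hQ hD.
have h := ok_down r5 r6 nx j0 H.
by apply: (ok_conseq h); rewrite ?all_mem_refl //; apply: leq_trans hD; nia.
Qed.

Definition memb y u := Seq (Block [:: AConst 8 0])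
  (down y (Seq (Block [:: ANeq 7 6 u]) (If 7 nop (Block [:: AConst 8 1])))).

Lemma ok_memb y u g a : size (a y) <= q.+2 -> u \notin [:: 5; 6; 7; 8] ->
  ok [::] (40 * q.+2) [:: 5; 6; 7; 8] [::] (memb y u) g a
    (fun g' _ => g' 8 = (g u \in a y)).
Proof.
move=> hs hu; have hu' := hu; rewrite !inE !negb_or in hu'; case/and4P: hu' => u5 u6 u7 u8.
apply: (@ok_le _ (1 + 39 * q.+2)); last by lia.
apply: ok_bseq => //=.
apply: (@ok_down' 6 _ _ _ _ _ _ (fun i g1 a1 => g1 8 = (g u \in drop i (a y)))) => //=.
- by rewrite drop_size.
- move=> i g1 a1 [f1 f2] hi j1.
  have eu : g1 u = g u by rewrite f1 // upd_ne.
  apply: (@ok_bseq _ 3) => //=.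
  rewrite !(upd_ne _ _ u5, upd_ne _ _ u6) eu.
  apply: ok_if => /= h; apply: ok_block => //=; rewrite (drop_nth 0) // inE; split=> //.
    by move: h; rewrite upd_eq neqE eq_sym => /negPf->; rewrite -j1.
  by move/eqP: h; rewrite upd_eq neqE eq_sym => /eqP->; rewrite eqxx.
- by move=> g1 a1 _; rewrite drop0.
by lia.
Qed.

Definition alladj x u := Seq (Block [:: AConst 8 1])
  (down x (Seq (Block [:: AAdj 7 u 6]) (If 7 nop (Block [:: AConst 8 0])))).

Lemma ok_alladj x u g a : size (a x) <= q.+2 -> u \notin [:: 5; 6; 7; 8] ->
  ok [::] (40 * q.+2) [:: 5; 6; 7; 8] [::] (alladj x u) g a
    (fun g' _ => g' 8 = all (E (g u)) (a x)).
Proof.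
move=> hs hu; have hu' := hu; rewrite !inE !negb_or in hu'; case/and4P: hu' => u5 u6 u7 u8.
apply: (@ok_le _ (1 + 39 * q.+2)); last by lia.
apply: ok_bseq => //=.
apply: (@ok_down' 4 _ _ _ _ _ _ (fun i g1 a1 => g1 8 = all (E (g u)) (drop i (a x)))) => //=.
- by rewrite drop_size.
- move=> i g1 a1 [f1 f2] hi j1.
  have eu : g1 u = g u by rewrite f1 // upd_ne.
  apply: (@ok_bseq _ 3) => //=.
  rewrite !(upd_ne _ _ u5, upd_ne _ _ u6) eu.
  apply: ok_if => /= h; apply: ok_block => //=; rewrite (drop_nth 0) //=; split=> //.
    by move: h; rewrite !upd_eq -[upd _ _ _ 8]/(g1 8) j1; case: (E _ _).
  by move: h; rewrite !upd_eq; case: (E _ _).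
- by move=> g1 a1 _; rewrite drop0.
by lia.
Qed.

Definition eqarr x y := Seq (Block [:: ALen 6 x; ALen 7 y; ANeq 7 6 7])
  (If 7 (Block [:: AConst 8 0])
    (Seq (Block [:: AConst 8 1])
      (down x (Seq (Block [:: AGet 7 y 5; ANeq 7 6 7]) (If 7 (Block [:: AConst 8 0]) nop))))).

Lemma ok_eqarr x y g a : size (a x) <= q.+2 ->
  ok [::] (40 * q.+2) [:: 5; 6; 7; 8] [::] (eqarr x y) g a
    (fun g' _ => g' 8 = (a x == a y)).
Proof.
move=> hs; apply: (@ok_le _ (7 + (2 + (1 + 35 * q.+2)))); last by lia.
apply: ok_bseq => //=; apply: ok_if => /=; rewrite !(upd_eq, upd_ne) //.
  rewrite neqE => ne; apply: ok_block => //=.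
  by rewrite upd_eq; case: eqP => // e; rewrite e eqxx in ne.
move/eqP; rewrite neqE => /eqP es; apply: ok_bseq => //=.
apply: (@ok_down' 11 _ _ _ _ _ _
  (fun i g1 a1 => g1 8 = (drop i (a x) == drop i (a y)))) => //=.
- by rewrite drop_size es drop_size.
- move=> i g1 a1 [f1 f2] hi j1; have ey := f2 y isT; have hy : i < size (a y) by rewrite -es.
  apply: (@ok_bseq _ 3) => //=; first by rewrite !(upd_eq, upd_ne) // ey.
  rewrite !(upd_eq, upd_ne) // ey.
  apply: ok_if => /=; rewrite upd_eq => h; apply: ok_block => //=;
    rewrite (drop_nth 0) // (drop_nth 0 hy) eqseq_cons; split=> //.
    by move: h; rewrite neqE => /negPf->.
  by move/eqP: h; rewrite neqE => ->; rewrite /= -j1.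
- by move=> g1 a1 _; rewrite !drop0.
by lia.
Qed.

(** Overwriting during a downward scan leaves the smallest index, and the initial value is the
    length, which is the convention of [index] for an absent vertex. *)
Definition indexarr x u := Seq (Block [:: ALen 8 x])
  (down x (Seq (Block [:: ANeq 7 6 u]) (If 7 nop (Block [:: AMov 8 5])))).

Lemma ok_indexarr x u g a : size (a x) <= q.+2 -> u \notin [:: 5; 6; 7; 8] ->
  ok [::] (40 * q.+2) [:: 5; 6; 7; 8] [::] (indexarr x u) g a
    (fun g' _ => g' 8 = index (g u) (a x)).
Proof.
move=> hs hu; have hu' := hu; rewrite !inE !negb_or in hu'; case/and4P: hu' => u5 u6 u7 u8.
apply: (@ok_le _ (2 + 38 * q.+2)); last by lia.
apply: ok_bseq => //=.
apply: (@ok_down' 7 _ _ _ _ _ _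
  (fun i g1 a1 => g1 8 = i + index (g u) (drop i (a x)))) => //=.
- by rewrite drop_size addn0.
- move=> i g1 a1 [f1 f2] hi j1.
  have eu : g1 u = g u by rewrite f1 // upd_ne.
  apply: (@ok_bseq _ 4) => //=.
  rewrite !(upd_ne _ _ u5, upd_ne _ _ u6) eu.
  apply: ok_if => /=; rewrite !upd_eq => h; apply: ok_block => //=; rewrite (drop_nth 0) //=; split=> //.
    by move: h; rewrite neqE => /negPf->; rewrite -addSnnS -j1.
  by move/eqP: h; rewrite neqE => ->; rewrite addn0.
- by move=> g1 a1 _; rewrite drop0.
by lia.
Qed.

Definition minarr x := Seq (Block [:: AN 8])
  (down x (Seq (Block [:: ASub 7 8 6]) (If 7 (Block [:: AMov 8 6]) nop))).

Lemma ok_minarr x g a : size (a x) <= q.+2 ->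
  ok [::] (40 * q.+2) [:: 5; 6; 7; 8] [::] (minarr x) g a
    (fun g' _ => g' 8 = least n (a x)).
Proof.
move=> hs; apply: (@ok_le _ (1 + 39 * q.+2)); last by lia.
apply: ok_bseq => //=.
apply: (@ok_down' 5 _ _ _ _ _ _ (fun i g1 a1 => g1 8 = least n (drop i (a x)))) => //=.
- by rewrite drop_size.
- move=> i g1 a1 [f1 f2] hi j1.
  apply: (@ok_bseq _ 4) => //=.
  apply: ok_if => /=; rewrite !(upd_eq, upd_ne) // j1 => h; apply: ok_block => //=;
    rewrite [drop i _](drop_nth 0) //=; split=> //.
    by rewrite !(upd_eq, upd_ne) // /minn; case: ltnP => //; lia.
  by rewrite !(upd_eq, upd_ne) // j1 /minn; case: ltnP => //; lia.
- by move=> g1 a1 _; rewrite drop0.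
by lia.
Qed.

Hypothesis qn : q <= n.

Definition copyarr y x r := Seq (Block [:: AConst 5 0; ACut y 5; ASub 7 r 5])
  (While 7 (Block [:: AGet 6 x 5; APush y 6; AInc 5; ASub 7 r 5])).

Lemma ok_copyarr y x r g a : x != y -> r \notin [:: 5; 6; 7] -> size (a x) <= q.+2 ->
  g r <= size (a x) ->
  ok [::] (40 * q.+2) [:: 5; 6; 7] [:: y] (copyarr y x r) g a
    (fun _ a' => a' y = take (g r) (a x)).
Proof.
move=> xy hr hs hg; have hr' := hr; rewrite !inE !negb_or in hr'; case/and3P: hr' => r5 r6 r7.
apply: (@ok_le _ (4 + (g r * 17).+1)); last by lia.
apply: ok_bseq => //=; first by rewrite inE eqxx.
rewrite upd_eq subn0 upd_ne // take0.
set g0 := upd _ 7 _; set a0 := fun _ => _.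
pose mu (g2 : nat -> nat) (a2 : nat -> seq nat) := g2 7.
have e0 : mu g0 a0 = g r by rewrite /mu /g0 upd_eq.
rewrite -[X in (X * _).+1]e0.
apply: ok_post.
  apply: (ok_while (Iv := fun g2 a2 =>
    [/\ g2 5 <= g r, a2 y = take (g2 5) (a x) & g2 7 = g r - g2 5])).
    by rewrite /g0 /a0 !(upd_eq, upd_ne) // eqxx take0 subn0.
  move=> g1 a1 [f1 f2] [h1 h2 h3] h4.
  have er : g1 r = g r by rewrite f1 // /g0 !upd_ne.
  have ex : a1 x = a x by rewrite f2 ?inE // /a0 (negPf xy).
  have h5 : g1 5 < g r by lia.
  have h6 : g1 5 < size (a x) by apply: leq_trans hg.
  have st : size (take (g1 5) (a x)) = g1 5 by rewrite size_take h6.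
  apply: ok_block => //=.
  - rewrite !(upd_eq, upd_ne) // ex h2 st; split=> //; split; first by lia.
    by split=> //; lia.
  - by rewrite inE eqxx.
  rewrite /mu !(upd_eq, upd_ne) // er eqxx h2 ex take_S_nth //; do !split=> //; lia.
by move=> g' a' _ [[h1 h2 h3] h4]; rewrite h2; congr take; lia.
Qed.

End HoareMore.

(** * Routines for completion, canonical order, parent, child and the child test *)

Section Routines.
Variables (n q : nat) (E K : rel nat).
Hypothesis G : black_white n E K.
Hypothesis valid_q : forall X, valid n E K X -> size X <= q.
Hypothesis qn : q <= n.

Notation ok := (ok n q E K).
Notation valid := (valid n E K).
Notation complete := (complete n E K).
Notation canon := (canon n E K).
Notation sol := (sol n E K).

(* Array 0 holds the current node P, 1 a sequence being completed, 2 a solution whose parent is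
   sought (before that, the filter of a restricted sweep), 3 this parent.  Scalars 0 and 1 hold
   the candidate (v, j), 2 the parity, 3 the flag of the main loop, 8 the result of a test. *)
Definition sweep_row x flt :=
  Seq (Block [:: AGet 6 x 9; ABlack 7 6 11])
  (Seq (If 7 (Seq flt (If 8 (Seq (alladj x 11) (If 8 (Block [:: APush x 11]) nop)) nop)) nop)
    (Block [:: AInc 11; AN 12; ASub 12 12 11])).

(** The array grows while it is swept, so the number of remaining rows is recomputed from its length
    after each row. It stays valid, hence there are at most [q] rows. *)
Definition sweep x flt :=
  Seq (Block [:: AConst 9 0; ALen 10 x; ASub 10 10 9])
    (While 10 (Seq (Block [:: AConst 11 0; AN 12; ASub 12 12 11])
                (Seq (While 12 (sweep_row x flt))
                  (Block [:: AInc 9; ALen 10 x; ASub 10 10 9])))).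

(** The filter may depend on any array except the one being grown; scalar 11 holds the vertex under
    test. *)
Definition filter_spec x flt (F : pred nat) (a : nat -> seq nat) :=
  forall g1 a1, (forall z, z != x -> a1 z = a z) ->
    ok [::] (40 * q.+2) [:: 5; 6; 7; 8] [::] flt g1 a1 (fun g' _ => g' 8 = F (g1 11)).

Definition sweep_regs := [:: 5; 6; 7; 8; 9; 10; 11; 12].

Lemma ok_sweep_row x flt F X0 g a0 a : filter_spec x flt F a0 ->
  (forall z, z != x -> a z = a0 z) ->
  partial_greedy n E K F X0 (a x) (g 9 * n + g 11) -> g 9 < size (a x) -> g 11 < n ->
  ok [::] (95 * q.+2) [:: 5; 6; 7; 8; 11; 12] [:: x] (sweep_row x flt) g a
    (fun g' a' => [/\ partial_greedy n E K F X0 (a' x) (g 9 * n + g' 11), g 9 < size (a' x),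
       g' 11 = (g 11).+1 & g' 12 = n - g' 11]).
Proof.
move=> fs ez pg l9 l11; set rs := [:: 5; _; _; _; _; _].
have vX : valid (a x) by case: pg.
have sX := valid_q vX.
pose T := [&& F (g 11), K (nth 0 (a x) (g 9)) (g 11) & all (E (g 11)) (a x)].
pose X' := if T then rcons (a x) (g 11) else a x.
have pg' : partial_greedy n E K F X0 X' (g 9 * n + (g 11).+1).
  rewrite /X'; case: ifP => [/and3P[h1 h2 h3]|/negbT h].
    exact: (partial_greedy_push G pg).
  exact: (partial_greedy_skip G pg).
have l9' : g 9 < size X' by rewrite /X'; case: ifP; rewrite ?size_rcons // ltnS ltnW.
have hfin g1 a1 : g1 9 = g 9 -> g1 11 = g 11 -> a1 x = X' ->
    ok [::] 4 rs [:: x] (Block [:: AInc 11; AN 12; ASub 12 12 11]) g1 a1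
    (fun g' a' => [/\ partial_greedy n E K F X0 (a' x) (g 9 * n + g' 11), g 9 < size (a' x),
       g' 11 = (g 11).+1 & g' 12 = n - g' 11]).
  move=> e9 e11 ex; apply: ok_block => //=.
    by rewrite e11; split=> //; lia.
  by rewrite !(upd_eq, upd_ne) // e11 ex.
apply: (@ok_le _ _ _ _ _ (6 + ((40 * q.+2 + (40 * q.+2 + 9).+2).+2 + 4))); last by lia.
apply: (@ok_bseq _ _ _ _ [::]) => //=.
rewrite !(upd_eq, upd_ne) //.
set g0 := upd _ 7 _.
have e9 : g0 9 = g 9 by []. have e11 : g0 11 = g 11 by []. have e7 : g0 7 = K (nth 0 (a x) (g 9)) (g 11) by [].
clearbody g0.
pose Q (g1 : nat -> nat) (a1 : nat -> seq nat) := a1 x = X'.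
apply: (@ok_call _ _ _ _ _ [:: 5; 6; 7; 8] [:: x] Q) => //; last first.
  move=> g1 a1 [f1 f2] h; apply: hfin => //; by rewrite f1.
apply: ok_if; rewrite e7 => hk; last first.
  apply: ok_nop; rewrite /Q /X' /T; move: hk.
  by case: (K _ _) => //; rewrite andbF.
apply: (ok_call (fs _ _ ez)) => // g1 a1 [f1 f2] h8.
have ex : a1 x = a x by apply: f2.
rewrite e11 in h8.
apply: ok_if; rewrite h8 => hF; last first.
  apply: ok_nop; rewrite /Q ex /X' /T; move: hF.
  by case: (F _).
apply: (@ok_call _ _ _ _ _ [:: 5; 6; 7; 8] [::]
  (fun g' _ => g' 8 = all (E (g1 11)) (a1 x))) => //.
  by apply: ok_alladj => //; rewrite ex; lia.
move=> g2 a2 [k1 k2]; rewrite ex (f1 11) // e11 => h8'.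
have ex2 : a2 x = a x by rewrite k2.
have e11' : g2 11 = g 11 by rewrite k1 // f1.
have K1 : K (nth 0 (a x) (g 9)) (g 11) by move: hk; case: (K _ _).
have F1 : F (g 11) by move: hF; case: (F _).
apply: ok_if; rewrite h8' => hA.
  apply: ok_block => //=; first by rewrite ex2; split=> //; lia.
    by rewrite inE eqxx.
  by rewrite /Q eqxx ex2 e11' /X' /T K1 F1; move: hA; case: (all _ _).
apply: ok_nop; rewrite /Q ex2 /X' /T F1 K1; move: hA.
by case: (all _ _).
Qed.

(** At most [q] rows of [n] vertices, each with O(q) work for the filter and the adjacency test. *)
Definition sweep_time := 120 * (q.+2 * q.+2 * n.+1).

Lemma ok_sweep x flt F g a : filter_spec x flt F a -> valid (a x) ->
  ok [::] sweep_time sweep_regs [:: x] (sweep x flt) g a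
    (fun _ a' => a' x = complete F (a x)).
Proof.
move=> fs vX; set rs := sweep_regs.
pose row := (3 + ((n * (95 * q.+2).+2).+1 + 5)).
apply: (@ok_le _ _ _ _ _ (4 + (q * row.+2).+1)); last by rewrite /sweep_time /row; nia.
apply: (@ok_bseq _ _ _ _ [::]) => //=.
rewrite !(upd_eq, upd_ne) // subn0.
set g0 := upd _ 10 _.
have e9 : g0 9 = 0 by []. have e10 : g0 10 = size (a x) by [].
clearbody g0.
pose mu (g2 : nat -> nat) (a2 : nat -> seq nat) := q - g2 9.
apply: (@ok_le _ _ _ _ _ (mu g0 a * row.+2).+1); last by rewrite /mu e9 subn0.
pose Iv (g1 : nat -> nat) (a1 : nat -> seq nat) :=
  [/\ partial_greedy n E K F (a x) (a1 x) (g1 9 * n), g1 9 <= size (a1 x) &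
      g1 10 = size (a1 x) - g1 9].
apply: ok_post.
  apply: (ok_while (Iv := Iv)).
    by rewrite /Iv e9 e10 subn0; split=> //; apply: partial_greedy0.
  move=> g1 a1 [f1 f2] [h1 h2 h3] h4.
  have l9 : g1 9 < size (a1 x) by rewrite h3 in h4; lia.
  have {h4} ez z : z != x -> a1 z = a z by move=> zx; rewrite f2 // inE.
  apply: (@ok_bseq _ _ _ _ [::]) => //=.
  rewrite !(upd_eq, upd_ne) // subn0.
  set g2 := upd _ 12 _.
  have e2 : g2 9 = g1 9 by []. have e11 : g2 11 = 0 by []. have e12 : g2 12 = n by [].
  clearbody g2.
  pose Jv (g3 : nat -> nat) (a3 : nat -> seq nat) :=
    [/\ partial_greedy n E K F (a x) (a3 x) (g1 9 * n + g3 11), g1 9 < size (a3 x),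
        g3 11 <= n & g3 12 = n - g3 11].
  pose nu (g3 : nat -> nat) (a3 : nat -> seq nat) := n - g3 11.
  have en : nu g2 a1 = n by rewrite /nu e11 subn0.
  apply: (@ok_le _ _ _ _ _ ((nu g2 a1 * (95 * q.+2).+2).+1 + 5)); last by rewrite en.
  apply: (@ok_call _ _ _ _ _ [:: 5; 6; 7; 8; 11; 12] [:: x]
    (fun g3 a3 => Jv g3 a3 /\ g3 12 = 0)) => //; last first.
  - move=> g3 a3 [k1 k2] [[j1 j2 j3 j4] j5].
    have e39 : g3 9 = g1 9 by rewrite k1.
    have v3 : valid (a3 x) by case: j1.
    have := valid_q v3 => s3.
    apply: ok_block => //=; first by rewrite e39; split=> //; lia.
    rewrite /Iv /mu !(upd_eq, upd_ne) // e39; split; last by lia.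
    split=> //; rewrite mulSn addnC.
    have e : g3 11 = n by lia.
    by rewrite e in j1.
  - apply: (ok_while (Iv := Jv)).
      by rewrite /Jv e11 e12 addn0 subn0.
    move=> g3 a3 [k1 k2] [j1 j2 j3 j4] j5.
    have e39 : g3 9 = g1 9 by rewrite k1.
    apply: ok_post.
      apply: (ok_sweep_row fs (X0 := a x)).
      - by move=> z zx; rewrite k2 ?inE // ez.
      - by rewrite e39.
      - by rewrite e39.
      by move: j5; rewrite j4; lia.
    move=> g4 a4 _ [i1 i2 i3 i4]; rewrite e39 in i1 i2.
    rewrite /Jv /nu; rewrite j4 in j5; split; last by lia.
    by split=> //; lia.
move=> g' a' _ [[h1 h2 h3] h4]; apply/esym/(completeE G) => //.
have e : g' 9 = size (a' x) by lia.
by rewrite e in h1; apply: (partial_greedy_stop G).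
Qed.

Lemma filter_spec_memb x y a : y != x -> size (a y) <= q.+2 ->
  filter_spec x (memb y 11) (mem (a y)) a.
Proof.
move=> yx sy g1 a1 e; apply: ok_post; first by apply: ok_memb; rewrite // e.
by move=> g' a' _ ->; rewrite e.
Qed.

Lemma filter_spec_true x a : filter_spec x (Block [:: AConst 8 1]) predT a.
Proof. by move=> g1 a1 e; apply: ok_block. Qed.

Definition canonarr y x :=
  Seq (Block [:: AConst 5 0; ACut y 5; ALen 7 x])
    (If 7 (Seq (minarr x) (Seq (Block [:: APush y 8]) (sweep y (memb x 11)))) nop).

Lemma ok_canonarr y x g a : x != y -> valid (a x) ->
  ok [::] (2 * sweep_time) sweep_regs [:: y] (canonarr y x) g a
    (fun _ a' => a' y = canon (a x)).
Proof.
move=> xy vX; have sX := valid_q vX; have sX2 : size (a x) <= q.+2 by lia.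
apply: (@ok_le _ _ _ _ _ (5 + (40 * q.+2 + (7 + sweep_time)).+2)); last by rewrite /sweep_time; nia.
apply: (@ok_bseq _ _ _ _ [::]) => //=; first by rewrite inE eqxx.
rewrite (negPf xy) !(upd_eq, upd_ne) // take0.
set g0 := upd _ 7 _; set a0 := fun _ => _.
have a0x : a0 x = a x by rewrite /a0 (negPf xy).
have a0y : a0 y = [::] by rewrite /a0 eqxx.
have e7 : g0 7 = size (a x) by [].
clearbody g0 a0.
apply: ok_if; rewrite e7 => hs; last first.
  by apply: ok_nop; rewrite a0y /canon (size0nil hs).
rewrite size_eq0 in hs.
apply: (@ok_call _ _ _ _ _ [:: 5; 6; 7; 8] [::]
  (fun g' _ => g' 8 = least n (a x))) => //.
  by rewrite -a0x; apply: ok_minarr; rewrite a0x; lia.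
move=> g1 a1 [f1 f2] h8.
apply: (@ok_bseq _ _ _ _ [::]) => //=; try by rewrite ?inE eqxx.
  by rewrite f2 // a0y.
rewrite f2 // a0y h8 /=; set a2 := fun _ => _.
have a2y : a2 y = [:: least n (a x)] by rewrite /a2 eqxx.
have a2x : a2 x = a x by rewrite /a2 (negPf xy) f2.
apply: ok_post; first apply: ok_sweep.
- by apply: filter_spec_memb; rewrite // a2x.
- by rewrite a2y; apply: least_valid.
by move=> g' a' _ ->; rewrite a2y a2x canonE.
Qed.

(** Scalar 14 carries the result of the comparison and so the loop condition. When the loop stops,
    array 1 already holds the differing completion, and only its canonical order remains to be
    computed. *)
Definition parentarr :=
  Seq (Block [:: ALen 13 2; AConst 14 1])
  (Seq (While 14 (Seq (Block [:: ADec 13]) (Seq (copyarr 1 2 13)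
     (Seq (sweep 1 (Block [:: AConst 8 1])) (Seq (eqarr 1 2) (Block [:: AMov 14 8]))))))
  (canonarr 3 1)).

Definition parent_time := 5 * (q.+2 * sweep_time).

Lemma ok_parentarr g a : sol (a 2) ->
  ok [::] parent_time (13 :: 14 :: sweep_regs) [:: 1; 3] parentarr g a
    (fun g' a' => a' 3 = parent n E K (a 2) /\ g' 13 = parent_pos n E K (a 2)).
Proof.
move=> sB; have [B0 vB cB mB] := sB; have sizeB := valid_q vB.
set B := a 2 in sB B0 vB cB mB sizeB *.
pose body := (2 + (40 * q.+2 + (sweep_time + (40 * q.+2 + 2)))).
apply: (@ok_le _ _ _ _ _ (3 + ((size B * body.+2).+1 + 2 * sweep_time))); last first.
  rewrite /parent_time /body.
  have : 120 * q.+2 <= sweep_time by rewrite /sweep_time; nia.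
  move: sweep_time => S; nia.
apply: (@ok_bseq _ _ _ _ [::]) => //=.
rewrite -/B; set g0 := upd _ 14 _.
have e13 : g0 13 = size B by []. have e14 : g0 14 = 1 by [].
clearbody g0.
pose Iv (g1 : nat -> nat) (a1 : nat -> seq nat) :=
  if g1 14 != 0 then [/\ 0 < g1 13, g1 13 <= size B &
    parent_pos_rec n E K (g1 13) B = parent_pos n E K B]
  else g1 13 = parent_pos n E K B /\ a1 1 = complete predT (take (g1 13) B).
pose mu (g2 : nat -> nat) (a2 : nat -> seq nat) := g2 13.
apply: (@ok_le _ _ _ _ _ ((mu g0 a * body.+2).+1 + 2 * sweep_time)); last by rewrite /mu e13.
apply: (@ok_call _ _ _ _ _ (13 :: 14 :: sweep_regs) [:: 1]
  (fun g1 a1 => Iv g1 a1 /\ g1 14 = 0)) => //; last first.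
  move=> g1 a1 [f1 f2] [+ h]; rewrite /Iv h /= => -[h1 h2].
  have v1 : valid (a1 1) by rewrite h2; apply: complete_valid => //; apply: valid_take.
  apply: (ok_conseq (ok_canonarr _ _ v1)) => //.
  by move=> g' a' [k1 k2] ->; rewrite k1 // h2 h1.
apply: (ok_while (Iv := Iv)).
  rewrite /Iv e14 /= e13; split=> //; by case: (B) B0.
move=> g1 a1 [f1 f2]; rewrite /Iv => + h14; rewrite h14 => -[h1 h2 h3].
have a12 : a1 2 = B by rewrite f2.
have eB : g1 13 = (g1 13).-1.+1 by rewrite prednK.
apply: (@ok_bseq _ _ _ _ [::]) => //=.
set g2 := upd _ 13 _.
have e2 : g2 13 = (g1 13).-1 by [].
clearbody g2.
apply: (@ok_call _ _ _ _ _ [:: 5; 6; 7] [:: 1]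
  (fun _ a' => a' 1 = take (g2 13) (a1 2))) => //.
  by apply: ok_copyarr; rewrite // a12; lia.
rewrite a12 e2 => g3 a3 [k1 k2] t3.
have v3 : valid (a3 1) by rewrite t3; apply: valid_take.
apply: (@ok_call _ _ _ _ _ sweep_regs [:: 1]
  (fun _ a' => a' 1 = complete predT (a3 1))) => //.
  by apply: ok_sweep => //; apply: filter_spec_true.
move=> g4 a4 [m1 m2] t4; rewrite t3 in t4.
have v4 : valid (a4 1) by rewrite t4; apply: complete_valid => //; apply: valid_take.
have a42 : a4 2 = B by rewrite m2 // k2.
apply: (@ok_call _ _ _ _ _ [:: 5; 6; 7; 8] [::]
  (fun g' _ => g' 8 = (a4 1 == a4 2))) => //.
  by apply: ok_eqarr; have := valid_q v4; lia.
move=> g5 a5 [p1 p2] h8.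
have e5 : g5 13 = (g1 13).-1 by rewrite p1 // m1 // k1 // e2.
have a51 : a5 1 = a4 1 by rewrite p2.
apply: ok_block => //=; rewrite /mu !(upd_eq, upd_ne) // e5 h8 a42 t4.
split; last by lia.
have eP : parent_pos n E K B = if complete predT (take (g1 13).-1 B) == B
    then parent_pos_rec n E K (g1 13).-1 B else (g1 13).-1 by rewrite -h3 eB.
rewrite a51 t4 eP; case: (altP (complete _ _ =P B)) => [e|ne] //=.
split=> //; last by lia.
rewrite lt0n; apply/eqP => e0; move: e B0.
by rewrite e0 take0 complete_nil // => <-.
Qed.

Definition filterarr := Seq (Block [:: AConst 5 0; ACut 2 5; APush 2 0])
  (down 0 (Seq (Block [:: AAdj 7 0 6]) (If 7 (Block [:: APush 2 6]) nop))).

(** The entries are pushed in reverse order; equality of sets suffices, as a filter is used only for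
    membership. *)
Lemma ok_filterarr g a : size (a 0) <= q ->
  ok [::] (40 * q.+2) [:: 5; 6; 7] [:: 2] filterarr g a
    (fun _ a' => a' 2 =i nbr_filter E (g 0) (a 0) /\ size (a' 2) <= q.+2).
Proof.
move=> hs; apply: (@ok_le _ _ _ _ _ (10 + 30 * q.+2)); last by lia.
apply: (@ok_bseq _ _ _ _ [::]) => //=.
  by split; [|rewrite upd_eq take0].
rewrite !(upd_eq, upd_ne) // take0 /=.
set g0 := upd _ 5 _; set a0 := fun _ => _.
have e0 : g0 0 = g 0 by []. have ea0 : a0 0 = a 0 by []. have ea2 : a0 2 = [:: g 0] by [].
clearbody g0 a0; rewrite -e0 -ea0 in hs ea2 *.
apply: (@ok_down' _ _ _ _ 10 _ _ _ _ _ _ (fun i g1 a1 =>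
  a1 2 =i nbr_filter E (g0 0) (drop i (a0 0)) /\ size (a1 2) + i <= (size (a0 0)).+1)) => //=.
- by lia.
- by rewrite drop_size ea2 /nbr_filter; split=> //=; lia.
- move=> i g1 a1 [f1 f2] hi [j1 j2].
  have ev : g1 0 = g0 0 by rewrite f1.
  apply: (@ok_bseq _ _ _ _ [::] 9) => //=.
  rewrite !(upd_eq, upd_ne) // ev.
  apply: ok_if => /=; rewrite !(upd_eq, upd_ne) //= => h; last first.
    apply: ok_nop; rewrite !(upd_eq, upd_ne) //; split=> //; split; last by lia.
    move=> u; rewrite j1 !mem_nbr_filter [drop i _](drop_nth 0) // inE.
    by case: (u =P nth _ _ _) => // ->; move: h; case: (E _ _).
  apply: ok_block => //=; first by split=> //; lia.
  rewrite !(upd_eq, upd_ne) //; split=> //; split; last by rewrite size_rcons; lia.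
  move=> u; rewrite mem_rcons inE j1 !mem_nbr_filter [drop i _](drop_nth 0) // inE.
  by case: (u =P nth _ _ _) => //= ->; move: h; case: (E _ _) => //; rewrite orbT.
- by move=> g1 a1 _; rewrite drop0 => -[h1 h2]; split=> //; lia.
lia.
Qed.

(** The two subtractions guard the cases that [nth] and [take] settle by convention ([j] past the
    end of [P], [v] missing from [W]), because array reads and cuts must stay within bounds. *)
Definition childarr :=
  Seq (Block [:: AMov 4 0; ALen 7 0; ASub 7 7 1])
  (Seq (If 7 (Block [:: AGet 4 0 1]) nop)
  (Seq filterarr
  (Seq (Block [:: AConst 5 0; ACut 1 5; APush 1 4])
  (Seq (sweep 1 (memb 2 11))
  (Seq (indexarr 1 0)
  (Seq (Block [:: ALen 7 1; ASub 7 7 8])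
  (Seq (If 7 (Block [:: AInc 8; ACut 1 8]) nop)
  (Seq (sweep 1 (Block [:: AConst 8 1])) (canonarr 2 1))))))))).

Lemma nth_valid_lt P v j : valid P -> v < n -> nth v P j < n.
Proof.
move=> vP vn; case: (ltnP j (size P)) => h; last by rewrite nth_default.
by apply: (proj1 vP); apply: mem_nth.
Qed.

Lemma ok_childarr g a (s := nth (g 0) (a 0) (g 1)) : valid (a 0) -> g 0 < n ->
  ok [::] (5 * sweep_time) (4 :: sweep_regs) [:: 1; 2] childarr g a
    (fun g' a' => g' 4 = s /\ a' 2 = child n E K (a 0) (g 0) s).
Proof.
move=> vP vn; have sP := valid_q vP.
have sn : s < n := nth_valid_lt _ vP vn.
apply: (@ok_le _ _ _ _ _ (5 + (7 + (40 * q.+2 + (10 + (sweep_time + (40 * q.+2 + (3 + (6 +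
  (sweep_time + 2 * sweep_time)))))))))); last first.
  have : 120 * q.+2 <= sweep_time by rewrite /sweep_time; nia.
  lia.
apply: (@ok_bseq _ _ _ _ [::]) => //=.
rewrite !(upd_eq, upd_ne) //; set g0 := upd _ 7 _.
have e0 : g0 0 = g 0 by []. have e1 : g0 1 = g 1 by []. have e4 : g0 4 = g 0 by [].
have e7 : g0 7 = size (a 0) - g 1 by [].
clearbody g0.
apply: (@ok_call _ _ _ _ _ [:: 4] [::] (fun g1 a1 => g1 4 = s)) => //.
  apply: ok_if; rewrite e7 => h; last first.
    by apply: ok_nop; rewrite e4 /s nth_default //; lia.
  have h1 : g 1 < size (a 0) by lia.
  apply: ok_block => //=; first by rewrite e1.
  by rewrite upd_eq e1 /s; apply: set_nth_default.
move=> g1 a1 [f1 f2] e14.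
have a10 : a1 0 = a 0 by rewrite f2.
have g10 : g1 0 = g 0 by rewrite f1.
apply: (@ok_call _ _ _ _ _ [:: 5; 6; 7] [:: 2]
  (fun _ a' => a' 2 =i nbr_filter E (g1 0) (a1 0) /\ size (a' 2) <= q.+2)) => //.
  by apply: ok_filterarr; rewrite a10.
move=> g2 a2 [k1 k2]; rewrite g10 a10 => -[h1 h2].
apply: (@ok_bseq _ _ _ _ [::]) => //=.
  by split; [|rewrite upd_eq take0].
rewrite !(upd_eq, upd_ne) // take0 /= (k1 4) // e14.
set g3 := upd _ 5 _; set a3 := fun _ => _.
have a31 : a3 1 = [:: s] by []. have a32 : a3 2 = a2 2 by [].
have g30 : g3 0 = g 0 by rewrite /g3 upd_ne // k1.
have g34 : g3 4 = s by rewrite /g3 upd_ne // k1.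
clearbody g3 a3.
pose W := complete (mem (nbr_filter E (g 0) (a 0))) [:: s].
have vW : valid W by apply: complete_valid => //; apply: valid1.
apply: (@ok_call _ _ _ _ _ sweep_regs [:: 1] (fun _ a' => a' 1 = W)) => //.
  apply: ok_post; first apply: ok_sweep.
  - by apply: filter_spec_memb; rewrite // a32.
  - by rewrite a31; apply: valid1.
  move=> g' a' _ ->; rewrite a31; apply: (complete_ext G); first exact: valid1.
  by move=> u; rewrite /= a32 h1.
move=> g4 a4 [l1 l2] a41; have sW := valid_q vW.
have g40 : g4 0 = g 0 by rewrite l1.
apply: (@ok_call _ _ _ _ _ [:: 5; 6; 7; 8] [::] (fun g' _ => g' 8 = index (g4 0) (a4 1))) => //.
  by apply: ok_indexarr => //; rewrite a41; lia.
move=> g5 a5 [m1 m2]; rewrite g40 a41 => e58.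
have a51 : a5 1 = W by rewrite m2.
apply: (@ok_bseq _ _ _ _ [::]) => //=.
rewrite !(upd_eq, upd_ne) // e58 a51; set g6 := upd _ 7 _.
have e67 : g6 7 = size W - index (g 0) W by [].
have e68 : g6 8 = index (g 0) W by [].
have e64 : g6 4 = s by rewrite /g6 !upd_ne // m1 // l1.
clearbody g6.
pose W' := take (index (g 0) W).+1 W.
have vW' : valid W' by apply: valid_take.
apply: (@ok_call _ _ _ _ _ [:: 8] [:: 1] (fun _ a' => a' 1 = W')) => //.
  apply: ok_if; rewrite e67 => h; last first.
    by apply: ok_nop; rewrite a51 /W' take_oversize //; lia.
  apply: ok_block => //=.
    rewrite upd_eq e68 a51; split; last by split=> //; lia.
    lia.
  by rewrite upd_eq e68 a51.
move=> g7 a7 [p1 p2] a71.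
apply: (@ok_call _ _ _ _ _ sweep_regs [:: 1] (fun _ a' => a' 1 = complete predT W')) => //.
  by rewrite -a71; apply: ok_sweep; [apply: filter_spec_true|rewrite a71].
move=> g8 a8 [r1 r2] a81.
have vc : valid (a8 1) by rewrite a81; apply: complete_valid.
apply: (ok_conseq (ok_canonarr _ _ vc)) => //.
move=> g' a' [t1 t2] ->; split; first by rewrite t1 // r1 // p1.
by rewrite a81.
Qed.

Definition testarr :=
  Seq childarr (Seq parentarr (Seq (eqarr 3 0)
  (Seq (Block [:: AMov 14 8; AGet 15 2 13; ANeq 15 15 0])
  (Seq (If 15 (Block [:: AConst 14 0]) nop)
  (Seq (Block [:: AConst 5 0; AGet 15 2 5; ANeq 15 15 4])
    (If 15 (Block [:: AConst 14 0]) nop)))))).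

(** Dominated by the parent, which needs one sweep for each prefix tried. *)
Definition test_time := 8 * (q.+2 * sweep_time).
Definition test_regs := [:: 4; 13; 14; 15] ++ sweep_regs.

Lemma ok_testarr g a (s := nth (g 0) (a 0) (g 1)) (C := child n E K (a 0) (g 0) s) :
  valid (a 0) -> g 0 < n ->
  ok [::] test_time test_regs [:: 1; 2; 3] testarr g a
    (fun g' a' => a' 2 = C /\ g' 14 = (parent_info n E K C == (a 0, g 0, s))).
Proof.
move=> vP vn; have sP := valid_q vP.
have sn : s < n := nth_valid_lt _ vP vn.
have sC : sol C := sol_child G _ _ sn.
apply: (@ok_le _ _ _ _ _ (5 * sweep_time + (parent_time + (40 * q.+2 + (10 + (3 + (9 + 3))))))); last first.
  rewrite /test_time /parent_time.
  have : 120 * q.+2 <= sweep_time by rewrite /sweep_time; nia.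
  move: sweep_time => S; nia.
apply: (ok_call (ok_childarr vP vn)) => // g1 a1 [f1 f2] [e4 a12].
rewrite -/s -/C in e4 a12.
have sB : sol (a1 2) by rewrite a12.
apply: (ok_call (ok_parentarr g1 sB)) => // g2 a2 [h1 h2] [a23 e13].
rewrite a12 in a23 e13.
have [posC _ _] := parent_posP G sC.
have [C0 vC _ _] := sC.
have a22 : a2 2 = C by rewrite h2.
have a20 : a2 0 = a 0 by rewrite h2 // f2.
have v23 : valid (a2 3).
  by rewrite a23; have [->|[]] := parent_sol G sC => //; apply: valid_nil.
apply: (@ok_call _ _ _ _ _ [:: 5; 6; 7; 8] [::] (fun g' _ => g' 8 = (a2 3 == a2 0))) => //.
  by apply: ok_eqarr; have := valid_q v23; lia.
move=> g3 a3 [k1 k2]; rewrite a23 a20 => e38.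
have a32 : a3 2 = C by rewrite k2.
have e3 : g3 13 = parent_pos n E K C by rewrite k1.
have g30 : g3 0 = g 0 by rewrite k1 // h1 // f1.
have g34 : g3 4 = s by rewrite k1 // h1.
apply: (@ok_bseq _ _ _ _ [::]) => //=.
  by rewrite upd_ne // a32 e3.
rewrite !(upd_eq, upd_ne) // a32 e3 e38 g30; set g4 := upd _ 15 _.
have g414 : g4 14 = (parent n E K C == a 0) by [].
have g415 : (g4 15 == 0) = (nth 0 C (parent_pos n E K C) == g 0) by rewrite /g4 upd_eq neqE.
have g44 : g4 4 = s by [].
clearbody g4.
apply: (@ok_call _ _ _ _ _ [:: 14] [::] (fun g' _ => g' 14 =
   (parent n E K C == a 0) && (nth 0 C (parent_pos n E K C) == g 0))) => //.
  apply: ok_if => h.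
    by apply: ok_block => //=; rewrite upd_eq -g415 (negPf h) andbF.
  by apply: ok_nop; rewrite -g415 h eqxx andbT.
move=> g5 a5 [m1 m2] e514.
have a52 : a5 2 = C by rewrite m2.
apply: (@ok_bseq _ _ _ _ [::]) => //=.
  by rewrite upd_eq a52; split=> //; split=> //; case: (C) C0.
rewrite !(upd_eq, upd_ne) // a52 (m1 4) // g44; set g6 := upd _ 15 _.
have g614 : g6 14 = g5 14 by [].
have g615 : (g6 15 == 0) = (nth 0 C 0 == s) by rewrite /g6 upd_eq neqE.
clearbody g6.
have eI : (parent_info n E K C == (a 0, g 0, s)) =
  [&& parent n E K C == a 0, nth 0 C (parent_pos n E K C) == g 0 & nth 0 C 0 == s].
  by rewrite /parent_info !xpair_eqE andbA.
apply: ok_if => h.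
  apply: ok_block => //=; rewrite upd_eq a52; split=> //.
  by rewrite eI -g615 (negPf h) !andbF.
apply: ok_nop; split=> //.
by rewrite g614 e514 eI -g615 h eqxx andbT.
Qed.

End Routines.

(** * The abstract traversal of the tree and the number of silent steps *)

Section Search.
Variables (n q : nat) (E K : rel nat).
Hypothesis G : black_white n E K.
Hypothesis valid_q : forall X, valid n E K X -> size X <= q.

Notation sol := (sol n E K).
Notation parent := (parent n E K).
Notation parent_info := (parent_info n E K).
Notation child := (child n E K).
Notation pot := (pot n K).

Definition dstate := (seq nat * nat * nat * bool)%type.

(* The Boolean is the parity of the depth: solutions are output when entered at even depth and
   when left at odd depth, so that long ascents and descents keep producing output.
   For j = size P the root s is v itself; below the empty sequence this is the only choice. *)
Definition dstep (d : dstate) : seq (seq nat) * dstate :=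
  let: (P, v, j, o) := d in
  if v < n then
    if j <= size P then
      let s := nth v P j in
      let C := child P v s in
      if parent_info C == (P, v, s)
      then (if o then [:: rev C] else [::], (C, 0, 0, ~~ o))
      else ([::], (P, v, j.+1, o))
    else ([::], (P, v.+1, 0, o))
  else
    let: (P', v', s') := parent_info P in
    (if o then [:: rev P] else [::], (P', v', (index s' P').+1, ~~ o)).

Definition node P := P = [::] \/ sol P.

Definition dstate_ok (d : dstate) :=
  let: (P, v, j, o) := d in [/\ node P, v <= n & j <= (size P).+1].

Definition final (d : dstate) := let: (P, v, j, o) := d in (v == n) && (P == [::]).

Inductive drun : dstate -> seq (seq (seq nat)) -> dstate -> Prop :=
| DRun0 d : drun d [::] d
| DRunS d ls d' : dstate_ok d -> ~~ final d -> drun (dstep d).2 ls d' ->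
    drun d ((dstep d).1 :: ls) d'.

Lemma drun_cat d1 l1 d2 l2 d3 : drun d1 l1 d2 -> drun d2 l2 d3 -> drun d1 (l1 ++ l2) d3.
Proof. by elim=> //= d ls d' h1 h2 _ IH h; apply: DRunS => //; apply: IH. Qed.

(** A running counter instead of a maximum: its final value is handed to the rest of the run, so
    bounds compose along concatenation. *)
Fixpoint gaps g c (ls : seq (seq (seq nat))) : option nat :=
  if ls is l :: ls' then
    if l is [::] then if c < g then gaps g c.+1 ls' else None else gaps g 0 ls'
  else Some c.

Lemma gaps_cat g c l1 l2 : gaps g c (l1 ++ l2) = obind (fun c' => gaps g c' l2) (gaps g c l1).
Proof. by elim: l1 c => //= -[|? ?] l1 IH c //; case: ifP. Qed.

Inductive subtree c : seq nat -> Prop :=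
| Subtree0 : sol c -> subtree c c
| SubtreeS X : sol X -> subtree c (parent X) -> subtree c X.

Definition kid S c := sol c /\ parent c = S.

Lemma subtree_sol c X : subtree c X -> sol X.
Proof. by case. Qed.

Lemma pot_subtree c X : subtree c X -> pot c <= pot X.
Proof.
elim=> // {}X sX _ h; apply: leq_trans h _; apply: ltnW.
exact: (pot_parent G sX).
Qed.

Lemma pot_kid S c : kid S c -> pot S < pot c.
Proof. by case=> sc <-; apply: pot_parent. Qed.

Lemma subtree_split c X : sol c ->
  subtree c X <-> X = c \/ exists2 c', kid c c' & subtree c' X.
Proof.
move=> sc; split=> [|[->|[c' [sc' pc] h]]]; last 2 first.
- exact: Subtree0.
- elim: h => [_|{}X sX _ IH]; last exact: SubtreeS.
  by apply: SubtreeS => //; rewrite pc; apply: Subtree0.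
elim=> [|{}X sX h [e|[c' kc h']]]; first by left.
  by right; exists X; [|apply: Subtree0].
by right; exists c' => //; apply: SubtreeS.
Qed.

(** Ancestors of [X] form a single chain. If it met two different kids of [S], then [S] would lie in
    the subtree of one of them, although every kid has larger potential than [S]. *)
Lemma subtree_kid_inj S c1 c2 X : kid S c1 -> kid S c2 ->
  subtree c1 X -> subtree c2 X -> c1 = c2.
Proof.
move=> k1 k2 h1; elim: h1 k2 => {X} [_ k2|X sX h1 IH k2] h2.
  case: h2 k1 => [//|X sX h [_ e]].
  have := pot_subtree h; rewrite e leqNgt; by rewrite (pot_kid k2).
case: h2 IH h1 => [_|Y sY h2] IH h1; last exact: IH.
have := pot_subtree h1; case: k2 => _ ->.
by rewrite leqNgt (pot_kid k1).
Qed.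

(** The rank of a pair in the order of traversal. The factor is [(size S).+2] because [j] takes the
    values 0 to [size S] for tests and one more for the move to the next [v]. *)
Definition kid_pos S c := let: (_, v, s) := parent_info c in v * (size S).+2 + index s S.

Lemma kid_info S c : kid S c -> exists v s,
  [/\ parent_info c = (S, v, s), v < n, child S v s = c & nth v S (index s S) = s].
Proof.
case=> sc pc; case E1: (parent_info c) => [[P v] s].
have eP : P = S by rewrite -pc parentE E1.
subst P; exists v, s; have [h1 h2] := child_parent G sc E1; split=> //.
case: E1 => _ <- _; have [h _ _] := parent_posP G sc; case: sc => _ vc _ _.
by apply: (proj1 vc); apply: mem_nth.
Qed.

Lemma kid_pos_lt S c : kid S c -> kid_pos S c < n * (size S).+2.
Proof.
move=> k; have [v [s [e vn _ _]]] := kid_info k; rewrite /kid_pos e.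
apply: (@leq_trans (v.+1 * (size S).+2)); last by rewrite leq_mul2r vn orbT.
by rewrite mulSn addnC ltn_add2r !ltnS leqW // index_size.
Qed.

Lemma kid_pos_eq S c v j : kid S c -> j < (size S).+2 -> kid_pos S c = v * (size S).+2 + j ->
  j <= size S /\ parent_info c = (S, v, nth v S j).
Proof.
move=> k hj; have [v' [s [e vn _ hs]]] := kid_info k; rewrite /kid_pos e => ep.
have hi : index s S <= size S := index_size s S.
have hi' : index s S < (size S).+2 by rewrite !ltnS leqW.
have ev : v' = v.
  by move/(congr1 (divn^~ (size S).+2)): ep; rewrite !divnMDl // !divn_small // !addn0.
have ej : index s S = j by move: ep; rewrite ev => /addnI.
by subst v' j; rewrite hs.
Qed.

(** On return from a child the position is recomputed by [index], so it must be the one from which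
    the child was entered. The critical case is [j = size S], where [s] is [v]: if [v] occurred in
    [S], it would still be the first vertex of the child, forcing an empty parent. *)
Lemma index_kid S c v j : node S -> kid S c -> j <= size S -> parent_info c = (S, v, nth v S j) ->
  index (nth v S j) S = j.
Proof.
move=> nS k jS e; case: (ltnP j (size S)) => h.
  case: nS => [S0|[_ vS _ _]]; first by rewrite S0 in h.
  apply: index_uniq => //; exact: (valid_uniq G vS).
have ej : j = size S by lia.
rewrite nth_default ?ej // in e *.
case: (boolP (v \in S)) => vS; last by apply: memNindex.
have [sc pc] := k; have [pl _ _] := parent_posP G sc; have [c0 vc _ _] := sc.
case: e => eS ev es; exfalso.
have /eqP p0 : parent_pos n E K c == 0.
  have := nth_uniq 0 pl (_ : 0 < size c) (valid_uniq G vc); rewrite ev es eqxx => <- //.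
  exact: leq_ltn_trans pl.
by move: vS; rewrite -eS p0 take0 (complete_nil G).
Qed.

Definition bound := n * q.+2.
Definition gap := (2 * bound).+3.
(** Below the root, a node with flag true was entered silently, so its counter may already include a
    full scan at its parent and the step down; with flag false, entry produced an output. Hence
    [gap] allows two scans. *)
Definition slack (o : bool) := if o then bound.+1 else 0.

Definition search_spec S o v j ls :=
  [/\ drun (S, v, j, o) ls (S, n, 0, o), uniq (flatten ls),
      forall Y, Y \in flatten ls <->
        exists c, [/\ kid S c, v * (size S).+2 + j <= kid_pos S c & subtree c (rev Y)]
    & forall c0, c0 <= slack o + (v * (size S).+2 + j) ->
        exists2 c1, gaps gap c0 ls = Some c1 & c1 <= slack o + n * (size S).+2].

Lemma node_size S : node S -> size S <= q.
Proof. by case=> [->//|[_ v _ _]]; apply: valid_q. Qed.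

Lemma search_skip S o v j v' j' ls : node S -> v < n -> j <= (size S).+1 ->
  dstep (S, v, j, o) = ([::], (S, v', j', o)) ->
  v' * (size S).+2 + j' = (v * (size S).+2 + j).+1 ->
  (forall c, kid S c -> kid_pos S c != v * (size S).+2 + j) ->
  search_spec S o v' j' ls -> search_spec S o v j ([::] :: ls).
Proof.
move=> nS vn hj ed ep nk [h1 h2 h3 h4]; split=> //=.
- have := @DRunS (S, v, j, o) ls (S, n, 0, o); rewrite ed; apply=> //.
    by split=> //; apply: ltnW.
  by rewrite /= (ltn_eqF vn).
- move=> Y; rewrite h3; split=> -[c [k1 k2 k3]]; exists c; split=> //.
    by rewrite ep in k2; apply: ltnW.
  by rewrite ep ltn_neqAle eq_sym nk.
move=> c0 hc; have := node_size nS => sS.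
have -> : c0 < gap by rewrite /gap; move: hc; rewrite /slack /bound; case: o {h1 h4 ed}; nia.
by apply: h4; rewrite ep; lia.
Qed.

(** Two nested inductions: over nodes, on the distance of the potential to its upper bound, which
    shrinks towards children; and at a fixed node, on the number of pairs still to be tested. *)
Lemma search_spec_exists S o : node S -> exists ls, search_spec S o 0 0 ls.
Proof.
have [m hm] := ubnP (base n ^ n.+1 - pot S).
elim: m S o hm => // m IH S o hm nS.
have sS := node_size nS.
have H k v j : n * (size S).+2 - (v * (size S).+2 + j) < k -> v <= n -> j <= (size S).+1 ->
    (v = n -> j = 0) -> exists ls, search_spec S o v j ls.
  elim: k v j => // k IHk v j hk vn hj hvj.
  case: (ltngtP v n) vn => // [vn _|vn _]; last first.
    have j0 := hvj vn; subst v j; exists [::]; split=> //=; first exact: DRun0.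
      move=> Y; split=> // -[c [k1 k2 _]].
      by have := kid_pos_lt k1; rewrite addn0 in k2; rewrite ltnNge k2.
    by move=> c0; rewrite addn0 => h; exists c0.
  case: (ltngtP j (size S).+1) hj => // [hj _|ej _]; last first.
    subst j; have [||||ls hls] := IHk v.+1 0; rewrite //; try nia.
    exists ([::] :: ls); apply: search_skip hls => //.
    - by rewrite /= vn ltnn.
    - by rewrite mulSn; lia.
    by move=> c kc; apply/eqP => e; have [|] := kid_pos_eq kc _ e; rewrite // ltnn.
  rewrite ltnS in hj.
  have vS : v * (size S).+2 + j < n * (size S).+2 by nia.
  set s := nth v S j; set C := child S v s.
  have [||||ls4 hls4] := IHk v j.+1; rewrite ?ltnS //; try nia; try lia.
  case E1: (parent_info C == (S, v, s)); last first.
    exists ([::] :: ls4); apply: search_skip hls4 => //.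
    - exact: leqW.
    - by rewrite /= vn hj -/s -/C E1.
    - by rewrite addnS.
    move=> c kc; apply/eqP => e; have [|_ ei] := kid_pos_eq kc _ e; first by rewrite !ltnS leqW.
    have [h _] := child_parent G (proj1 kc) ei; rewrite -/s -/C in h ei.
    by rewrite h ei eqxx in E1.
  move/eqP: E1 => E1.
  have sn : s < n.
    rewrite /s; case: (ltnP j (size S)) => h; last by rewrite nth_default.
    by case: nS h => [->//|[_ vv _ _] h]; apply: (proj1 vv); apply: mem_nth.
  have sC : sol C := sol_child G _ _ sn.
  have kC : kid S C by split=> //; rewrite parentE E1.
  have eidx : index s S = j := index_kid nS kC hj E1.
  have posC : kid_pos S C = v * (size S).+2 + j by rewrite /kid_pos E1 eidx.
  have pC := pot_kid kC.
  have [||ls2 hls2] := IH C (~~ o); [|by right|].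
    have [_ vC _ _] := sC; have := pot_lt G vC; lia.
  case: hls2 => d2 u2 m2 g2; case: hls4 => d4 u4 m4 g4.
  have sizeC : size C <= q by apply: node_size; right.
  (* Entry, subtree of [C], return, rest of the scan at [S]; exactly one of entry and return prints
     [C]. *)
  exists ((if o then [:: rev C] else [::]) :: ls2 ++ (if ~~ o then [:: rev C] else [::]) :: ls4).
  have [C0 _ _ _] := sC.
  have inj X c : subtree C X -> kid S c -> subtree c X -> c = C.
    by move=> h1 kc h2; apply: (subtree_kid_inj kc kC h2 h1).
  have pf : perm_eq (flatten ((if o then [:: rev C] else [::]) :: ls2 ++
      (if ~~ o then [:: rev C] else [::]) :: ls4)) (rev C :: flatten ls2 ++ flatten ls4).
    rewrite /= flatten_cat /=; case: (o) => //=.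
    by rewrite -cat1s perm_catCA.
  have in2 Y : Y \in flatten ls2 -> subtree C (rev Y).
    by case/m2=> c [k1 _ k3]; apply/subtree_split => //; right; exists c.
  have nin4 Y : Y \in flatten ls4 -> subtree C (rev Y) -> False.
    case/m4=> c [k1 k2 k3] h; have e := inj _ _ h k1 k3; subst c.
    by move: k2; rewrite posC addnS ltnn.
  split.
  - have := @DRunS (S, v, j, o); rewrite /= vn hj -/s -/C E1 eqxx; apply=> //.
    + by split=> //; [apply: ltnW|apply: leqW].
    + by rewrite (ltn_eqF vn).
    apply: (drun_cat d2).
    have := @DRunS (C, n, 0, ~~ o); rewrite /= ltnn.
    case: (E1) => -> -> ->; rewrite eidx negbK; apply=> //.
      by split=> //; right.
    by rewrite eqxx.
  - rewrite (perm_uniq pf) /= cat_uniq u2 u4 mem_cat andbT /=; apply/andP; split.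
      rewrite negb_or; apply/andP; split; apply/negP.
        case/m2=> c [k1 _ k3]; rewrite revK in k3.
        by have := pot_subtree k3; rewrite leqNgt (pot_kid k1).
      by move/nin4; rewrite revK; apply; apply: Subtree0.
    apply/hasPn => Y /nin4 h; apply/negP => /in2; exact: h.
  - move=> Y; rewrite (perm_mem pf) inE mem_cat; split.
      case/or3P => [/eqP->|h|/m4[c [k1 k2 k3]]].
      + by exists C; rewrite revK posC; split=> //; apply: Subtree0.
      + by exists C; rewrite posC; split=> //; apply: in2.
      by exists c; split=> //; apply: leq_trans k2; rewrite addnS.
    move=> [c [k1 k2 k3]]; case: (ltngtP (kid_pos S c) (v * (size S).+2 + j)) k2 => // [h _|e _].
      by apply/or3P/Or33/m4; exists c; rewrite addnS.
    have [|_ ei] := kid_pos_eq k1 _ e; first by rewrite !ltnS leqW.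
    have [h _] := child_parent G (proj1 k1) ei; rewrite -/s -/C in h; subst c.
    have [eY|[c' k' h']] := proj1 (subtree_split _ sC) k3; first by rewrite -eY revK eqxx.
    by apply/or3P/Or32/m2; exists c'; split.
  move=> c0 hc.
  have bS : n * (size S).+2 <= bound by rewrite /bound leq_mul2l !ltnS sS orbT.
  have bC : n * (size C).+2 <= bound by rewrite /bound leq_mul2l !ltnS sizeC orbT.
  (* With [o] true, entry resets the counter, and the silent return leaves at most a scan of [C]
     plus one step, which [slack] absorbs. With [o] false, entry is silent and the return resets
     it. *)
  case: o {IHk hm} d2 g2 d4 g4 hc pf => /= _ g2 _ g4 hc _.
    rewrite gaps_cat; have [|c1 -> h1] := g2 0; first by [].
    rewrite /= (_ : c1 < gap); last by rewrite /gap; lia.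
    by apply: g4; rewrite addnS; lia.
  rewrite (_ : c0 < gap); last by rewrite /gap; lia.
  rewrite gaps_cat; have [|c1 -> h1] := g2 c0.+1; first by lia.
  by apply: g4.
apply: (H (n * (size S).+2).+1) => //; lia.
Qed.

(** The counter starts at 1 to account for the initial assignments of the program, and ends strictly
    below [gap] to leave room for the final pass that detects termination. *)
Lemma search_all : exists ls,
  [/\ drun ([::], 0, 0, true) ls ([::], n, 0, true), uniq (flatten ls),
      forall Y, Y \in flatten ls <-> sol (rev Y)
    & exists2 c, gaps gap 1 ls = Some c & c < gap].
Proof.
have [|ls [h1 h2 h3 h4]] := search_spec_exists (S := [::]) true; first by left.
exists ls; split=> // [Y|]; last first.
  have [|c1 e hc] := h4 1; first by [].
  by exists c1 => //; move: hc; rewrite /gap /slack /bound /=; nia.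
rewrite h3; split=> [[c [_ _ /subtree_sol]]//|].
set X := rev Y; have [m] := ubnP (pot X).
suff H Z : pot Z < m -> sol Z -> exists2 c, kid [::] c & subtree c Z.
  by move=> hm /(H _ hm)[c k h]; exists c.
elim: m Z => // m IH Z hm sZ; have [pZ|sP] := parent_sol G sZ.
  by exists Z => //; apply: Subtree0.
have [|//|c k h] := IH (parent Z); first by have := pot_parent G sZ; lia.
by exists c => //; apply: SubtreeS.
Qed.

End Search.

(** * The main program and the correctness of one pass of its loop *)

Definition outarr x := Seq (Block [:: ALen 5 x])
  (Seq (While 5 (Block [:: ADec 5; AGet 6 x 5; AOut 6])) (Block [:: ASep])).

(** The parity is flipped before it is tested, so zero in scalar 2 means that the node just entered
    has to be printed. *)
Definition descend := Seq (Block [:: ALen 13 2]) (Seq (copyarr 0 2 13)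
  (Seq (Block [:: AConst 5 1; ASub 2 5 2; AConst 0 0; AConst 1 0]) (If 2 nop (outarr 0)))).

(** The old node survives in array 2, from which [v] and [s] are read after its parent has been
    computed; array 0 then receives the parent. *)
Definition ascend := Seq (If 2 (outarr 0) nop) (Seq (Block [:: ALen 13 0]) (Seq (copyarr 2 0 13)
  (Seq parentarr (Seq (Block [:: AGet 0 2 13; AConst 5 0; AGet 4 2 5; ALen 13 3])
  (Seq (copyarr 0 3 13) (Seq (indexarr 0 4)
    (Block [:: AMov 1 8; AInc 1; AConst 5 1; ASub 2 5 2]))))))).

Definition body :=
  Seq (Block [:: AN 7; ASub 7 7 0])
  (If 7
    (Seq (Block [:: ALen 7 0; AInc 7; ASub 7 7 1])
      (If 7 (Seq testarr (If 14 descend (Block [:: AInc 1])))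
        (Block [:: AInc 0; AConst 1 0])))
    (Seq (Block [:: ALen 7 0]) (If 7 ascend (Block [:: AConst 3 0])))).

Definition main := Seq (Block [:: AConst 2 1; AConst 3 1]) (While 3 body).

Lemma main_ok : cmd_ok main. Proof. by vm_compute. Qed.

Section Main.
Variables (n q : nat) (E K : rel nat).
Hypothesis G : black_white n E K.
Hypothesis valid_q : forall X, valid n E K X -> size X <= q.
Hypothesis qn : q <= n.

Notation ok := (ok n q E K).
Notation valid := (valid n E K).
Notation sol := (sol n E K).
Notation dstep := (dstep n E K).
Notation dstate_ok := (dstate_ok n E K).

(** Proved directly on executions: between two rounds of the loop a block is unfinished, which
    [emits], and with it [ok_while], cannot express. *)
Lemma ok_outarr x g a : size (a x) <= q ->
  ok [:: rev (a x)] (20 * q.+2) [:: 5; 6] [::] (outarr x) g a (fun _ _ => True).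
Proof.
move=> sX.
suff [g' [evs [h1 h2 h3 h4]]] : exists g' evs,
    [/\ forall t, exec n q E K (While 5 (Block [:: ADec 5; AGet 6 x 5; AOut 6]))
          (State (upd g 5 (size (a x))) a t) (State g' a (t ++ evs)),
        forall cur es, blocks cur (evs ++ es) = blocks (cur ++ rev (a x)) es,
        size evs <= 10 * size (a x) + 1 &
        frame [:: 5; 6] [::] (upd g 5 (size (a x))) a g' a].
  exists g', a, ([:: ENone; ENone] ++ evs ++ [:: ESep]); split=> //.
  - move=> t; apply: (XSeq (s1 := State (upd g 5 (size (a x))) a (t ++ [:: ENone; ENone]))).
      exact: (@XBlock n q E K [:: ALen 5 x] (State g a t)).
    apply: (XSeq (h1 _)).
    have := @XBlock n q E K [:: ASep] (State g' a ((t ++ [:: ENone; ENone]) ++ evs)) (conj I I).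
    by rewrite /block_sem /= /asem /= -!catA.
  - by move=> es; rewrite -!catA /= h2.
  - by rewrite !size_cat /=; lia.
  by apply: frame_trans h4; split=> // r; rewrite !inE negb_or => /andP[h _]; rewrite upd_ne.
suff H i g0 : i <= size (a x) -> g0 5 = i -> exists g' evs,
    [/\ forall t, exec n q E K (While 5 (Block [:: ADec 5; AGet 6 x 5; AOut 6]))
          (State g0 a t) (State g' a (t ++ evs)),
        forall cur es, blocks cur (evs ++ es) = blocks (cur ++ rev (take i (a x))) es,
        size evs <= 10 * i + 1 & frame [:: 5; 6] [::] g0 a g' a].
  by rewrite -{2}(take_size (a x)); apply: H; rewrite // upd_eq.
elim: i g0 => [|i IH] g0 hi e5.
  exists g0, [:: ENone]; split=> //.
    by move=> t; rewrite cats1; apply: XWhileF.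
  by move=> cur es; rewrite take0 cats0.
have [|//|g' [evs [h1 h2 h3 h4]]] := IH (upd (upd g0 5 i) 6 (nth 0 (a x) i)); first exact: ltnW.
set bevs := nseq 7 ENone ++ [:: EOut (nth 0 (a x) i)].
exists g', ([:: ENone] ++ bevs ++ [:: ENone] ++ evs); split.
- move=> t; pose s1 := State (upd (upd g0 5 i) 6 (nth 0 (a x) i)) a (rcons t ENone ++ bevs).
  apply: (@XWhileT _ _ _ _ _ _ (State g0 a t) s1); first by rewrite /= e5.
    have := @XBlock n q E K [:: ADec 5; AGet 6 x 5; AOut 6] (State g0 a (rcons t ENone)).
    rewrite /block_sem /= /asem /= !upd_eq e5 /= -!catA; apply.
    by split=> //; split.
  have := h1 (rcons (rcons t ENone ++ bevs) ENone); rewrite /s1 /tick /=.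
  by rewrite !cat_rcons -!catA.
- move=> cur es; rewrite -!catA /= h2; congr blocks.
  by rewrite take_S_nth // rev_rcons cat_rcons.
- by rewrite !size_cat /=; lia.
apply: frame_trans h4; split=> // r; rewrite !inE !negb_or => /andP[r5 r6].
by rewrite !upd_ne.
Qed.

Definition all_regs := iota 0 16.
Definition all_arrays := iota 0 4.

Definition drepr (d : dstate) (g : nat -> nat) (a : nat -> seq nat) :=
  let: (P, v, j, o) := d in [/\ a 0 = P, g 0 = v, g 1 = j & g 2 = nat_of_bool o].

Definition step_time := 10 * (q.+2 * (sweep_time n q)).

Definition out_if (o : bool) (X : seq nat) : seq (seq nat) := if o then [:: rev X] else [::].

Lemma sweep_time_ge : 120 * q.+2 <= (sweep_time n q).
Proof. by rewrite /sweep_time; nia. Qed.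

Lemma ok_descend (g : nat -> nat) a (o : bool) : valid (a 2) -> g 2 = o ->
  ok (out_if o (a 2)) (80 * q.+2) [:: 0; 1; 2; 5; 6; 7; 13] [:: 0] descend g a
    (fun g' a' => [/\ a' 0 = a 2, g' 0 = 0, g' 1 = 0 & g' 2 = ~~ o]).
Proof.
move=> vC eo; have sC := valid_q vC.
apply: (@ok_le _ _ _ _ _ (2 + (40 * q.+2 + (4 + (20 * q.+2).+2)))); last by lia.
apply: ok_bseq => //=.
apply: (@ok_call _ _ _ _ _ [:: 5; 6; 7] [:: 0] (fun _ a' => a' 0 = a 2)) => //.
  have := @ok_copyarr n q E K qn 0 2 13 (upd g 13 (size (a 2))) a; rewrite upd_eq take_size.
  by apply=> //; lia.
move=> g1 a1 [f1 f2] e1.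
have eo1 : g1 2 = o by rewrite f1.
apply: ok_bseq => //=; rewrite !(upd_eq, upd_ne) // eo1.
case: o eo eo1 => eo eo1; apply: ok_if => /= h //.
  have s1 : size (a1 0) <= q by rewrite e1.
  rewrite /out_if -e1; apply: (ok_conseq (ok_outarr _ s1)) => //.
  by move=> g' a' [k1 k2] _; rewrite k2 // !k1.
by apply: ok_nop.
Qed.

Lemma ok_ascend (g : nat -> nat) a (o : bool) : sol (a 0) -> g 2 = o ->
  ok (out_if o (a 0)) ((parent_time n q) + 200 * q.+2) (0 :: 1 :: 2 :: test_regs) all_arrays ascend g a
    (fun g' a' => [/\ a' 0 = parent n E K (a 0), g' 0 = nth 0 (a 0) (parent_pos n E K (a 0)),
       g' 1 = (index (nth 0 (a 0) 0) (parent n E K (a 0))).+1 & g' 2 = ~~ o]).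
Proof.
move=> sP eo; have [P0 vP _ _] := sP; have sizeP := valid_q vP.
have [posP _ _] := parent_posP G sP.
have vQ : valid (parent n E K (a 0)).
  by have [->|[]] := parent_sol G sP => //; apply: valid_nil.
have sizeQ := valid_q vQ.
set P := a 0 in sP P0 vP sizeP posP vQ sizeQ *.
apply: (@ok_le _ _ _ _ _ ((20 * q.+2).+2 + (2 + (40 * q.+2 + ((parent_time n q) + (13 +
  (40 * q.+2 + (40 * q.+2 + 6)))))))); last by lia.
rewrite -[out_if o P]cats0.
apply: (@ok_seq _ _ _ _ _ _ [:: 5; 6] [::] _ _ _ _ _ _ _ _ (fun _ _ => True)) => //.
  case: o eo => eo; apply: ok_if; rewrite eo => //= _; last by apply: ok_nop.
  exact: ok_outarr.
move=> g1 a1 [f1 f2] _.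
have a10 : a1 0 = P by rewrite f2.
have g12 : g1 2 = o by rewrite f1.
apply: ok_bseq => //=; rewrite a10.
apply: (@ok_call _ _ _ _ _ [:: 5; 6; 7] [:: 2] (fun _ a' => a' 2 = P)) => //.
  have := @ok_copyarr n q E K qn 2 0 13 (upd g1 13 (size P)) a1; rewrite upd_eq a10 take_size.
  by apply=> //; lia.
move=> g2 a2 [h1 h2] e2.
have sB : sol (a2 2) by rewrite e2.
apply: (ok_call (ok_parentarr G valid_q qn g2 sB)) => // g3 a3 [k1 k2]; rewrite e2 => -[a33 g313].
have a32 : a3 2 = P by rewrite k2.
have g32 : g3 2 = o by rewrite k1 // h1.
apply: ok_bseq => //=.
  by rewrite !(upd_eq, upd_ne) // a32 g313; split=> //; split=> //; split=> //; case: (P) P0.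
rewrite !(upd_eq, upd_ne) // a32 a33 g313; set g4 := upd _ 13 _.
have g40 : g4 0 = nth 0 P (parent_pos n E K P) by [].
have g44 : g4 4 = nth 0 P 0 by [].
have g413 : g4 13 = size (parent n E K P) by [].
have g42 : g4 2 = o by [].
clearbody g4.
apply: (@ok_call _ _ _ _ _ [:: 5; 6; 7] [:: 0] (fun _ a' => a' 0 = parent n E K P)) => //.
  have := @ok_copyarr n q E K qn 0 3 13 g4 a3; rewrite g413 a33 take_size.
  by apply=> //; lia.
move=> g5 a5 [m1 m2] e5.
apply: (@ok_call _ _ _ _ _ [:: 5; 6; 7; 8] [::] (fun g' _ => g' 8 = index (g5 4) (a5 0))) => //.
  by apply: ok_indexarr => //; rewrite e5; lia.
move=> g6 a6 [p1 p2]; rewrite (m1 4) // g44 e5 => e68.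
have hi : index (nth 0 P 0) (parent n E K P) <= size (parent n E K P) := index_size _ _.
apply: ok_block => //=; rewrite !(upd_eq, upd_ne) // e68.
  by split=> //; split=> //; lia.
have -> : g6 0 = g4 0 by rewrite p1 // m1.
have -> : g6 2 = o by rewrite p1 // m1.
by rewrite p2 // e5 g40; split=> //; case: (o).
Qed.

Lemma ok_body d g a : dstate_ok d -> ~~ final n d -> drepr d g a -> g 3 = 1 ->
  ok (dstep d).1 step_time all_regs all_arrays body g a
    (fun g' a' => drepr (dstep d).2 g' a' /\ g' 3 = 1).
Proof.
case: d => [[[P v] j] o] [nP vn jP] nf [a0 g0 g1 g2] g3.
have sP := node_size valid_q nP.
have vP : valid P by case: nP => [->|[]] //; apply: valid_nil.
have tst : 120 * q.+2 <= (sweep_time n q) := sweep_time_ge.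
have lsw : 2 * (sweep_time n q) <= q.+2 * (sweep_time n q) by rewrite leq_mul2r orbT.
apply: (@ok_le _ _ _ _ _ (2 + ((test_time n q) + 200 * q.+2 + 20).+2)); last first.
  by rewrite /step_time /test_time; lia.
apply: ok_bseq => //=; rewrite !(upd_eq, upd_ne) // g0.
set g4 := upd _ 7 _.
have e40 : g4 0 = v by rewrite /g4 !upd_ne. have e41 : g4 1 = j by rewrite /g4 !upd_ne.
have e42 : g4 2 = o by rewrite /g4 !upd_ne. have e43 : g4 3 = 1 by rewrite /g4 !upd_ne.
have e47 : g4 7 = n - v by [].
clearbody g4.
apply: ok_if; rewrite e47 => hv; last first.
  have vn' : v = n by lia.
  move: nf; rewrite /final /= vn' eqxx /= => nf.
  have {nP} sol_P : sol P by case: nP nf => // ->; rewrite eqxx.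
  apply: (@ok_le _ _ _ _ _ (2 + ((parent_time n q) + 200 * q.+2).+2)); last first.
    by rewrite /test_time /parent_time; lia.
  apply: ok_bseq => //=; rewrite a0 ltnn.
  have ei : parent_info n E K P = (parent n E K P, nth 0 P (parent_pos n E K P), nth 0 P 0) by [].
  apply: ok_if => /=; rewrite upd_eq => hs; last by move: nf; rewrite -size_eq0 hs.
  have s0 : sol (a 0) by rewrite a0.
  rewrite -{1}a0.
  apply: (ok_conseq (@ok_ascend (upd g4 7 (size P)) a o s0 _)) => //.
  move=> g' a' [k1 k2] [h1 h2 h3 h4]; rewrite a0 in h1 h2 h3; split=> //.
  by rewrite k1.
have {vn} vn : v < n by lia.
rewrite /= vn.
apply: (@ok_le _ _ _ _ _ (5 + ((test_time n q) + (80 * q.+2).+2).+2)); last by lia.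
apply: ok_bseq => //=; rewrite !(upd_eq, upd_ne) // a0; first by split=> //; split=> //; lia.
rewrite e41; set g5 := upd _ 7 _.
have e50 : g5 0 = v by rewrite /g5 !upd_ne. have e51 : g5 1 = j by rewrite /g5 !upd_ne.
have e52 : g5 2 = o by rewrite /g5 !upd_ne. have e53 : g5 3 = 1 by rewrite /g5 !upd_ne.
have e57 : g5 7 = (size P).+1 - j by [].
clearbody g5.
apply: ok_if; rewrite e57 => hj; last first.
  have jl : (j <= size P) = false by lia.
  rewrite jl; apply: ok_block => //=.
    by rewrite e50; split=> //; lia.
    by lia.
  by rewrite !(upd_eq, upd_ne) // e50 e52 e53.
have jl : j <= size P by lia.
rewrite jl.
set s := nth v P j; set C := child n E K P v s.
have va : valid (a 0) by rewrite a0. have g5n : g5 0 < n by rewrite e50.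
have sn : s < n := nth_valid_lt _ vP vn.
have sC : sol C := sol_child G _ _ sn.
apply: (ok_call (ok_testarr G valid_q qn va g5n)) => // g6 a6 [k1 k2].
rewrite e50 e51 a0 -/s -/C => -[c2 e614].
have e60 : g6 0 = v by rewrite k1. have e61 : g6 1 = j by rewrite k1.
have e62 : g6 2 = o by rewrite k1. have e63 : g6 3 = 1 by rewrite k1.
have a60 : a6 0 = P by rewrite k2.
case: ifP e614 => hC e614; apply: ok_if; rewrite e614 //= => _; last first.
  apply: ok_block => //=; first by rewrite e61; split=> //; lia.
  by rewrite !(upd_eq, upd_ne) // e61 e63.
have vC : valid (a6 2) by rewrite c2; case: sC.
have := ok_descend vC e62; rewrite c2 /out_if => h.
apply: (ok_conseq h) => // g' a' [p1 p2] [h1 h2 h3 h4]; split=> //.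
by rewrite p1.
Qed.

Lemma ok_body_final d g a : final n d -> drepr d g a ->
  ok [::] 20 all_regs all_arrays body g a (fun g' _ => g' 3 = 0).
Proof.
case: d => [[[P v] j] o] /andP[/eqP -> /eqP ->] [a0 g0 g1 g2].
apply: (@ok_le _ _ _ _ _ (2 + (2 + 2.+2).+2)); last by [].
apply: ok_bseq => //=; rewrite !(upd_eq, upd_ne) // g0 subnn.
apply: ok_if => //= _; apply: ok_bseq => //=; rewrite a0 /=.
by apply: ok_if => //= _; apply: ok_block.
Qed.

End Main.

(** * Delay *)

Inductive chunks D : seq (seq (seq nat)) -> seq event -> Prop :=
| Chunks0 : chunks D [::] [::]
| ChunksS lab e ls evs : emits lab e -> size e <= D -> chunks D ls evs ->
    chunks D (lab :: ls) (e ++ evs).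

Lemma chunks_blocks D ls evs : chunks D ls evs -> blocks [::] evs = flatten ls.
Proof. by elim=> //= lab e {}ls {}evs he _ _ IH; rewrite he IH. Qed.

Definition is_sep (e : event) := if e is ESep then true else false.

Lemma emits_sep lab e : emits lab e -> lab != [::] -> has is_sep e.
Proof.
move=> /(_ [::]); rewrite !cats0 => <-.
by elim: e [::] => //= -[|v|] e IH cur //; apply: IH.
Qed.

(** A chunk with an output contains a separator. A prefix without one therefore crosses at most
    [g - c] silent chunks and ends inside one more. *)
Lemma sep_free_prefix D g c ls evs W : chunks D ls evs -> gaps g c ls != None ->
  W <= size evs -> ~~ has is_sep (take W evs) -> W <= D * (g - c) + D.
Proof.
move=> h; elim: h c W => [|lab e {}ls {}evs he hs _ IH] c W /=.
  by move=> _; rewrite leqn0 => /eqP->.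
rewrite size_cat take_cat; case: lab he => [|x lab] he; last first.
  move=> _ _; case: ltnP => [h _|_].
    by apply: leq_trans (leq_addl _ _); apply: leq_trans (ltnW h) hs.
  by rewrite has_cat (emits_sep he).
case: ltnP => // cg hg hW; case: ltnP => [h _|h]; first by nia.
rewrite has_cat negb_or => /andP[_ /(IH _ _ hg)]; rewrite leq_subLR => /(_ hW).
nia.
Qed.

(** Compared with a prefix, a window adds the rest of the chunk in which it starts; this gives
    [g.+2] chunks in all. *)
Lemma sep_free_window D g c ls evs t W : chunks D ls evs -> gaps g c ls != None ->
  t + W <= size evs -> ~~ has is_sep (take W (drop t evs)) -> W <= D * g.+2.
Proof.
move=> h; elim: h c t => [|lab e {}ls {}evs he hs hc IH] c t /=.
  by rewrite leqn0 addn_eq0 => _ /andP[_ /eqP->].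
move=> hg; have {hg} [c' hg] : exists c', gaps g c' ls != None.
  by case: lab hg he => [|? ?]; [case: ifP => // _; exists c.+1|exists 0].
rewrite size_cat drop_cat; case: ltnP => ht hW; last first.
  by move=> hn; apply: (IH c' (t - size e)) => //; lia.
have sd : size (drop t e) <= D by rewrite size_drop; lia.
rewrite take_cat; case: ltnP => h; first by nia.
rewrite has_cat negb_or => /andP[_] /(sep_free_prefix hc hg).
rewrite !size_drop in h sd *; move=> /(_ _)H.
have : W - (size e - t) <= D * (g - c') + D by apply: H; lia.
nia.
Qed.

(** * The complete run of the compiled program *)

Section Run.
Variables (n q : nat) (E K : rel nat).
Hypothesis G : black_white n E K.
Hypothesis valid_q : forall X, valid n E K X -> size X <= q.
Hypothesis qn : q <= n.

Notation exec := (exec n q E K).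
Definition chunk_time := (step_time n q).+2.

(** The appended empty label is the last pass, in which the body finds the root exhausted and clears
    scalar 3. *)
Lemma exec_loop d ls d' g a : drun n E K d ls d' -> final n d' -> drepr d g a -> g 3 = 1 ->
  exists g' a' evs,
    (forall t, exec (While 3 body) (State g a t) (State g' a' (t ++ evs))) /\
    chunks chunk_time (rcons ls [::]) evs.
Proof.
move=> h fd; elim: h fd g a => {d ls d'} [d|d ls d' hd nf _ IH] fd g a hr g3.
  have [g' [a' [evs [h1 h2 h3 _ h5]]]] := ok_body_final q E K fd hr.
  exists g', a', (ENone :: evs ++ [:: ENone; ENone]); split.
    move=> t; apply: (XWhileT (s := State g a t) _ (h1 (rcons t ENone))); first by rewrite /= g3.
    have -> : t ++ ENone :: evs ++ [:: ENone; ENone] = rcons (rcons (rcons t ENone ++ evs) ENone) ENone.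
      by rewrite -!cats1 -!catA.
    exact: XWhileF.
  rewrite -[_ :: _]cats0; apply: ChunksS; last exact: Chunks0.
    by apply/emits_cons => es; rewrite -catA h2.
  by rewrite /= size_cat /= /chunk_time /step_time /sweep_time; nia.
have [g1 [a1 [e1 [h1 h2 h3 _ [h5 h6]]]]] := ok_body G valid_q qn hd nf hr g3.
have [g' [a' [evs [k1 k2]]]] := IH fd g1 a1 h5 h6.
exists g', a', ((ENone :: rcons e1 ENone) ++ evs); split.
  move=> t; apply: (XWhileT (s := State g a t) _ (h1 (rcons t ENone))); first by rewrite /= g3.
  have := k1 (rcons (rcons t ENone ++ e1) ENone).
  by rewrite /tick /= -!cats1 -!catA.
rewrite rcons_cons; apply: ChunksS => //; first by apply/emits_cons/emits_rcons.
by rewrite /= size_rcons /chunk_time.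
Qed.

Definition clique_program : program := compile 0 main.

Lemma run_program (I := Input n E K) : exists T evs ls,
  [/\ halts_at clique_program I T, size evs = T,
      forall i, i < T -> nth ENone evs i = event_at clique_program I i,
      space_le clique_program I T (mem_size q) 6 &
      [/\ chunks chunk_time ls evs, gaps (gap n q) 0 ls != None, uniq (flatten ls) &
          forall Y, Y \in flatten ls <-> sol n E K (rev Y)]].
Proof.
have [ls [d1 u1 m1 [c1 g1 hc1]]] := search_all G valid_q.
pose s0 := State (fun=> 0) (fun=> [::]) [::].
pose l0 := [:: AConst 2 1; AConst 3 1].
have [||g' [a' [evs [h1 h2]]]] := exec_loop (g := rg (block_sem n E K l0 s0))
    (a := fun=> [::]) d1 _ _ erefl.
- by rewrite /= eqxx.
- by [].
have x0 : exec main s0 (State g' a' ([:: ENone; ENone] ++ evs)).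
  by apply: XSeq (h1 _); apply: (@XBlock n q E K l0 s0).
have r0 : represents n q s0 (fun=> 0).
  split=> //=.
  by split=> //= x i; rewrite nth_nil.
have [|ev [m' [t1 sg hr]]] := compile_correct (P := clique_program) (off := 0) qn x0 main_ok _ r0.
  by move=> i.
have eev : ev = [:: ENone; ENone] ++ evs by rewrite -[ev]cat0s -[[::]]/(tr s0) -t1.
have [k1 k2 k3] := segment_conf (t := 0) sg erefl.
rewrite add0n in k1 k3; have k3' i : i < size ev -> nth ENone ev i = event_at clique_program I i.
  by move=> hi; rewrite k3.
exists (size ev), ev, ([::] :: rcons ls [::]); split=> //.
- have hp : nth IHalt clique_program (0 + csize main) = IHalt.
    by rewrite nth_default // size_compile.
  split; first by rewrite -k1 /halted [pc _]/(0 + csize main) hp.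
  by move=> t ht; have [] := k2 t ht.
- move=> t; rewrite leq_eqVlt => /orP[/eqP->|ht]; last by have [_ []] := k2 t ht.
  by rewrite -k1; have [_ _ _ []] := hr.
split.
- by rewrite eev; apply: ChunksS => //; rewrite /chunk_time.
- by rewrite /= -cats1 gaps_cat g1 /= hc1.
- by rewrite /= -cats1 flatten_cat cats0.
by move=> Y; rewrite /= -cats1 flatten_cat cats0.
Qed.

End Run.

(** * From sequences of numbers to vertex sets *)

Section Sets.
Variables (n : nat) (e b : rel 'I_n).
Hypotheses (esym : symmetric e) (eirr : irreflexive e) (bsym : symmetric b).

Let E : rel nat := lift_rel e.
Let K : rel nat := lift_rel (black_edge e b).
Notation vset := (as_vset n).

Lemma lift_relE (r : rel 'I_n) (x y : 'I_n) : lift_rel r x y = r x y.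
Proof. by rewrite /lift_rel !valK. Qed.

Lemma lift_relP (r : rel 'I_n) x y : lift_rel r x y ->
  exists x' y' : 'I_n, [/\ x = x', y = y' & r x' y'].
Proof.
rewrite /lift_rel; case: insubP => // x' _ <-; case: insubP => // y' _ <- h.
by exists x', y'.
Qed.

Lemma lift_sym (r : rel 'I_n) : symmetric r -> symmetric (lift_rel r).
Proof.
move=> rs x y; rewrite /lift_rel; case: (insub x) => [x'|]; case: (insub y) => [y'|] //.
Qed.

Lemma black_sym : symmetric (black_edge e b).
Proof. by move=> x y; rewrite /black_edge esym bsym. Qed.

Lemma graph_black_white : black_white n E K.
Proof.
split.
- exact: lift_sym.
- by move=> x; apply/negP => /lift_relP[x' [y' [-> /val_inj <-]]]; rewrite eirr.
- by move=> x y /lift_relP[x' [y' [-> _ _]]].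
- exact/lift_sym/black_sym.
by move=> x y /lift_relP[x' [y' [-> ->]]] /andP[h _]; rewrite /E lift_relE.
Qed.
Let G := graph_black_white.

Lemma mem_vset (X : seq nat) (i : 'I_n) : (i \in vset X) = (val i \in X).
Proof. by rewrite inE. Qed.

Lemma vset_inj (X Y : seq nat) : (forall x, x \in X -> x < n) -> (forall y, y \in Y -> y < n) ->
  vset X = vset Y -> X =i Y.
Proof.
move=> hX hY /setP h x; apply/idP/idP => hx.
  by have := h (Ordinal (hX _ hx)); rewrite !mem_vset /= hx.
by have := h (Ordinal (hY _ hx)); rewrite !mem_vset /= hx.
Qed.

Lemma card_vset X : valid n E K X -> #|vset X| = size X.
Proof.
move=> vX; rewrite cardE -(size_map val); apply/perm_size/uniq_perm.
- by rewrite map_inj_uniq ?enum_uniq //; apply: val_inj.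
- exact: (valid_uniq G vX).
move=> x; apply/mapP/idP => [[i]|hx]; first by rewrite mem_enum mem_vset => h ->.
by exists (Ordinal (proj1 vX _ hx)); rewrite // mem_enum mem_vset.
Qed.

Notation in_black C := [rel u v | [&& u \in C, v \in C & black_edge e b u v]].

Lemma vset_bc_clique X : X != [::] -> valid n E K X -> bc_clique e b (vset X).
Proof.
move=> X0 vX; apply/and3P; split.
- apply/forall_inP => x hx; apply/forall_inP => y hy; apply/implyP => xy.
  rewrite !mem_vset in hx hy; rewrite -lift_relE.
  exact: (valid_clique G vX).
- case: X X0 vX => // x X _ vX; apply/set0Pn.
  have hx : x < n by apply: (proj1 vX); rewrite mem_head.
  by exists (Ordinal hx); rewrite mem_vset mem_head.
apply/forall_inP => x hx; apply/forall_inP => y hy; apply/negPn/negP => nxy.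
set r := (X in connect X) in nxy.
(* The vertices reachable from [x] would form a cut of [X] separating [x] from [y]; the black edge
   that crosses it extends reachability. *)
pose Y m := if insub m is Some i then connect r x i else false.
rewrite !mem_vset in hx hy.
have Yx : Y x by rewrite /Y valK connect0.
have Yy : ~~ Y y by rewrite /Y valK.
have [u [w [uX wX Yu Yw k]]] := valid_exit G vX hx Yx hy Yy.
case/lift_relP: k => w' [u' [ew eu k]]; subst u w.
case/negP: Yw; move: Yu; rewrite /Y !valK => xu.
apply: connect_trans xu (connect1 _).
by rewrite /r /= !mem_vset uX wX black_sym.
Qed.

Lemma connect_exit (T : finType) (r : rel T) (A : {pred T}) x y :
  connect r x y -> x \in A -> y \notin A -> exists u w, [/\ u \in A, w \notin A & r u w].
Proof.
move=> /connectP[p]; elim: p x => [|z p IH] x /=; first by move=> _ -> ->.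
case/andP=> rxz pz ey xA yA; case: (boolP (z \in A)) => zA; first exact: IH pz ey zA yA.
by exists x, z.
Qed.

(** Connectivity of [C] gives a black edge from [X] to a vertex of [C] outside [X], and the clique
    property makes that vertex a candidate. With [F] membership in [C] this shows that [C] can be
    exhausted; with [predT] it gives maximality. *)
Lemma bc_exit (C : {set 'I_n}) (X : seq nat) (F : pred nat) : bc_clique e b C -> X != [::] -> valid n E K X ->
  {subset vset X <= C} -> vset X != C -> (forall i, i \in C -> F (val i)) ->
  exists u, cand E K F X u.
Proof.
move=> /and3P[cl _ con] X0 vX sXC ne hF.
have [y yC yX] : exists2 y, y \in C & y \notin vset X.
  apply/exists_inP; apply: contraR ne => /exists_inPn h; apply/eqP/setP => i.
  by apply/idP/idP => [/sXC //|/h]; rewrite negbK.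
have [x xX] : exists x, x \in vset X.
  by have /and3P[_ /set0Pn] := vset_bc_clique X0 vX.
have xC := sXC _ xX.
have /forall_inP/(_ y yC) xy := forall_inP con x xC.
have [u [w [uX wX /and3P[uC wC uw]]]] := connect_exit xy xX yX.
exists (val w); apply/and3P; split; first exact: hF.
  apply/allP => z zX; have zn := proj1 vX _ zX.
  have -> : z = Ordinal zn by [].
  rewrite /E lift_relE.
  have zC : Ordinal zn \in C by apply: sXC; rewrite mem_vset.
  have /forall_inP/(_ _ zC)/implyP := forall_inP cl w wC; apply.
  by apply: contraNneq wX => ->; rewrite mem_vset.
apply/hasP; exists (val u); first by rewrite -mem_vset.
by rewrite /K lift_relE black_sym.
Qed.

Lemma bc_clique_valid C : bc_clique e b C ->
  exists X, [/\ X != [::], valid n E K X & vset X = C].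
Proof.
move=> bc; have /and3P[_ /set0Pn[x xC] _] := bc.
pose F := mem [seq val i | i <- enum C].
have hF i : i \in C -> F (val i).
  by move=> iC; apply/mapP; exists i; rewrite ?mem_enum.
have vx : valid n E K [:: val x] by apply: valid1; apply: ltn_ord.
pose X := complete n E K F [:: val x].
have vX : valid n E K X := complete_valid G F vx.
have X0 : X != [::] by apply: complete_neq0.
exists X; split=> //; apply/eqP/negPn/negP => ne.
have sXC : {subset vset X <= C}.
  move=> i; rewrite mem_vset => /(greedy_mem (complete_greedy G F vx)).
  case=> [|/mapP[j]]; first by rewrite inE => /eqP/val_inj->.
  by rewrite mem_enum => jC /val_inj->.
have [u cu] := bc_exit bc X0 vX sXC ne hF.
by have := complete_max G F u vx; rewrite cu.
Qed.

Lemma sol_maximal X : sol n E K X -> maximal_bc_clique e b (vset X).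
Proof.
case=> X0 vX _ mX; split; first exact: vset_bc_clique.
move=> D bD /subsetP sXD; apply/eqP/negPn/negP => ne.
have [|u cu] := bc_exit (F := predT) bD X0 vX sXD _ (fun _ _ => isT).
  by rewrite eq_sym.
by have := mX u; rewrite cu.
Qed.

Lemma maximal_sol C : maximal_bc_clique e b C -> exists2 X, sol n E K X & vset X = C.
Proof.
case=> bc mx; have [X [X0 vX eC]] := bc_clique_valid bc.
have hm := mem_canon G vX.
exists (canon n E K X); last by rewrite -eC; apply/setP => i; rewrite !mem_vset hm.
apply: sol_canon => // u; apply/negP => cu.
have vXu := valid_rcons G vX cu.
have un := cand_lt G cu.
have : vset (rcons X u) = C.
  apply: mx; first by apply: vset_bc_clique => //; case: (X).
  by rewrite -eC; apply/subsetP => i; rewrite !mem_vset mem_rcons inE => ->; rewrite orbT.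
rewrite -eC => /setP/(_ (Ordinal un)); rewrite !mem_vset mem_rcons mem_head.
by rewrite (negPf (cand_notin G cu)).
Qed.

Let q := max_bc_size e b.

(** This turns the array bound of the program into the parameter of the statement. *)
Lemma valid_max_size X : valid n E K X -> size X <= q.
Proof.
case: (altP (X =P [::])) => [->//|X0] vX; rewrite -card_vset //.
by apply: leq_bigmax_cond; apply: vset_bc_clique.
Qed.

Lemma max_size_le : q <= n.
Proof. by apply/bigmax_leqP => C _; rewrite -[n in _ <= n]card_ord max_card. Qed.

Lemma max_size_gt0 : 0 < n -> 0 < q.
Proof. by move=> h; apply: (@valid_max_size [:: 0]); apply: valid1. Qed.

Lemma vset_rev Y : vset (rev Y) = vset Y.
Proof. by apply/setP => i; rewrite !mem_vset mem_rev. Qed.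

Lemma sols_enumerate outs : uniq outs -> (forall Y, Y \in outs <-> sol n E K (rev Y)) ->
  enumerates_maximal_bc_cliques e b outs.
Proof.
move=> u h.
have lt Y : Y \in outs -> forall y, y \in rev Y -> y < n.
  by case/h => _ [vY _] _ _ y /vY.
split; last split.
- by apply/allP => Y hY; apply/allP => y yY; apply: (lt Y hY); rewrite mem_rev.
- rewrite map_inj_in_uniq // => Y Z hY hZ; rewrite -(vset_rev Y) -(vset_rev Z) => eYZ.
  have em := vset_inj (lt _ hY) (lt _ hZ) eYZ.
  have [/h[_ vY cY _] /h[_ vZ cZ _]] := (hY, hZ).
  by rewrite -(revK Y) -(revK Z) -cY -cZ (canon_eq_mem G vY em).
move=> C; split=> [/mapP[Y /h sY ->]|/maximal_sol[X sX <-]].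
  by rewrite -vset_rev; apply: sol_maximal.
by apply/mapP; exists (rev X); rewrite ?vset_rev //; apply/h; rewrite revK.
Qed.

End Sets.

(** A pass costs O(q^3 n) and O(n q) passes may be silent, so the left side has order q^4 n^2; a
    factor [q] remains as slack. For [n = 0] the summand 1 suffices; otherwise a single vertex gives
    [0 < q], so [q.+2] and [n.+1] are at most [3 * q] and [2 * n]. *)
Lemma delay_arith n q : q <= n -> (0 < n -> 0 < q) ->
  (chunk_time n q * (gap n q).+2).+1 <= 1000 * 1000 * (q ^ 5 * n ^ 2 + 1).
Proof.
move=> qn q0; rewrite /chunk_time /step_time /sweep_time /gap /bound.
case: (posnP n) => [n0|n0].
  have -> : q = 0 by lia.
  by rewrite n0; lia.
have {q0} q1 := q0 n0.
have e3 : q ^ 3 = q * q * q by rewrite !expnS expn0 muln1 mulnA.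
have e5 : q ^ 5 = q ^ 3 * (q * q) by rewrite !expnS expn0 muln1 !mulnA.
have hL : q.+2 <= 3 * q by lia.
have hN : n.+1 <= 2 * n by lia.
have h3 : q.+2 * (120 * (q.+2 * q.+2 * n.+1)) <= 54 * 120 * (q ^ 3 * n).
  apply: (@leq_trans ((3 * q) * (120 * ((3 * q) * (3 * q) * (2 * n))))); last by rewrite e3; lia.
  by rewrite !leq_mul.
have h1 : n * q.+2 <= 3 * (n * q) by nia.
apply: (@leq_trans (65 * 1000 * (q ^ 3 * n) * (11 * (n * q))).+1).
  rewrite ltnS; apply: leq_mul; last by nia.
  have : 0 < q ^ 3 * n by rewrite muln_gt0 expn_gt0 q1.
  lia.
have h4 : q ^ 3 * n * (n * q) <= q ^ 5 * n ^ 2.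
  have -> : q ^ 5 * n ^ 2 = q ^ 3 * n * (n * q) * q by rewrite e5 -mulnn; lia.
  by rewrite leq_pmulr.
lia.
Qed.

Theorem mainTheorem10 :
  exists (P : program) (c k : nat),
  forall (n : nat) (e b : rel 'I_n),
    symmetric e -> irreflexive e -> symmetric b ->
    let I := graph_input e b in
    let q := max_bc_size e b in
    exists T : nat,
      [/\ halts_at P I T,
          enumerates_maximal_bc_cliques e b (outputs P I T),
          delay_le P I T (c * (q ^ 5 * n ^ 2 + 1))
        & space_le P I T (c * (q + 1)) k].
Proof.
exists clique_program, (1000 * 1000), 6 => n e b esym eirr bsym I q.
have G := graph_black_white esym eirr bsym.
have qn := max_size_le e b.
have vq := valid_max_size esym eirr bsym.
have [T [evs [ls [h1 h2 h3 h4 [h5 h6 h7 h8]]]]] := run_program G vq qn.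
exists T; split=> //.
- have -> : outputs clique_program I T = flatten ls.
    rewrite -(chunks_blocks h5) /outputs; congr blocks.
    apply: (@eq_from_nth _ ENone); rewrite size_map size_iota // => i hi.
    by rewrite (nth_map 0) ?size_iota // nth_iota // h3.
  exact: sols_enumerate.
- move=> t ht; have da := delay_arith qn (max_size_gt0 esym eirr bsym).
  set D := (_ * _ * _) in ht da *.
  have : has is_sep (take D (drop t evs)).
    apply: contraLR da => ns; rewrite -ltnNge ltnS.
    by apply: sep_free_window h5 h6 _ ns; rewrite h2.
  case/(has_nthP ENone)=> i; rewrite size_take_min size_drop leq_min => /andP[iD it].
  rewrite nth_take // nth_drop => hs.
  have hT : t + i < T by rewrite -h2; lia.
  exists (t + i); first by rewrite leq_addr ltn_add2l.
  by rewrite -h3 //; case: nth hs.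
move=> t ht; have [h9 h10] := h4 t ht; split=> // a ha; apply: h9.
by apply: leq_trans ha; rewrite /mem_size -/q; lia.
Qed.
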